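(* Let $n=3$, $s_0,s_1,s_2\in\mathbb{R}$ and $b_2>\frac12$. Assume $s_0+s_1+s_2\ge\frac32$ and $s_0+s_1+s_2\ge\max(s_0,s_1,s_2)$, and that these two inequalities are not both equalities. Then $\begin{pmatrix} s_0 & s_1 & s_2\\ 0 & 0 & b_2\end{pmatrix}$ is a product.
   Context: For $u\in\mathcal S(\mathbb{R}^{1+n})$ let $\widetilde u(\tau,\xi)=\iint e^{-i(t\tau+x\cdot\xi)}u(t,x)\,dt\,dx$, $(\tau,\xi)\in\mathbb{R}\times\mathbb{R}^n$, and $\langle x\rangle=(1+|x|^2)^{1/2}$. For $s,b\in\mathbb{R}$ the wave-Sobolev space $H^{s,b}=H^{s,b}(\mathbb{R}^{1+n})$ is the completion of $\mathcal S(\mathbb{R}^{1+n})$ with respect to the norm $\|u\|_{H^{s,b}}=\|\langle\xi\rangle^s\langle|\tau|-|\xi|\rangle^b\widetilde u(\tau,\xi)\|_{L^2_{\tau,\xi}}$. A real matrix $\begin{pmatrix} s_0 & s_1 & s_2\\ b_0 & b_1 & b_2\end{pmatrix}$ is called a product (in dimension $n$) if there is a constant $C$ such that $\|uv\|_{H^{-s_0,-b_0}}\le C\|u\|_{H^{s_1,b_1}}\|v\|_{H^{s_2,b_2}}$ for all $u,v\in\mathcal S(\mathbb{R}^{1+n})$. *)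

(* Defs.v *)
From HB Require Import structures.
From mathcomp Require Import all_boot all_order all_algebra.
From mathcomp Require Import all_classical all_reals all_analysis.
Set Implicit Arguments. Unset Strict Implicit. Unset Printing Implicit Defensive.
Import Order.TTheory GRing.Theory Num.Theory.
Import numFieldNormedType.Exports.
Local Open Scope ring_scope.

Section WaveSobolev.
Variable R : realType.

Definition pt (t x1 x2 x3 : R) : 'rV[R]_4 := \row_(i < 4) [:: t; x1; x2; x3]`_i.

Definition int1 (f : R -> R) : R := Rintegral lebesgue_measure setT f.
Definition int4 (F : R -> R -> R -> R -> R) : R :=
  int1 (fun t => int1 (fun a => int1 (fun b => int1 (fun c => F t a b c)))).
Definition eint1 (f : R -> \bar R) : \bar R :=
  (\int[lebesgue_measure]_(x in setT) f x)%E.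
Definition eint4 (F : R -> R -> R -> R -> \bar R) : \bar R :=
  eint1 (fun t => eint1 (fun a => eint1 (fun b => eint1 (fun c => F t a b c)))).

Inductive pderiv_of (f : 'rV[R]_4 -> R) : ('rV[R]_4 -> R) -> Prop :=
| pd_self : pderiv_of f f
| pd_step (g : 'rV[R]_4 -> R) (k : 'I_4) :
    pderiv_of f g -> pderiv_of f (fun x => 'D_(delta_mx 0 k) g x).

Definition rschwartz (f : 'rV[R]_4 -> R) : Prop :=
  (forall g, pderiv_of f g -> forall (k : 'I_4) (x : 'rV[R]_4),
      derivable g x (delta_mx 0 k)) /\
  (forall g, pderiv_of f g -> forall alpha : 'I_4 -> nat,
      exists M : R, forall x : 'rV[R]_4,
        `|(\prod_(i < 4) x 0 i ^+ alpha i) * g x| <= M).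

(* Complex-valued functions on R^4, as (real part, imaginary part). *)
Definition cfun := (('rV[R]_4 -> R) * ('rV[R]_4 -> R))%type.

Definition schwartz (u : cfun) : Prop := rschwartz u.1 /\ rschwartz u.2.

Definition cmul (u v : cfun) : cfun :=
  (fun x => u.1 x * v.1 x - u.2 x * v.2 x,
   fun x => u.1 x * v.2 x + u.2 x * v.1 x).

(* Space-time Fourier transform
   u~(tau,xi) = \iint e^{-i(t tau + x.xi)} u(t,x) dt dx,
   real and imaginary parts. *)
Definition phase (tau xi1 xi2 xi3 t a b c : R) : R :=
  t * tau + a * xi1 + b * xi2 + c * xi3.
Definition ft_re (u : cfun) (tau xi1 xi2 xi3 : R) : R :=
  int4 (fun t a b c => let p := phase tau xi1 xi2 xi3 t a b c in
     u.1 (pt t a b c) * cos p + u.2 (pt t a b c) * sin p).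
Definition ft_im (u : cfun) (tau xi1 xi2 xi3 : R) : R :=
  int4 (fun t a b c => let p := phase tau xi1 xi2 xi3 t a b c in
     u.2 (pt t a b c) * cos p - u.1 (pt t a b c) * sin p).

Definition jbr (y : R) : R := Num.sqrt (1 + y ^+ 2).
Definition norm3 (xi1 xi2 xi3 : R) : R := Num.sqrt (xi1 ^+ 2 + xi2 ^+ 2 + xi3 ^+ 2).

Definition Hsb_norm (s b : R) (u : cfun) : \bar R :=
  sqrte (eint4 (fun tau xi1 xi2 xi3 =>
    EFin (((powR (jbr (norm3 xi1 xi2 xi3)) s
       * powR (jbr (`|tau| - norm3 xi1 xi2 xi3)) b) ^+ 2
      * (ft_re u tau xi1 xi2 xi3 ^+ 2 + ft_im u tau xi1 xi2 xi3 ^+ 2))))).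

Definition is_product (s0 s1 s2 b0 b1 b2 : R) : Prop :=
  exists C : R, forall u v : cfun, schwartz u -> schwartz v ->
    (Hsb_norm (- s0) (- b0) (cmul u v) <= C%:E * Hsb_norm s1 b1 u * Hsb_norm s2 b2 v)%E.

End WaveSobolev.

(* Main.v *)
(** Only the regularity of v in time enters: for fixed t the claim is the Sobolev
    product law in R^3, and b2 > 1/2 makes H^{s2,b2} embed in C_t H^{s2}.

    On the Fourier side, |(uv)~| <= (2 pi)^{-4} |u~| * |v~|.  This is obtained without
    inversion or decay of u~ and v~: replacing v by its convolution with the Poisson
    kernel amounts to inserting the factor e^{-e |omega|_1} under the inversion integral,
    where Fubini is harmless, and the error is uniformly small because v is bounded and
    Lipschitz.

    With u~ = <xi>^{-s1} F and v~ = <xi>^{-s2} <|tau|-|xi|>^{-b2} G it remains to bound the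
    operator with kernel <xi>^{-s0} <xi-eta>^{-s1} <eta>^{-s2} <|lambda|-|eta|>^{-b2}.  The two
    largest of |xi|, |xi-eta|, |eta| are comparable, so the kernel splits into three
    pieces, each with a single low frequency, and Cauchy-Schwarz reduces each of them to
    the boundedness of <rho>^{-2a} int_{|eta| <= rho} <eta>^{-2s} d eta, where s is the
    exponent of the low frequency and a the sum of the other two.  This holds when a >= 0 and
    a + s >= 3/2, except for (a, s) = (0, 3/2), which is the excluded double equality. *)

Require Import Defs.
From HB Require Import structures.
From mathcomp Require Import all_boot all_order all_algebra.
From mathcomp Require Import all_classical all_reals all_analysis.
From mathcomp Require Import measurable_realfun ring lra.
Import Order.TTheory GRing.Theory Num.Theory.
Import numFieldNormedType.Exports.
Set Implicit Arguments. Unset Strict Implicit. Unset Printing Implicit Defensive.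
Local Open Scope classical_set_scope.
Local Open Scope ring_scope.

(** * Measure and integration *)

(** The Poisson kernel is preferred to a Gaussian because its mass and the transform of exp(-e|w|)
    both follow from explicit antiderivatives, and because at parameter 1 it also serves as decay
    majorant of a Schwartz function. Its price is an infinite first moment, so the error in
    smoothing v is measured by min(1, |z|), which uses that v is bounded besides Lipschitz. No limit
    is passed under the inversion integral: (uv)~(k) is multiplied by its own conjugate, the
    resulting number |(uv)~(k)|^2 is an integral against v, smoothing v moves it arbitrarily little,
    and only then is the Abel factor bounded by 1.

    The three frequency pieces are not alike. If eta or xi - eta is low, the kernel is square
    integrable in the integration variable, uniformly in xi. If xi is low it need not be, and the
    square has to be integrated in the output variable; the modulation weight then goes with u~ and
    the remaining factor with v~. The estimates take place in [0, +oo], so that finiteness of the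
    norms never has to be shown. *)

Section measurable_functions.
Context d (T : measurableType d) (R : realType).

Lemma measurable_fun_fst d1 d2 (T1 : measurableType d1) (T2 : measurableType d2)
  (f : T -> T1 * T2) : measurable_fun setT f -> measurable_fun setT (fun x => (f x).1).
Proof. by move=> mf; exact: (measurableT_comp measurable_fst mf). Qed.

Lemma measurable_fun_snd d1 d2 (T1 : measurableType d1) (T2 : measurableType d2)
  (f : T -> T1 * T2) : measurable_fun setT f -> measurable_fun setT (fun x => (f x).2).
Proof. by move=> mf; exact: (measurableT_comp measurable_snd mf). Qed.

Lemma measurable_fun_cos (f : T -> R) :
  measurable_fun setT f -> measurable_fun setT (fun x => cos (f x)).
Proof.
by move=> mf; apply: (measurableT_comp _ mf); apply: continuous_measurable_fun; exact: continuous_cos.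
Qed.

Lemma measurable_fun_sin (f : T -> R) :
  measurable_fun setT f -> measurable_fun setT (fun x => sin (f x)).
Proof.
by move=> mf; apply: (measurableT_comp _ mf); apply: continuous_measurable_fun; exact: continuous_sin.
Qed.

Lemma measurable_fun_sqrt (f : T -> R) :
  measurable_fun setT f -> measurable_fun setT (fun x => Num.sqrt (f x)).
Proof.
by move=> mf; apply: (measurableT_comp _ mf); apply: continuous_measurable_fun; exact: sqrt_continuous.
Qed.

Lemma measurable_fun_expR (f : T -> R) :
  measurable_fun setT f -> measurable_fun setT (fun x => expR (f x)).
Proof. by move=> mf; exact: (measurableT_comp (@measurable_expR R) mf). Qed.

Lemma measurable_fun_powR (f : T -> R) (p : R) :
  measurable_fun setT f -> measurable_fun setT (fun x => f x `^ p).
Proof. by move=> mf; exact: (measurableT_comp (measurable_powR p) mf). Qed.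

Lemma measurable_fun_norm (f : T -> R) :
  measurable_fun setT f -> measurable_fun setT (fun x => `|f x|).
Proof. by move=> mf; exact: (measurableT_comp (@normr_measurable R setT) mf). Qed.

End measurable_functions.

Ltac mfun1 := cbv beta; match goal with
  | |- measurable_fun _ (fun x => x) => exact: measurable_id
  | |- measurable_fun _ (fun _ => ?c) => exact: measurable_cst
  | |- measurable_fun _ (fun x => fst x) => exact: measurable_fst
  | |- measurable_fun _ (fun x => snd x) => exact: measurable_snd
  | |- measurable_fun _ fst => exact: measurable_fst
  | |- measurable_fun _ snd => exact: measurable_snd
  | |- measurable_fun _ (fun x => (_, _)) => apply: measurable_fun_pair
  | |- measurable_fun _ (fun x => fst _) => apply: measurable_fun_fst
  | |- measurable_fun _ (fun x => snd _) => apply: measurable_fun_snd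
  | |- measurable_fun _ (fun x => cos _) => apply: measurable_fun_cos
  | |- measurable_fun _ (fun x => sin _) => apply: measurable_fun_sin
  | |- measurable_fun _ (fun x => Num.sqrt _) => apply: measurable_fun_sqrt
  | |- measurable_fun _ (fun x => expR _) => apply: measurable_fun_expR
  | |- measurable_fun _ (fun x => powR _ _) => apply: measurable_fun_powR
  | |- measurable_fun _ (fun x => Num.norm _) => apply: measurable_fun_norm
  | |- measurable_fun _ (fun x => (_ + _)%R) => apply: measurable_funD
  | |- measurable_fun _ (fun x => (- _)%R) => apply: measurable_funN
  | |- measurable_fun _ (fun x => (_ * _)%R) => apply: measurable_funM
  | |- measurable_fun _ (fun x => (_ ^+ _)%R) => apply: measurable_funX
  | |- measurable_fun _ (fun x => Num.min _ _) => apply: measurable_minr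
  | |- _ => assumption
  | H : measurable_fun _ ?f |- measurable_fun _ (fun x => ?f _) => refine (measurableT_comp H _)
  end.

Ltac mfun := repeat mfun1.

(** * Iterated products and Fubini for integrands with a product majorant *)

Section product_measure.
Context d1 d2 (T1 : measurableType d1) (T2 : measurableType d2) (R : realType).
Variables (m1 : {sigma_finite_measure set T1 -> \bar R})
  (m2 : {sigma_finite_measure set T2 -> \bar R}).

(* m1 \x m2 packaged so that it is inferred to be sigma-finite and products can be iterated. *)
Definition pm : set (T1 * T2)%type -> \bar R := product_measure1 m1 m2.
HB.instance Definition _ := Measure.on pm.

Lemma pm_sigma_finite : sigma_finite setT pm.
Proof.
have /sigma_finiteP[F [TF ndF Foo]] := sigma_finiteT m1.
have /sigma_finiteP[G [TG ndG Goo]] := sigma_finiteT m2.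
exists (fun n => F n `*` G n) => [|k].
  rewrite -setXTT TF TG predeqE => -[x y]; split => [|[n _ [? ?]]]; last first.
    by split; exists n.
  move=> [/= [n _ Fnx] [k _ Gky]]; exists (maxn n k) => //; split.
  - by move: x Fnx; exact/subsetPset/ndF/leq_maxl.
  - by move: y Gky; exact/subsetPset/ndG/leq_maxr.
have [? ?] := Foo k; have [? ?] := Goo k.
split; first exact: measurableX.
by rewrite /pm product_measure1E// lte_mul_pinfty// ge0_fin_numE.
Qed.

HB.instance Definition _ := Measure_isSigmaFinite.Build _ _ _ pm pm_sigma_finite.

Definition prodm : {sigma_finite_measure set (T1 * T2)%type -> \bar R} := pm.

Lemma ge0_integral_prodm (f : T1 * T2 -> \bar R) :
  measurable_fun setT f -> (forall z, 0 <= f z)%E ->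
  (\int[prodm]_z f z = \int[m1]_x \int[m2]_y f (x, y))%E.
Proof. by move=> mf f0; rewrite -[RHS](fubini_tonelli1 f). Qed.

(** Tonelli makes the integrals of the positive and of the negative part measurable in x, and the
    real integral is [fine] of their difference. *)
Lemma measurable_Rintegral_l (f : T1 * T2 -> R) : measurable_fun setT f ->
  measurable_fun setT (fun x => \int[m2]_y f (x, y)).
Proof.
move=> mf; apply: (measurableT_comp (fine_measurable measurableT)).
have mEf : measurable_fun setT (EFin \o f) by exact/measurable_EFinP.
rewrite (_ : (fun x => _) = (fubini_F m2 (EFin \o f)^\+ \- fubini_F m2 (EFin \o f)^\-)%E).
  apply: emeasurable_funB; apply: measurable_fun_fubini_tonelli_F => //.
    exact: measurable_funepos.
  exact: measurable_funeneg.
apply/funext => x; rewrite integralE /fubini_F.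
by rewrite -[(fun x1 => (f (x, x1))%:E)]/((EFin \o f) \o pair x) funepos_comp funeneg_comp.
Qed.

Section dominated.
Variables (f : T1 * T2 -> R) (g : T1 -> R) (h : T2 -> R).
Hypotheses (mf : measurable_fun setT f)
  (ig : m1.-integrable setT (EFin \o g)) (ih : m2.-integrable setT (EFin \o h))
  (g0 : forall x, 0 <= g x) (h0 : forall y, 0 <= h y)
  (fgh : forall x y, `|f (x, y)| <= g x * h y).

(** A product majorant makes every section integrable, not just almost every one, so [fine] loses
    nothing inside an iterated integral. *)
Lemma dominated_section x : m2.-integrable setT (fun y => (f (x, y))%:E).
Proof.
apply: (@le_integrable _ _ _ _ _ _ _ (EFin \o (fun y => g x * h y))) => //.
- by apply/measurable_EFinP; exact: measurableT_comp mf (measurable_pair1 x).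
- by move=> y _ /=; rewrite lee_fin [leRHS]ger0_norm ?mulr_ge0.
- rewrite (_ : EFin \o _ = fun y => (g x)%:E * (h y)%:E)%E; first exact: integrableZl.
  by apply/funext => y /=; rewrite EFinM.
Qed.

Lemma dominated_integrable : prodm.-integrable setT (EFin \o f).
Proof.
have mEf : measurable_fun setT (EFin \o f) by exact/measurable_EFinP.
apply: (proj2 (@integrable12ltyP _ _ _ _ _ m1 m2 (EFin \o f) mEf)).
have mg : measurable_fun setT g by apply/measurable_EFinP; exact: measurable_int ig.
have mh : measurable_fun setT h by apply/measurable_EFinP; exact: measurable_int ih.
apply: (@le_lt_trans _ _ (\int[m1]_x ((g x)%:E * \int[m2]_y (h y)%:E))%E).
  apply: ge0_le_integral => //.
  - by move=> x _; apply: integral_ge0.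
  - apply: (@measurable_fun_fubini_tonelli_F _ _ _ _ _ _ (abse \o (EFin \o f))) => //.
    exact: measurableT_comp.
  - by move=> z; exact: abse_ge0.
  - by apply: emeasurable_funM; [exact/measurable_EFinP|exact: measurable_cst].
  - move=> x _; rewrite -ge0_integralZl//; [|exact/measurable_EFinP|by move=> y _; rewrite lee_fin|by rewrite lee_fin].
    apply: ge0_le_integral => //.
    + apply: measurableT_comp => //; apply/measurable_EFinP.
      exact: measurableT_comp mf (measurable_pair1 x).
    + by apply/measurable_EFinP; mfun.
    + by move=> y _ /=; rewrite -EFinM lee_fin.
have h_fin : (\int[m2]_y (h y)%:E)%E \is a fin_num by exact: integrable_fin_num.
under eq_integral do rewrite muleC.
rewrite ge0_integralZl//; [|exact/measurable_EFinP|by move=> y _; rewrite lee_fin|by apply: integral_ge0 => y _; rewrite lee_fin].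
by rewrite ltey_eq fin_numM//; exact: integrable_fin_num.
Qed.

Lemma Rintegral_prodm : \int[prodm]_z f z = \int[m1]_x \int[m2]_y f (x, y).
Proof.
rewrite /Rintegral -[X in fine X = _](@integral12_prod_meas1 _ _ _ _ _ m1 m2 (EFin \o f)); last exact: dominated_integrable.
congr fine; apply: eq_integral => x _; rewrite fineK//.
by apply: integrable_fin_num => //; exact: dominated_section.
Qed.

End dominated.
End product_measure.

Section product_swap.
Context d1 d2 (T1 : measurableType d1) (T2 : measurableType d2) (R : realType).
Variables (m1 : {sigma_finite_measure set T1 -> \bar R})
  (m2 : {sigma_finite_measure set T2 -> \bar R}).

Lemma Rintegral_swap (f : T1 * T2 -> R) (g : T1 -> R) (h : T2 -> R) :
  measurable_fun setT f ->
  m1.-integrable setT (EFin \o g) -> m2.-integrable setT (EFin \o h) ->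
  (forall x, 0 <= g x) -> (forall y, 0 <= h y) ->
  (forall x y, `|f (x, y)| <= g x * h y) ->
  \int[m1]_x \int[m2]_y f (x, y) = \int[m2]_y \int[m1]_x f (x, y).
Proof.
move=> mf ig ih g0 h0 fgh; rewrite -(Rintegral_prodm mf ig ih)//.
rewrite /Rintegral -[X in fine X = _](@integral21_prod_meas1 _ _ _ _ _ m1 m2 (EFin \o f)); last exact: dominated_integrable mf ig ih _ _ _.
congr fine; apply: eq_integral => y _; rewrite fineK//.
apply: integrable_fin_num => //.
(* Sections in the other variable are sections of the transposed function, whose majorant is the
   product with its factors exchanged. *)
have mfs : measurable_fun setT (f \o (fun z : T2 * T1 => (z.2, z.1))).
  by apply: measurableT_comp => //; mfun.
have fhg a b : `|(f \o (fun z : T2 * T1 => (z.2, z.1))) (a, b)| <= h a * g b.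
  by rewrite mulrC fgh.
exact: dominated_section mfs ig h0 g0 fhg y.
Qed.

End product_swap.

Section generic.
Context d (T : measurableType d) (R : realType) (mu : {measure set T -> \bar R}).

(** Hölder with exponents 2 and 2, squared and kept in the extended reals so that it can be
    integrated once more in an outer variable whether or not the inner integrals are finite. *)
Lemma cauchy_schwarz (f g : T -> R) : measurable_fun setT f -> measurable_fun setT g ->
  (forall x, 0 <= f x) -> (forall x, 0 <= g x) ->
  ((\int[mu]_x (f x * g x)%:E) ^+ 2 <=
    (\int[mu]_x (f x ^+ 2)%:E) * (\int[mu]_x (g x ^+ 2)%:E))%E.
Proof.
move=> mf mg f0 g0.
have sqE (k : T -> R) : (forall x, 0 <= k x) ->
    ('N[mu]_2%:E[EFin \o k] ^+ 2 = \int[mu]_x (k x ^+ 2)%:E)%E.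
  move=> k0; rewrite unlock poweR12_sqrt; last by apply: integral_ge0 => x _; exact: poweR_ge0.
  rewrite sqr_sqrte; last by apply: integral_ge0 => x _; exact: poweR_ge0.
  apply: eq_integral => x _; rewrite (_ : `|(EFin \o k) x| = (k x)%:E)%E; last by rewrite /= ger0_norm.
  by rewrite poweR_EFin powR_mulrn.
rewrite -!sqE// !expe2 muleACA.
have := @hoelder _ T R mu f g 2 2 mf mg.
have half : 2^-1 + 2^-1 = 1 :> R by lra.
move=> /(_ ltac:(lra) ltac:(lra) half).
rewrite Lnorm1 (_ : (\int[mu]_x `|(EFin \o (f \* g)%R) x|)%E = \int[mu]_x (f x * g x)%:E)%E; last first.
  by apply: eq_integral => x _ /=; rewrite ger0_norm// mulr_ge0.
move=> H; apply: lee_pmul => //; apply: integral_ge0 => x _; by rewrite lee_fin mulr_ge0.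
Qed.

Lemma integrable_le (f g : T -> R) : measurable_fun setT f ->
  mu.-integrable setT (EFin \o g) -> (forall x, `|f x| <= g x) ->
  mu.-integrable setT (EFin \o f).
Proof.
move=> mf ig fg; apply: (@le_integrable _ _ _ _ _ _ (EFin \o f) (EFin \o g)) => //.
  exact/measurable_EFinP.
by move=> x _ /=; rewrite lee_fin (le_trans (fg x))// ler_norm.
Qed.

End generic.

(** * Lebesgue measure on the line *)

Section lebesgue1.
Variable R : realType.
Local Notation RM := (measurableTypeR R).

Definition leb : {sigma_finite_measure set RM -> \bar R} := @lebesgue_measure R.

Lemma ge0_integral_addr (f : RM -> \bar R) (c : R) :
  measurable_fun setT f -> (forall x, 0 <= f x)%E ->
  (\int[leb]_x f (x + c)%R = \int[leb]_x f x)%E.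
Proof.
move=> mf f0; pose phi (x : RM) : RM := x + c.
have mphi : measurable_fun setT phi by apply: measurable_funD; mfun.
rewrite -[LHS](@ge0_integral_pushforward _ _ _ _ R phi mphi leb setT f)//.
apply/esym/eq_measure_integral => A mA _.
have mphi' : measurable_fun setT (phi : RM -> RM) by exact: mphi.
(* The image measure gives half-open intervals their length, and this determines Lebesgue
   measure. *)
apply: (@lebesgue_measure_unique R (pushforward leb phi)) => // _ [[a b]] _ <-.
transitivity (lebesgue_measure (`]a - c, b - c]%classic : set R)).
  rewrite !lebesgue_measure_itv/= !lte_fin ltrD2r -!EFinD.
  by have -> : b - c - (a - c) = b - a by ring.
congr (lebesgue_measure _); apply/seteqP; split => x.
  by rewrite /phi /= !in_itv /= ltrBlDr lerBrDr.
by rewrite /phi /= !in_itv /= ltrBlDr lerBrDr.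
Qed.

Lemma ge0_integral_oppr (f : RM -> \bar R) :
  measurable_fun setT f -> (forall x, 0 <= f x)%E ->
  (\int[leb]_x f (- x)%R = \int[leb]_x f x)%E.
Proof.
move=> mf f0; have mphi : measurable_fun setT (-%R : RM -> RM).
  by apply: measurable_funN; mfun.
rewrite -[LHS](@ge0_integral_pushforward _ _ _ _ R _ mphi leb setT f)//.
by apply: eq_measure_integral => // A mA _; exact: lebesgue_measureN.
Qed.

Lemma ge0_integral_subr (f : RM -> \bar R) (c : R) :
  measurable_fun setT f -> (forall x, 0 <= f x)%E ->
  (\int[leb]_x f (c - x)%R = \int[leb]_x f x)%E.
Proof.
move=> mf f0; have mc : measurable_fun setT (fun x : RM => f (x + c)).
  by apply: measurableT_comp => //; apply: measurable_funD; mfun.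
rewrite -[RHS](ge0_integral_addr c)// -[RHS](ge0_integral_oppr mc)//.
by apply: eq_integral => x _; rewrite addrC.
Qed.

Lemma ge0_integral_halves (f : RM -> \bar R) :
  measurable_fun setT f -> (forall x, 0 <= f x)%E ->
  (\int[leb]_x f x = \int[leb]_(x in `[0%R, +oo[) f x + \int[leb]_(x in `[0%R, +oo[) f (- x)%R)%E.
Proof.
move=> mf f0.
have mposnums : measurable [set x : RM | 0 <= x]%R by rewrite -set_itvcy.
rewrite -(setUv [set x : RM | 0 <= x]%R) ge0_integral_setU//= ; last 3 first.
  exact: measurableC.
  by rewrite setUv.
  exact/disj_setPCl.
rewrite -set_itvcy// setCitvr; congr (_ + _)%E.
rewrite integral_itv_bndo_bndc; last exact: measurable_funTS.
rewrite (@ge0_integration_by_substitution0 R (fun x => f (- x)%R))//.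
  by apply: eq_integral => x _; rewrite opprK.
by apply: measurableT_comp => //; apply: measurable_funN; mfun.
Qed.

Lemma integral0y_FTC (f F : R -> R) (l : R) :
  (forall x, 0 <= x -> 0 <= f x) ->
  (forall x, 0 <= x -> {for x, continuous (f : R -> R)}) ->
  (forall x : R, 0 <= x -> is_derive x (1:R) F (f x)) -> F x @[x --> +oo] --> l ->
  (\int[leb]_(x in `[0%R, +oo[) (f x)%:E = (l - F 0)%:E)%E.
Proof.
move=> f0 cf dF Fl; rewrite (@ge0_continuous_FTC2y R f F 0 l)//.
- apply/continuous_within_itvcyP; split => [x x0|].
    by apply: cf; move: x0; rewrite in_itv/= andbT => /ltW.
  by apply: cvg_at_right_filter; exact: cf.
- by move=> x x0; have [] := dF x (ltW x0).
- apply: cvg_at_right_filter; apply: differentiable_continuous; apply/derivable1_diffP.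
  by have [] := dF 0 (lexx _).
- move=> x; rewrite in_itv/= andbT => x0; rewrite derive1E.
  by have [] := dF x (ltW x0).
Qed.

Lemma cvg_expRN (e : R) : 0 < e -> expR (- (e * x)) @[x --> +oo] --> (0 : R).
Proof.
move=> e0; apply: (@cvg_comp _ _ _ (fun x => e * x) (fun x => expR (- x)) _ +oo).
  by apply: gt0_cvgMry => //.
exact: cvgr_expR.
Qed.

(** The antiderivative is the real part of exp((-e + ix) w + i phi) / (-e + ix), plus that of c
    exp(-e w). *)
Let dcos (e x phi c w : R) : e != 0 -> e ^+ 2 + x ^+ 2 != 0 ->
  is_derive w (1:R) (fun w => expR (- (e * w)) *
    ((x * sin (x * w + phi) - e * cos (x * w + phi)) / (e ^+ 2 + x ^+ 2) - c / e))
    (expR (- (e * w)) * (c + cos (x * w + phi))).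
Proof.
move=> e0 ex0.
pose A : R -> R := expR \o ((- e) \*: id).
pose B : R -> R := sin \o (x \*: id + cst phi).
pose C : R -> R := cos \o (x \*: id + cst phi).
have -> : (fun w => expR (- (e * w)) *
    ((x * sin (x * w + phi) - e * cos (x * w + phi)) / (e ^+ 2 + x ^+ 2) - c / e)) =
  A * ((x / (e ^+ 2 + x ^+ 2)) \*: B - (e / (e ^+ 2 + x ^+ 2)) \*: C - cst (c / e)).
  apply/funext => v; rewrite /A /B /C /= !fctE /= /GRing.scale /=.
  by rewrite mulNr; field; do ?[apply/andP; split].
apply: is_derive_eq; rewrite /A /B /C /= !fctE /= /GRing.scale /=.
by rewrite !mulNr; field; do ?[apply/andP; split].
Qed.


(* The constant c >= 1 makes the integrand nonnegative, as the improper fundamental theorem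
   of calculus requires; it is removed by subtraction in Rintegral_expcos. *)
Lemma integral0y_expcos (e x phi c : R) : 0 < e -> 1 <= c ->
  (\int[leb]_(w in `[0%R, +oo[) (expR (- (e * w)) * (c + cos (x * w + phi)))%:E =
   ((e * cos phi - x * sin phi) / (e ^+ 2 + x ^+ 2) + c / e)%:E)%E.
Proof.
move=> e0 c1.
have ex0 : 0 < e ^+ 2 + x ^+ 2 by rewrite ltr_pwDl ?exprn_gt0// sqr_ge0.
have dF w := @dcos e x phi c w (lt0r_neq0 e0) (lt0r_neq0 ex0).
rewrite (integral0y_FTC (l := 0) _ _ (fun w _ => dF w)).
- rewrite sub0r mulr0 oppr0 expR0 mul1r mulr0 add0r opprB; congr EFin.
  by rewrite addrC -mulNr opprB.
- by move=> w _; rewrite mulr_ge0 ?expR_ge0//; have := cos_geN1 (x * w + phi); lra.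
- move=> w _; apply: continuousM.
    apply: (@continuous_comp _ _ _ (fun w => - (e * w)) expR); last exact: continuous_expR.
    by apply: cvgN; apply: cvgMr; exact: cvg_id.
  apply: cvgD; first exact: cvg_cst.
  apply: (@continuous_comp _ _ _ (fun w => x * w + phi) cos); last exact: continuous_cos.
  by apply: cvgD; [apply: cvgMr; exact: cvg_id|exact: cvg_cst].
(* [K] bounds the trigonometric factor of the antiderivative, which therefore tends to 0 with exp(-e
   w). *)
- set K := (`|x| + e) / (e ^+ 2 + x ^+ 2) + c / e.
  have K0 w : `|(x * sin (x * w + phi) - e * cos (x * w + phi)) / (e ^+ 2 + x ^+ 2) - c / e| <= K.
    rewrite (le_trans (ler_normB _ _))// lerD//; last by rewrite ger0_norm// divr_ge0 ?ltW//; lra.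
    have i0 : 0 < (e ^+ 2 + x ^+ 2)^-1 by rewrite invr_gt0.
    rewrite normrM (gtr0_norm i0) ler_pM2r//.
    rewrite (le_trans (ler_normB _ _))// !normrM [`|e|]gtr0_norm//.
    rewrite lerD// ?ler_piMr ?(ltW e0)// ?ler_norml ?sin_geN1 ?sin_le1 ?cos_geN1 ?cos_le1//.
  apply: (@squeeze_cvgr _ _ _ _ (fun w => - (K * expR (- (e * w)))) (fun w => K * expR (- (e * w)))).
  + apply: nearW => w; rewrite -ler_norml normrM ger0_norm ?expR_ge0// mulrC.
    by rewrite ler_wpM2r ?expR_ge0.
  + by rewrite -[X in _ --> X]oppr0 -[in X in _ --> X](mulr0 K); apply: cvgN; apply: cvgMr; exact: cvg_expRN.
  + by rewrite -[X in _ --> X](mulr0 K); apply: cvgMr; exact: cvg_expRN.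
Qed.

Lemma measurable_expcos (e x phi c : R) :
  measurable_fun setT (fun w : RM => expR (- (e * `|w|)) * (c + cos (x * w + phi))).
Proof.
apply: measurable_funM.
  apply: measurableT_comp; first exact: measurable_expR.
  by apply: measurable_funN; mfun; exact: normr_measurable.
apply: measurable_funD; first exact: measurable_cst.
apply: measurableT_comp; last by mfun.
by apply: continuous_measurable_fun; exact: continuous_cos.
Qed.

(** The two half-lines contribute the half-line value at x and at -x; the sine terms are odd in x
    and cancel. *)
Lemma integral_expcosD (e x phi c : R) : 0 < e -> 1 <= c ->
  (\int[leb]_w (expR (- (e * `|w|)) * (c + cos (x * w + phi)))%:E =
   (2 * e * cos phi / (e ^+ 2 + x ^+ 2) + 2 * c / e)%:E)%E.
Proof.
move=> e0 c1.
have ex0 : 0 < e ^+ 2 + x ^+ 2 by rewrite ltr_pwDl ?exprn_gt0// sqr_ge0.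
rewrite ge0_integral_halves; first last.
- move=> w; rewrite lee_fin mulr_ge0 ?expR_ge0//; have := cos_geN1 (x * w + phi); lra.
- by apply/measurable_EFinP; exact: measurable_expcos.
transitivity ((((e * cos phi - x * sin phi) / (e ^+ 2 + x ^+ 2) + c / e)%:E +
  ((e * cos phi - (- x) * sin phi) / (e ^+ 2 + (- x) ^+ 2) + c / e)%:E)%E).
  congr (_ + _)%E.
    rewrite -(@integral0y_expcos _ _ _ _ e0 c1); apply: eq_integral => w.
    by rewrite inE/= in_itv/= andbT => w0; rewrite ger0_norm.
  rewrite -(@integral0y_expcos _ _ _ _ e0 c1); apply: eq_integral => w.
  by rewrite inE/= in_itv/= andbT => w0; rewrite normrN ger0_norm// mulrN mulNr.
rewrite -EFinD sqrrN; congr EFin; field; do ?[apply/andP; split]; exact: lt0r_neq0.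
Qed.

Lemma integrable_expN (e : R) : 0 < e ->
  leb.-integrable setT (EFin \o (fun w : RM => expR (- (e * `|w|)))).
Proof.
move=> e0.
have m0 : measurable_fun setT (fun w : RM => expR (- (e * `|w|))).
  apply: measurableT_comp; first exact: measurable_expR.
  by apply: measurable_funN; mfun; exact: normr_measurable.
apply/integrableP; split; first exact/measurable_EFinP.
(* Frequency 0 and phase pi/2 make the cosine vanish, so the exponential itself is an instance of
   the formula with c = 1. *)
apply: (@le_lt_trans _ _ (\int[leb]_w (expR (- (e * `|w|)) * (1 + cos (0 * w + pi / 2)))%:E)%E); last first.
  by rewrite integral_expcosD// ltry.
apply: ge0_le_integral => //.
- exact/measurableT_comp/measurable_EFinP.
- by apply/measurable_EFinP; exact: measurable_expcos.
- by move=> w _; rewrite /= lee_fin mul0r add0r cos_pihalf addr0 mulr1 ger0_norm ?expR_ge0.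
Qed.

Lemma Rintegral_expcos (e x phi : R) : 0 < e ->
  \int[leb]_w (expR (- (e * `|w|)) * cos (x * w + phi)) = 2 * e / (e ^+ 2 + x ^+ 2) * cos phi.
Proof.
move=> e0; have iE := integrable_expN e0.
have ex0 : 0 < e ^+ 2 + x ^+ 2 by rewrite ltr_pwDl ?exprn_gt0// sqr_ge0.
have Hc phi' c : 1 <= c -> \int[leb]_w (expR (- (e * `|w|)) * (c + cos (x * w + phi'))) =
   2 * e * cos phi' / (e ^+ 2 + x ^+ 2) + 2 * c / e.
  by move=> c1; rewrite /Rintegral integral_expcosD.
have mb c phi' : leb.-integrable setT (EFin \o (fun w : RM => expR (- (e * `|w|)) * (c + cos (x * w + phi')))).
  apply: (@integrable_le _ _ _ leb (fun w => expR (- (e * `|w|)) * (c + cos (x * w + phi'))) (fun w => (`|c| + 1) * expR (- (e * `|w|)))).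
  - exact: measurable_expcos.
  - rewrite (_ : EFin \o _ = fun w => (`|c| + 1)%:E * (expR (- (e * `|w|)))%:E)%E; first exact: integrableZl.
    by apply/funext => w /=; rewrite EFinM.
  - move=> w; rewrite normrM mulrC [X in _ * X]ger0_norm ?expR_ge0// ler_wpM2r ?expR_ge0//.
    by rewrite (le_trans (ler_normD _ _))// lerD2l ler_norml cos_geN1 cos_le1.
have := Hc phi 2 ltac:(lra); have := Hc phi 1 ltac:(lra).
(* Twice the case c = 1 minus the case c = 2: the constants cancel and the cosine keeps coefficient
   1. *)
have -> : \int[leb]_w (expR (- (e * `|w|)) * cos (x * w + phi)) =
  2 * \int[leb]_w (expR (- (e * `|w|)) * (1 + cos (x * w + phi))) -
  \int[leb]_w (expR (- (e * `|w|)) * (2 + cos (x * w + phi))).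
  pose F (c : R) (w : RM) := expR (- (e * `|w|)) * (c + cos (x * w + phi)).
  have iF2 : leb.-integrable setT (EFin \o (fun w => 2 * F 1 w)).
    rewrite (_ : EFin \o _ = fun w => 2%:E * (F 1 w)%:E)%E; first exact: integrableZl (mb 1 phi).
    by apply/funext => w /=; rewrite EFinM.
  rewrite -(@RintegralZl _ _ _ leb setT (F 1) 2 measurableT (mb 1 phi)).
  rewrite -(@RintegralB _ _ _ leb setT (fun w => 2 * F 1 w) (F 2) measurableT iF2 (mb 2 phi)).
  by apply: eq_Rintegral => w _; rewrite /F; ring.
move=> -> ->; field; do ?[apply/andP; split]; exact: lt0r_neq0.
Qed.

End lebesgue1.

(** * The Poisson kernel and the weights (1 + |x|)^p *)

Section kernels1.
Variable R : realType.
Local Notation RM := (measurableTypeR R).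
Local Notation leb := (leb R).

(** The Fourier transform of exp(-e|w|), left unnormalised: its mass is 2 pi, and the fourfold
    product is the source of every (2 pi)^4 below. *)
Definition poisson (e z : R) : R := 2 * e / (e ^+ 2 + z ^+ 2).

Lemma poisson_ge0 (e z : R) : 0 < e -> 0 <= poisson e z.
Proof. by move=> e0; rewrite /poisson divr_ge0 ?mulr_ge0 ?addr_ge0 ?sqr_ge0// ltW. Qed.

Lemma continuous_poisson (e : R) : 0 < e -> continuous (poisson e).
Proof.
move=> e0 z; have ez : e ^+ 2 + z ^+ 2 != 0 by rewrite lt0r_neq0// ltr_pwDl ?exprn_gt0// sqr_ge0.
apply: cvgMr; apply: cvgV => //; apply: cvgD; first exact: cvg_cst.
exact: exprn_continuous.
Qed.

Lemma measurable_poisson (e : R) : 0 < e -> measurable_fun setT (poisson e : RM -> R).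
Proof. by move=> e0; apply: continuous_measurable_fun; exact: continuous_poisson. Qed.

Lemma integral_poisson (e : R) : 0 < e ->
  (\int[leb]_z (poisson e z)%:E = (2 * pi)%:E)%E.
Proof.
move=> e0.
have half : (\int[leb]_(z in `[0%R, +oo[) (poisson e z)%:E = pi%:E)%E.
  have dF (z : R) : 0 <= z -> is_derive z (1:R) (fun z => 2 * atan (e^-1 * z)) (poisson e z).
    move=> _; have ez : e ^+ 2 + z ^+ 2 != 0 by rewrite lt0r_neq0// ltr_pwDl ?exprn_gt0// sqr_ge0.
    rewrite (_ : (fun z => _) = 2 \*: (atan \o (e^-1 \*: id))); last by apply/funext.
    apply: is_derive_eq; rewrite /= /poisson /GRing.scale /=.
    have e1 : e != 0 by rewrite lt0r_neq0.
    have ez1 : 1 + (e^-1 * z) ^+ 2 != 0 by rewrite lt0r_neq0// ltr_pwDl// sqr_ge0.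
    by field; do ?[apply/andP; split] => //; rewrite addrC.
  rewrite (integral0y_FTC (l := pi) _ _ dF).
  - by rewrite mulr0 atan0 mulr0 subr0.
  - by move=> z _; exact: poisson_ge0.
  - by move=> z _; exact: continuous_poisson.
  - rewrite -[X in _ --> X](_ : 2 * (pi / 2) = pi); last by field.
    apply: cvgMr; apply: (@cvg_comp _ _ _ (fun z => e^-1 * z) (@atan R) _ +oo); last exact: cvgy_atan.
    by apply: gt0_cvgMry => //; rewrite invr_gt0.
rewrite ge0_integral_halves; first last.
- by move=> z; rewrite lee_fin poisson_ge0.
- by apply/measurable_EFinP; exact: measurable_poisson.
rewrite half (_ : (\int[leb]_(z in `[0%R, +oo[) (poisson e (- z))%:E)%E = pi%:E) -?EFinD.
  by congr EFin; ring.
by rewrite -half; apply: eq_integral => z _; rewrite /poisson sqrrN.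
Qed.

Lemma integrable_poisson (e : R) : 0 < e -> leb.-integrable setT (EFin \o poisson e).
Proof.
move=> e0; apply/integrableP; split; first by apply/measurable_EFinP; exact: measurable_poisson.
rewrite (_ : (\int[leb]_x `|(EFin \o poisson e) x|)%E = (2 * pi)%:E) ?ltry// -(integral_poisson e0).
by apply: eq_integral => z _; rewrite /= ger0_norm// poisson_ge0.
Qed.

(** The mass concentrates at 0 as e tends to 0. Truncating |z| at 1 is essential, since the first
    moment is infinite; with it, dominated convergence along e = 1/(n+1) applies with majorant twice
    the kernel at parameter 1. *)
Lemma poisson_modulus (d : R) : 0 < d -> exists e : R, 0 < e /\
  (\int[leb]_z (poisson e z * Num.min 1 `|z|)%:E <= d%:E)%E.
Proof.
move=> d0.
pose f_ n (z : RM) : \bar R := (poisson n.+1%:R^-1 z * Num.min 1 `|z|)%:E.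
have n0 n : 0 < n.+1%:R^-1 :> R by rewrite invr_gt0.
have n1 n : n.+1%:R^-1 <= 1 :> R by rewrite invf_le1// ler1n.
have mf n : measurable_fun setT (f_ n).
  apply/measurable_EFinP; apply: measurable_funM; first exact: measurable_poisson.
  by apply: measurable_minr; [exact: measurable_cst|exact: normr_measurable].
have m0 (z : R) : 0 <= Num.min 1 `|z| by rewrite le_min ler01 normr_ge0.
have cvf z : setT z -> f_ n z @[n --> \oo] --> 0%E.
  move=> _; apply: cvg_EFin; first exact: nearW.
  rewrite /f_ /=; have [->|z0] := eqVneq z 0.
    by apply: cvg_near_cst; apply: nearW => n /=; rewrite normr0 minEle ler10 mulr0.
  apply: (@squeeze_cvgr _ _ _ _ (fun=> 0) (fun n => (2 / z ^+ 2) * n.+1%:R^-1)).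
  - apply: nearW => n /=; rewrite mulr_ge0 ?poisson_ge0//=.
    rewrite (@le_trans _ _ (poisson n.+1%:R^-1 z))//; first by rewrite ler_piMr ?poisson_ge0// ge_min lexx.
    rewrite (_ : 2 / z ^+ 2 / n.+1%:R = 2 * n.+1%:R^-1 / z ^+ 2); last by ring.
    rewrite /poisson ler_wpM2l ?mulr_ge0 ?(ltW (n0 n))//.
    by rewrite lef_pV2 ?posrE ?ltr_wpDl ?sqr_ge0 ?exprn_even_gt0// lerDr sqr_ge0.
  - exact: cvg_cst.
  - by rewrite -[X in _ --> X](mulr0 (2 / z ^+ 2)); apply: cvgMr; exact: cvg_harmonic.
have dom n z : setT z -> (`|f_ n z| <= (2 * poisson 1 z)%:E)%E.
  move=> _; rewrite /f_ /= lee_fin ger0_norm; last by apply: mulr_ge0 => //; exact: poisson_ge0.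
  set e := n.+1%:R^-1; have e0 : 0 < e := n0 n; have e1 : e <= 1 := n1 n.
  have ez : 0 < e ^+ 2 + z ^+ 2 by rewrite ltr_pwDl ?exprn_gt0// sqr_ge0.
  have oz : 0 < 1 + z ^+ 2 by rewrite ltr_pwDl ?sqr_ge0.
  rewrite /poisson expr1n (_ : 2 * (2 * 1 / (1 + z ^+ 2)) = 4 / (1 + z ^+ 2)); last by ring.
  rewrite mulrAC ler_pdivrMr// [leRHS]mulrAC ler_pdivlMr//.
  have zz : z ^+ 2 = `|z| ^+ 2 by rewrite real_normK// num_real.
  rewrite zz; have := normr_ge0 z; move: (`|z|) => t t0.
  (* For t >= 1 the bound is e(1 + t^2) <= 2 t^2, from e <= 1; for t < 1 it combines 2et <= e^2 +
     t^2 with 1 + t^2 <= 2. *)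
  rewrite minEle; case: ifPn => [t1|].
    have : 1 <= t ^+ 2 by rewrite exprn_ege1.
    by nra.
  rewrite -ltNge => t1.
  have h1 : 0 <= (e - t) ^+ 2 by rewrite sqr_ge0.
  have h2 : t ^+ 2 <= 1 by rewrite exprn_ile1// ltW.
  have h3 : 0 <= e * t by rewrite mulr_ge0// ltW.
  have h4 : 0 <= (e * t) * (1 - t ^+ 2) by rewrite mulr_ge0// subr_ge0.
  by lra.
have ig : leb.-integrable setT (fun z => (2 * poisson 1 z)%:E).
  rewrite (_ : (fun z => _) = fun z => 2%:E * (poisson 1 z)%:E)%E; last by apply/funext => z; rewrite EFinM.
  by apply: integrableZl => //; exact: integrable_poisson.
have := @dominated_cvg _ _ _ leb setT measurableT f_ (cst 0%E) (fun z => (2 * poisson 1 z)%:E) mf cvf (fun _ _ => erefl) ig dom.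
rewrite integral0 => /fine_cvgP[fin H].
have [N _ NH] := fin.
move/cvgrPdist_le : H => /(_ d d0)[M _ MH].
(* The limit concerns [fine] of the integrals, so the index must also lie in the range where they
   are finite. *)
exists (maxn N M).+1%:R^-1; split => //.
have := MH (maxn N M) (leq_maxr _ _); have := NH (maxn N M) (leq_maxl _ _).
rewrite /= sub0r normrN => fi; rewrite -lee_fin => /(le_trans _); apply.
by rewrite -{1}[leLHS]fineK// lee_fin ler_norm.
Qed.

Lemma cvg_powRN (p : R) : 0 < p -> (1 + x) `^ (- p) @[x --> +oo] --> (0 : R).
Proof.
move=> p0.
apply: (@squeeze_cvgr _ _ _ _ (fun=> 0) (fun x => (1 + x) `^ (- p))).
- by apply: nearW => x; rewrite powR_ge0 lexx.
- exact: cvg_cst.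
apply/cvgrPdist_le => d d0; near=> x.
rewrite sub0r normrN ger0_norm ?powR_ge0//.
have x0 : 0 < 1 + x by rewrite ltr_pwDl//; near: x; exact: nbhs_pinfty_ge.
have dx : d `^ (- p^-1) <= 1 + x.
  by rewrite ler_wpDl//; near: x; apply: nbhs_pinfty_ge; rewrite num_real.
rewrite powRN invf_ple ?posrE ?powR_gt0//.
have -> : d^-1 = (d `^ (- p^-1)) `^ p.
  by rewrite -powRrM mulNr mulVf ?lt0r_neq0// powR_inv1 ?ltW.
by apply: ge0_ler_powR => //; rewrite ?nnegrE ?powR_ge0// ltW.
Unshelve. all: by end_near. Qed.

Lemma is_derive_powR1D (p x : R) : p != 1 -> 0 <= x ->
  is_derive x (1:R) (fun x => (1 + x) `^ (1 - p) / (1 - p)) ((1 + x) `^ (- p)).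
Proof.
move=> p1 x0; have x1 : 0 < 1 + x by rewrite ltr_pwDl.
have p10 : 1 - p != 0 by rewrite subr_eq0 eq_sym.
rewrite (_ : (fun x => _) = (1 - p)^-1 \*: ((fun y => y `^ (1 - p)) \o (cst 1 + id))); last first.
  by apply/funext => y /=; rewrite /GRing.scale/= mulrC.
have H : is_derive ((cst 1 + id) x : R) 1 (fun y : R => y `^ (1 - p)) ((1 - p) * (1 + x) `^ (1 - p - 1)).
  exact: is_derive1_powR.
apply: is_derive_eq; rewrite /GRing.scale /= add0r mulr1 mulKf//.
by congr (_ `^ _); ring.
Qed.

Lemma continuous_powR1D (p x : R) : 0 <= x -> {for x, continuous (fun x : R => (1 + x) `^ p)}.
Proof.
move=> x0; have x1 : 0 < 1 + x by rewrite ltr_pwDl.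
apply: (@continuous_comp _ _ _ (fun x : R => 1 + x) (fun y : R => y `^ p) x).
  by apply: cvgD; [exact: cvg_cst|exact: cvg_id].
by apply: differentiable_continuous; apply/derivable1_diffP; apply: derivable_powR; rewrite in_itv/= x1.
Qed.

Lemma measurable_powR1Dnorm (p : R) : measurable_fun setT (fun x : RM => (1 + `|x|) `^ p).
Proof.
apply: (measurableT_comp (measurable_powR p)).
by apply: measurable_funD; [exact: measurable_cst|exact: normr_measurable].
Qed.

Lemma integral_powR1Dnorm_fin (p : R) : 1 < p ->
  (\int[leb]_x ((1 + `|x|) `^ (- p))%:E < +oo)%E.
Proof.
move=> p1; rewrite ge0_integral_halves; first last.
- by move=> x; rewrite lee_fin powR_ge0.
- by apply/measurable_EFinP; exact: measurable_powR1Dnorm.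
have half : (\int[leb]_(x in `[0%R, +oo[) ((1 + x) `^ (- p))%:E < +oo)%E.
  have p1' : p != 1 by rewrite gt_eqF.
  rewrite (integral0y_FTC (l := 0) _ _ (fun x => @is_derive_powR1D p x p1')) ?ltry//.
  - by move=> x _; exact: powR_ge0.
  - by move=> x x0; exact: continuous_powR1D.
  - rewrite -[X in _ --> X](mul0r (1 - p)^-1); apply: cvgMl.
    by rewrite -opprB; apply: cvg_powRN; rewrite subr_gt0.
apply: lte_add_pinfty; apply: le_lt_trans half; rewrite le_eqVlt; apply/orP; left; apply/eqP;
  apply: eq_integral => x; rewrite inE/= in_itv/= andbT => x0; by rewrite ?normrN ger0_norm.
Qed.

(** Each half contributes ((1 + rho)^(1-q) - 1)/(1-q). Dropping the -1 leaves a pure power of 1 +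
    rho, which the decay in the high frequency can cancel exactly. *)
Lemma integral_powR1Dnorm_ball (q rho : R) : 0 < q < 1 -> 0 <= rho ->
  (\int[leb]_x (if `|x| <= rho then (1 + `|x|) `^ (- q) else 0)%:E
    <= (2 / (1 - q) * (1 + rho) `^ (1 - q))%:E)%E.
Proof.
move=> /andP[q0 q1] rho0.
have mg : measurable_fun setT (fun x : RM => if `|x| <= rho then (1 + `|x|) `^ (- q) else 0).
  apply: measurable_fun_ifT; last 2 first.
  - exact: measurable_powR1Dnorm.
  - exact: measurable_cst.
  by apply: measurable_fun_ler; [exact: normr_measurable|exact: measurable_cst].
rewrite ge0_integral_halves; first last.
- by move=> x; case: ifP; rewrite lee_fin ?powR_ge0.
- exact/measurable_EFinP.
have half : (\int[leb]_(x in `[0%R, +oo[) (if `|x| <= rho then (1 + `|x|) `^ (- q) else 0)%:E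
    <= ((1 - q)^-1 * (1 + rho) `^ (1 - q))%:E)%E.
  have -> : (\int[leb]_(x in `[0%R, +oo[) (if `|x| <= rho then (1 + `|x|) `^ (- q) else 0)%:E =
      \int[leb]_(x in `[0%R, rho]) ((1 + x) `^ (- q))%:E)%E.
    rewrite (_ : `[0, rho]%classic = `[0, +oo[%classic `&` [set x : R | `|x| <= rho]); last first.
      apply/seteqP; split => x /=; rewrite !in_itv/= ?andbT.
        by move=> /andP[x0 xr]; rewrite ger0_norm.
      by move=> [x0]; rewrite ger0_norm// => ->; rewrite x0.
    rewrite integral_mkcondr; apply: eq_integral => x.
    rewrite inE/= in_itv/= andbT patchE => x0.
    rewrite [`|x|]ger0_norm//; case: ifPn => xr; first by rewrite mem_set//= ger0_norm.
    by rewrite memNset//= ger0_norm//; exact/negP.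
  (* The fundamental theorem requires a nondegenerate interval, hence the separate case rho = 0. *)
  move: rho0; rewrite le_eqVlt => /predU1P[<-|rho0].
    by rewrite set_itv1 integral_set1 lee_fin mulr_ge0 ?powR_ge0// invr_ge0 subr_ge0 ltW.
  rewrite (@continuous_FTC2 _ _ (fun x => (1 + x) `^ (1 - q) / (1 - q)) 0 rho)//.
  - by rewrite -EFinB lee_fin [leRHS]mulrC gerBl divr_ge0 ?powR_ge0// subr_ge0 ltW.
  - apply: continuous_in_subspaceT => x; rewrite inE/= in_itv/= => /andP[x0 _].
    exact: continuous_powR1D.
  - have cF x : 0 <= x -> {for x, continuous (fun x : R => (1 + x) `^ (1 - q) / (1 - q))}.
      by move=> x0; apply: cvgMl; exact: continuous_powR1D.
    split.
    + move=> x; rewrite in_itv/= => /andP[x0 _].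
      by have [] := @is_derive_powR1D q x _ (ltW x0); rewrite ?lt_eqF.
    + by apply: cvg_at_right_filter; exact: cF.
    + by apply: cvg_at_left_filter; apply: cF; exact: ltW.
  - move=> x; rewrite in_itv/= => /andP[x0 _]; rewrite derive1E.
    by have [] := @is_derive_powR1D q x _ (ltW x0); rewrite ?lt_eqF.
have -> : 2 / (1 - q) * (1 + rho) `^ (1 - q) =
  (1 - q)^-1 * (1 + rho) `^ (1 - q) + (1 - q)^-1 * (1 + rho) `^ (1 - q) by ring.
rewrite EFinD; apply: leeD; first exact: half.
under eq_integral do rewrite normrN.
exact: half.
Qed.

End kernels1.

(** * Joint measurability and invariance under translations *)

Section caratheodory.
Context d (T : measurableType d) (R : realType).
Local Notation RM := (measurableTypeR R).

(** Rounding x down to a multiple of 1/(n+1) gives functions whose preimages are countable unions of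
    rectangles; by continuity in x they converge to f. Used one coordinate at a time, this yields
    joint measurability with respect to the iterated product sigma-algebra. *)
Lemma measurable_caratheodory (f : RM * T -> R) :
  (forall x, measurable_fun setT (fun y => f (x, y))) ->
  (forall y, continuous (fun x : R => f (x, y))) -> measurable_fun setT f.
Proof.
move=> mf cf.
pose g n (z : RM * T) := f ((Num.floor (z.1 * n.+1%:R))%:~R / n.+1%:R, z.2).
apply: (@measurable_fun_cvg _ _ R setT g) => [n|[x y] _].
  move=> _ Y mY; rewrite setTI.
  pose F (k : int) : set (RM * T) :=
    `[k%:~R / n.+1%:R, (k + 1)%:~R / n.+1%:R[%classic `*` [set y | Y (f (k%:~R / n.+1%:R, y))].
  have n0 : 0 < n.+1%:R :> R by [].
  have -> : g n @^-1` Y = \bigcup_k F k.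
    apply/seteqP; split => [[x y] /= Yg|[x y] [k _ [/= +]]].
      exists (Num.floor (x * n.+1%:R)) => //; split => //=.
      by rewrite in_itv/= ler_pdivrMr// ltr_pdivlMr// floor_itv.
    rewrite in_itv/= ler_pdivrMr// ltr_pdivlMr// /g /=.
    by move=> /floor_def ->.
  apply: countable_bigcupT_measurable; first exact: countableP.
  move=> k; apply: measurableX; first exact: measurable_itv.
  by have := mf (k%:~R / n.+1%:R) measurableT Y mY; rewrite setTI.
apply: (@cvg_comp _ _ _ (fun n => (Num.floor (x * n.+1%:R))%:~R / n.+1%:R) (fun x : R => f (x, y)) _ (nbhs (x : R))); last exact: cf.
apply: (@squeeze_cvgr _ _ _ _ (fun n => x - n.+1%:R^-1) (fun=> x)).
- apply: nearW => n; have n0 : 0 < n.+1%:R :> R by [].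
  rewrite ler_pdivrMr// ler_pdivlMr// mulrBl mulVf ?lt0r_neq0// lerBlDr floor_le andbT.
  by have /andP[_ /ltW] := floor_itv (x * n.+1%:R); rewrite intrD.
- rewrite -[X in _ --> X]subr0; apply: cvgB; first exact: cvg_cst.
  exact: cvg_harmonic.
- exact: cvg_cst.
Qed.

End caratheodory.

Section preserving.
Variable R : realType.

(** Stated through integrals of nonnegative functions instead of measures of sets, so that passing
    to products is Tonelli and nothing more. *)
Definition preserving d (T : measurableType d) (m : {measure set T -> \bar R}) (phi : T -> T) :=
  measurable_fun setT phi /\
  forall f : T -> \bar R, measurable_fun setT f -> (forall x, 0 <= f x)%E ->
    (\int[m]_x f (phi x) = \int[m]_x f x)%E.

Lemma preserving_prodm d1 d2 (T1 : measurableType d1) (T2 : measurableType d2)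
  (m1 : {sigma_finite_measure set T1 -> \bar R})
  (m2 : {sigma_finite_measure set T2 -> \bar R}) phi psi :
  preserving m1 phi -> preserving m2 psi ->
  preserving (prodm m1 m2) (fun z => (phi z.1, psi z.2)).
Proof.
move=> [mphi Hphi] [mpsi Hpsi].
have mpp : measurable_fun setT (fun z : T1 * T2 => (phi z.1, psi z.2)).
  by apply: measurable_fun_pair; [apply: (measurableT_comp mphi)|apply: (measurableT_comp mpsi)]; mfun.
split=> // f mf f0.
rewrite (ge0_integral_prodm m1 m2 mf f0).
rewrite (ge0_integral_prodm m1 m2 (measurableT_comp mf mpp) (fun z => f0 _)).
rewrite -[RHS]Hphi; first last.
- by move=> x; exact: integral_ge0.
- exact: measurable_fun_fubini_tonelli_F.
apply: eq_integral => x _.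
by rewrite -[RHS]Hpsi//; exact: measurableT_comp mf (measurable_pair1 _).
Qed.

Local Notation RM := (measurableTypeR R).
Local Notation T3 := (RM * (RM * RM))%type.
Local Notation T4 := (RM * T3)%type.

Definition leb3 : {sigma_finite_measure set T3 -> \bar R} := prodm (leb R) (prodm (leb R) (leb R)).
Definition leb4 : {sigma_finite_measure set T4 -> \bar R} := prodm (leb R) leb3.

Definition sub3 (x y : T3) : T3 := (x.1 - y.1, (x.2.1 - y.2.1, x.2.2 - y.2.2)).
Definition sub4 (x y : T4) : T4 := (x.1 - y.1, sub3 x.2 y.2).

Lemma preserving_addr c : preserving (leb R) (fun x : RM => x + c).
Proof.
split; first by apply: measurable_funD; mfun.
by move=> f mf f0; exact: ge0_integral_addr.
Qed.

Lemma preserving_subr c : preserving (leb R) (fun x : RM => c - x).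
Proof.
split; first by apply: measurable_funB; mfun.
by move=> f mf f0; exact: ge0_integral_subr.
Qed.

Lemma preserving_sub3l c : preserving leb3 (fun x => sub3 x c).
Proof.
exact: preserving_prodm (preserving_addr _) (preserving_prodm (preserving_addr _) (preserving_addr _)).
Qed.

Lemma preserving_sub3r c : preserving leb3 (fun x => sub3 c x).
Proof.
exact: preserving_prodm (preserving_subr _) (preserving_prodm (preserving_subr _) (preserving_subr _)).
Qed.

Lemma preserving_sub4l c : preserving leb4 (fun x => sub4 x c).
Proof. exact: preserving_prodm (preserving_addr _) (preserving_sub3l _). Qed.

Lemma preserving_sub4r c : preserving leb4 (fun x => sub4 c x).
Proof. exact: preserving_prodm (preserving_subr _) (preserving_sub3r _). Qed.

Lemma measurable_sub3 : measurable_fun setT (fun z : T3 * T3 => sub3 z.1 z.2).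
Proof.
rewrite /sub3; mfun.
Qed.

Lemma measurable_sub4 : measurable_fun setT (fun z : T4 * T4 => sub4 z.1 z.2).
Proof.
rewrite /sub4 /sub3; mfun.
Qed.

End preserving.

(** * Schwartz functions *)

Section schwartz_facts.
Variable R : realType.
Local Notation RM := (measurableTypeR R).
Local Notation T4 := (RM * (RM * (RM * RM)))%type.
Implicit Types (f : 'rV[R]_4 -> R).

Definition pt4 (z : T4) : 'rV[R]_4 := pt z.1 z.2.1 z.2.2.1 z.2.2.2.

(** The Schwartz bound with all exponents 0 bounds the partial derivative; the mean value theorem on
    a coordinate line does the rest. *)
Lemma pderiv_lipschitz f (k : 'I_4) : rschwartz f ->
  exists L : R, 0 <= L /\ forall (x : 'rV[R]_4) (h : R),
    `|f (x + h *: delta_mx 0 k) - f x| <= L * `|h|.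
Proof.
move=> [df bf]; have [L HL] := bf _ (pd_step k (pd_self f)) (fun=> 0%N).
have {}HL x : `|'D_(delta_mx 0 k) f x| <= L.
  by have := HL x; rewrite big1 ?mul1r// => i _; rewrite expr0.
have L0 : 0 <= L by exact: le_trans (HL 0).
set v := delta_mx 0 k.
(* The mean value theorem is applied on [0, h]; a negative h is reduced to this case by exchanging
   the endpoints. *)
have Hpos (x : 'rV[R]_4) (h : R) : 0 <= h -> `|f (x + h *: v) - f x| <= L * h.
  move=> h0; pose g (s : R) := f (x + s *: v).
  have gd (s : R) : is_derive s (1:R) g ('D_v f (x + s *: v)).
    have E : (fun h : R => h^-1 *: ((g \o shift s) (h *: (1 : R)) - g s)) =
             (fun h : R => h^-1 *: ((f \o shift (x + s *: v)) (h *: v) - f (x + s *: v))).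
      apply/funext => e /=; congr (_ *: (_ - _)); rewrite /g /=; congr f.
      by rewrite [e *: (1:R)]mulr1 scalerDl addrCA.
    have d1 := df _ (pd_self f) k (x + s *: v).
    by split; rewrite /derivable /derive E.
  have cg : continuous g.
    move=> s; apply: differentiable_continuous; apply/derivable1_diffP.
    by have [] := gd s.
  have [c _] := @MVT_segment R g (fun s => 'D_v f (x + s *: v)) 0 h h0 (fun s _ => gd s) (continuous_subspaceT cg).
  rewrite /g scale0r addr0 subr0 => ->.
  by rewrite normrM (ger0_norm h0) ler_wpM2r.
exists L; split => // x h; have [h0|/ltW h0] := leP 0 h.
  by rewrite (ger0_norm h0) Hpos.
have := Hpos (x + h *: v) (- h).
by rewrite -addrA -scalerDl subrr scale0r addr0 distrC (ler0_norm h0) oppr_ge0; apply.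
Qed.

Definition poisson4 (e : R) (z : T4) : R :=
  poisson e z.1 * (poisson e z.2.1 * (poisson e z.2.2.1 * poisson e z.2.2.2)).

Lemma poisson4_ge0 e z : 0 < e -> 0 <= poisson4 e z.
Proof. by move=> e0; do 3 (apply: mulr_ge0; first exact: poisson_ge0); exact: poisson_ge0. Qed.

Lemma measurable_poisson4 e : 0 < e -> measurable_fun setT (poisson4 e).
Proof. by move=> /measurable_poisson me; rewrite /poisson4; mfun. Qed.

(** The majorant is a product of four factors 2/(1 + x_i^2), so that integrability and the Fubini
    majorants come for free from the kernel. *)
Lemma schwartz_decay f : rschwartz f -> exists M : R, 0 <= M /\
  forall z : T4, `|f (pt4 z)| <= M * poisson4 1 z.
Proof.
move=> [_ bf].
(* [Q w]: w f times any monomial is bounded. This is stable under multiplying w by 1 + x_k^2, so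
   four such steps from w = 1 give the weight required. *)
pose Q (w : 'rV[R]_4 -> R) := forall alpha : 'I_4 -> nat, exists M : R,
  forall x : 'rV[R]_4, `|w x * ((\prod_(i < 4) x 0 i ^+ alpha i) * f x)| <= M.
have Q1 : Q (fun=> 1).
  by move=> alpha; have [M HM] := bf _ (pd_self f) alpha; exists M => x; rewrite mul1r.
have QS k w : Q w -> Q (fun x => w x * (1 + x 0 k ^+ 2)).
  move=> Qw alpha; have [M1 H1] := Qw alpha.
  have [M2 H2] := Qw (fun i => alpha i + (i == k).*2)%N.
  exists (M1 + M2) => x; have := lerD (H1 x) (H2 x); apply: le_trans.
  apply: le_trans (ler_normD _ _); rewrite le_eqVlt; apply/orP; left; apply/eqP; congr (`|_|).
  have -> : \prod_(i < 4) x 0 i ^+ (alpha i + (i == k).*2) =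
      x 0 k ^+ 2 * \prod_(i < 4) x 0 i ^+ alpha i.
    under eq_bigr do rewrite exprD.
    rewrite big_split /= mulrC; congr (_ * _).
    rewrite (bigD1 k)//= eqxx big1 ?mulr1// => i /negPf ->.
    by rewrite expr0.
  by ring.
have [M HM] := QS (inord 3) _ (QS (inord 2) _ (QS (inord 1) _ (QS (inord 0) _ Q1))) (fun=> 0%N).
have M0 : 0 <= M by exact: le_trans (HM 0).
(* The 16 is the product of the four numerators 2 of the kernel. *)
exists (M / 16); split => [|[t [a [b c]]]]; first by rewrite divr_ge0.
have := HM (pt t a b c).
rewrite /pt4 /poisson4 /= big1 ?mul1r; last by move=> i _; rewrite expr0.
rewrite !mxE !inordK//= /poisson !expr1n => H.
have P (y : R) : 0 < 1 + y ^+ 2 by rewrite ltr_pwDl ?sqr_ge0.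
have -> : M / 16 * (2 * 1 / (1 + t ^+ 2) * (2 * 1 / (1 + a ^+ 2) * (2 * 1 / (1 + b ^+ 2) * (2 * 1 / (1 + c ^+ 2))))) =
  M / ((1 + t ^+ 2) * (1 + a ^+ 2) * (1 + b ^+ 2) * (1 + c ^+ 2)).
  by field; do ?[apply/andP; split]; exact: lt0r_neq0.
have P4 : 0 < (1 + t ^+ 2) * (1 + a ^+ 2) * (1 + b ^+ 2) * (1 + c ^+ 2) by rewrite !mulr_gt0.
by rewrite ler_pdivlMr// mulrC -[X in X * _](gtr0_norm P4) -normrM.
Qed.

Lemma pt4_shift (t a b c h : R) :
  [/\ pt (t + h) a b c = pt t a b c + h *: delta_mx 0 (inord 0),
      pt t (a + h) b c = pt t a b c + h *: delta_mx 0 (inord 1),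
      pt t a (b + h) c = pt t a b c + h *: delta_mx 0 (inord 2) &
      pt t a b (c + h) = pt t a b c + h *: delta_mx 0 (inord 3)].
Proof.
by split; apply/rowP => -[[|[|[|[|//]]]] i]; rewrite !mxE -!val_eqE /= inordK//= ?mulr1 ?mulr0 ?addr0.
Qed.

Lemma schwartz_lipschitz f : rschwartz f -> exists L : R, 0 <= L /\
  forall z w : T4, `|f (pt4 z) - f (pt4 w)| <=
    L * (`|z.1 - w.1| + `|z.2.1 - w.2.1| + `|z.2.2.1 - w.2.2.1| + `|z.2.2.2 - w.2.2.2|).
Proof.
move=> sf.
have [L0 [L0p H0]] := pderiv_lipschitz (inord 0) sf.
have [L1 [L1p H1]] := pderiv_lipschitz (inord 1) sf.
have [L2 [L2p H2]] := pderiv_lipschitz (inord 2) sf.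
have [L3 [L3p H3]] := pderiv_lipschitz (inord 3) sf.
exists (L0 + L1 + L2 + L3); split; first by rewrite !addr_ge0.
move=> [t [a [b c]]] [t' [a' [b' c']]]; rewrite /pt4 /=.
have E0 : `|f (pt t a b c) - f (pt t' a b c)| <= L0 * `|t - t'|.
  have := H0 (pt t' a b c) (t - t').
  by have [<- _ _ _] := pt4_shift t' a b c (t - t'); rewrite subrKC.
have E1 : `|f (pt t' a b c) - f (pt t' a' b c)| <= L1 * `|a - a'|.
  have := H1 (pt t' a' b c) (a - a').
  by have [_ <- _ _] := pt4_shift t' a' b c (a - a'); rewrite subrKC.
have E2 : `|f (pt t' a' b c) - f (pt t' a' b' c)| <= L2 * `|b - b'|.
  have := H2 (pt t' a' b' c) (b - b').
  by have [_ _ <- _] := pt4_shift t' a' b' c (b - b'); rewrite subrKC.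
have E3 : `|f (pt t' a' b' c) - f (pt t' a' b' c')| <= L3 * `|c - c'|.
  have := H3 (pt t' a' b' c') (c - c').
  by have [_ _ _ <-] := pt4_shift t' a' b' c' (c - c'); rewrite subrKC.
have {}E : `|f (pt t a b c) - f (pt t' a' b' c')| <=
    L0 * `|t - t'| + L1 * `|a - a'| + L2 * `|b - b'| + L3 * `|c - c'|.
  have -> : f (pt t a b c) - f (pt t' a' b' c') =
    f (pt t a b c) - f (pt t' a b c) + (f (pt t' a b c) - f (pt t' a' b c)) +
    (f (pt t' a' b c) - f (pt t' a' b' c)) + (f (pt t' a' b' c) - f (pt t' a' b' c')) by ring.
  by do 3 (apply: (le_trans (ler_normD _ _)); apply: lerD => //).
apply: (le_trans E); have := normr_ge0 (t - t'); have := normr_ge0 (a - a').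
have := normr_ge0 (b - b'); have := normr_ge0 (c - c').
move: (`|t - t'|) (`|a - a'|) (`|b - b'|) (`|c - c'|) => p q r s s0 r0 q0 p0.
have -> : (L0 + L1 + L2 + L3) * (p + q + r + s) = L0 * p + L1 * q + L2 * r + L3 * s +
  (L0 * (q + r + s) + L1 * (p + r + s) + L2 * (p + q + s) + L3 * (p + q + r)) by ring.
by rewrite lerDl !addr_ge0// mulr_ge0// !addr_ge0.
Qed.

Lemma lipschitz_continuous1 (g : R -> R) (L : R) :
  (forall x y, `|g x - g y| <= L * `|x - y|) -> continuous g.
Proof.
move=> Hg x; apply/cvgrPdist_le => e e0.
have L1 : 0 < `|L| + 1 by rewrite ltr_wpDl.
near=> y; rewrite (le_trans (Hg x y))//.
have : `|x - y| <= e / (`|L| + 1).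
  by near: y; apply: cvgr_dist_le => //; rewrite divr_gt0.
rewrite ler_pdivlMr// => H; rewrite (le_trans _ H)// mulrC ler_wpM2l//.
by rewrite (le_trans (ler_norm _))// lerDl.
Unshelve. all: by end_near. Qed.

Lemma measurable_schwartz f : rschwartz f -> measurable_fun setT (f \o pt4 : T4 -> R).
Proof.
move=> sf; have [L [_ HL]] := schwartz_lipschitz sf.
apply: measurable_caratheodory => [t|[a [b c]]]; last first.
  apply: (@lipschitz_continuous1 _ L) => x y.
  by have := HL (x, (a, (b, c))) (y, (a, (b, c))); rewrite /= !subrr normr0 !addr0.
apply: (@measurable_caratheodory _ _ _ (fun y => f (pt4 (t, y)))) => [a|[b c]]; last first.
  apply: (@lipschitz_continuous1 _ L) => x y.
  by have := HL (t, (x, (b, c))) (t, (y, (b, c))); rewrite /= !subrr normr0 !addr0 add0r.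
apply: (@measurable_caratheodory _ _ _ (fun y => f (pt4 (t, (a, y))))) => [b|c]; last first.
  apply: (@lipschitz_continuous1 _ L) => x y.
  by have := HL (t, (a, (x, c))) (t, (a, (y, c))); rewrite /= !subrr normr0 !addr0 !add0r.
apply: continuous_measurable_fun; apply: (@lipschitz_continuous1 _ L) => x y.
by have := HL (t, (a, (b, x))) (t, (a, (b, y))); rewrite /= !subrr normr0 !add0r.
Qed.

Lemma integrable_poisson4 e : 0 < e -> (leb4 R).-integrable setT (EFin \o poisson4 e).
Proof.
move=> e0; have i1 := integrable_poisson e0.
have m1 := measurable_poisson e0.
have p1 (x : R) : 0 <= poisson e x by exact: poisson_ge0.
have p2 (x y : R) : 0 <= poisson e x * poisson e y by apply: mulr_ge0; exact: p1.
have p3 (x y z : R) : 0 <= poisson e x * (poisson e y * poisson e z).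
  by apply: mulr_ge0; [exact: p1|exact: p2].
have i2 : (prodm (leb R) (leb R)).-integrable setT (EFin \o (fun z => poisson e z.1 * poisson e z.2)).
  apply: (dominated_integrable _ i1 i1 p1 p1); first by mfun.
  by move=> x y; rewrite (ger0_norm (p2 _ _)).
have i3 : (leb3 R).-integrable setT (EFin \o (fun z => poisson e z.1 * (poisson e z.2.1 * poisson e z.2.2))).
  apply: (dominated_integrable _ i1 i2 p1 (fun y => p2 _ _)); first by mfun.
  by move=> x y; rewrite (ger0_norm (p3 _ _ _)).
apply: (dominated_integrable _ i1 i3 p1 (fun y => p3 _ _ _)); first exact: measurable_poisson4.
by move=> x y; rewrite (ger0_norm (poisson4_ge0 _ e0)).
Qed.

End schwartz_facts.

(** * Abel and Poisson kernels in four variables *)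

Section poisson_fourier.
Variable R : realType.
Local Notation RM := (measurableTypeR R).
Local Notation T4 := (RM * (RM * (RM * RM)))%type.

Definition dot (x w : T4) : R :=
  x.1 * w.1 + (x.2.1 * w.2.1 + (x.2.2.1 * w.2.2.1 + x.2.2.2 * w.2.2.2)).

Definition abel (e w : R) : R := expR (- (e * `|w|)).
Definition abel4 (e : R) (w : T4) : R :=
  abel e w.1 * (abel e w.2.1 * (abel e w.2.2.1 * abel e w.2.2.2)).

Lemma abel_ge0 e w : 0 <= abel e w. Proof. exact: expR_ge0. Qed.

Lemma measurable_abel e : measurable_fun setT (abel e : RM -> R).
Proof. by rewrite /abel; mfun. Qed.

Lemma tensor_integrable d1 d2 (T1 : measurableType d1) (T2 : measurableType d2)
  (m1 : {sigma_finite_measure set T1 -> \bar R}) (m2 : {sigma_finite_measure set T2 -> \bar R})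
  (g : T1 -> R) (h : T2 -> R) :
  (forall x, 0 <= g x) -> (forall y, 0 <= h y) ->
  m1.-integrable setT (EFin \o g) -> m2.-integrable setT (EFin \o h) ->
  (prodm m1 m2).-integrable setT (EFin \o (fun z => g z.1 * h z.2)).
Proof.
move=> g0 h0 ig ih.
have mg : measurable_fun setT g by apply/measurable_EFinP; exact: measurable_int ig.
have mh : measurable_fun setT h by apply/measurable_EFinP; exact: measurable_int ih.
apply: (dominated_integrable _ ig ih g0 h0); first by mfun.
by move=> x y; rewrite ger0_norm// mulr_ge0.
Qed.

(** Induction step on the number of variables. The free phase lets x z.1 be absorbed into the inner
    integral, whose value is again a multiple of a cosine with a free phase; it also keeps the
    computation real and covers sines. *)
Lemma tensor_cos d2 (T2 : measurableType d2) (m2 : {sigma_finite_measure set T2 -> \bar R})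
  (E L : T2 -> R) (q e x : R) : 0 < e ->
  (forall y, 0 <= E y) -> m2.-integrable setT (EFin \o E) -> measurable_fun setT L ->
  (forall phi, \int[m2]_y (E y * cos (L y + phi)) = q * cos phi) ->
  forall phi, \int[prodm (leb R) m2]_z (abel e z.1 * E z.2 * cos (x * z.1 + L z.2 + phi))
    = poisson e x * q * cos phi.
Proof.
move=> e0 E0 iE mL HE phi.
have mE : measurable_fun setT E by apply/measurable_EFinP; exact: measurable_int iE.
have ia := integrable_expN e0.
have ma := measurable_abel e.
rewrite (Rintegral_prodm _ ia iE (abel_ge0 e) E0); last first.
- move=> a b /=; rewrite normrM ger0_norm ?mulr_ge0 ?abel_ge0// ler_piMr ?mulr_ge0 ?abel_ge0//.
  by rewrite ler_norml cos_geN1 cos_le1.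
- by mfun.
transitivity (\int[leb R]_w (q * (abel e w * cos (x * w + phi)))).
  apply: eq_Rintegral => w _ /=; rewrite mulrCA -HE -RintegralZl//.
    by apply: eq_Rintegral => y _; rewrite -mulrA (addrC (x * w)) addrA.
  apply: (integrable_le _ iE); first by mfun.
  move=> y; rewrite normrM (ger0_norm (E0 y)) ler_piMr//.
  by rewrite ler_norml cos_geN1 cos_le1.
rewrite RintegralZl//; last first.
  apply: (integrable_le _ ia); first by mfun.
  move=> w; rewrite normrM (ger0_norm (abel_ge0 _ _)) ler_piMr ?abel_ge0//.
  by rewrite ler_norml cos_geN1 cos_le1.
by rewrite Rintegral_expcos// mulrA [poisson e x * q]mulrC.
Qed.

Lemma abel4_ge0 e w : 0 <= abel4 e w.
Proof. by rewrite /abel4 !mulr_ge0// abel_ge0. Qed.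

Lemma abel4_le1 e w : 0 < e -> abel4 e w <= 1.
Proof.
move=> e0; have a1 x : abel e x <= 1 by rewrite /abel -expR0 ler_expR oppr_le0 mulr_ge0// ltW.
by rewrite /abel4 !mulr_ile1 ?mulr_ge0 ?abel_ge0.
Qed.

Lemma integrable_abel4 e : 0 < e -> (leb4 R).-integrable setT (EFin \o abel4 e).
Proof.
move=> e0; have ia := integrable_expN e0; have a0 := abel_ge0 e.
have i2 : (prodm (leb R) (leb R)).-integrable setT (EFin \o (fun z : RM * RM => abel e z.1 * abel e z.2)).
  exact: (@tensor_integrable _ _ RM RM (leb R) (leb R) (abel e) (abel e)).
have i3 : (leb3 R).-integrable setT (EFin \o (fun z : RM * (RM * RM) => abel e z.1 * (abel e z.2.1 * abel e z.2.2))).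
  apply: (@tensor_integrable _ _ RM _ (leb R) (prodm (leb R) (leb R)) (abel e) (fun z : RM * RM => abel e z.1 * abel e z.2)) => //.
  by move=> y; rewrite mulr_ge0.
apply: (@tensor_integrable _ _ RM _ (leb R) (leb3 R) (abel e) (fun z : RM * (RM * RM) => abel e z.1 * (abel e z.2.1 * abel e z.2.2))) => //.
by move=> y; rewrite !mulr_ge0.
Qed.

Lemma fourier_abel4 e (x : T4) phi : 0 < e ->
  \int[leb4 R]_w (abel4 e w * cos (dot x w + phi)) = poisson4 e x * cos phi.
Proof.
move=> e0; have ia := integrable_expN e0; have a0 := abel_ge0 e.
have i2 : (prodm (leb R) (leb R)).-integrable setT (EFin \o (fun z : RM * RM => abel e z.1 * abel e z.2)).
  exact: (@tensor_integrable _ _ RM RM (leb R) (leb R) (abel e) (abel e)).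
have i3 : (leb3 R).-integrable setT (EFin \o (fun z : RM * (RM * RM) => abel e z.1 * (abel e z.2.1 * abel e z.2.2))).
  apply: (@tensor_integrable _ _ RM _ (leb R) (prodm (leb R) (leb R)) (abel e) (fun z : RM * RM => abel e z.1 * abel e z.2)) => //.
  by move=> y; rewrite mulr_ge0.
have p2 (y : RM * RM) : 0 <= abel e y.1 * abel e y.2 by rewrite mulr_ge0.
have p3 (y : RM * (RM * RM)) : 0 <= abel e y.1 * (abel e y.2.1 * abel e y.2.2) by rewrite !mulr_ge0.
have H1 psi : \int[leb R]_w (abel e w * cos (x.2.2.2 * w + psi)) = poisson e x.2.2.2 * cos psi.
  exact: Rintegral_expcos.
have m1 : measurable_fun setT (fun w : RM => x.2.2.2 * w) by mfun.
have H2 := @tensor_cos _ RM (leb R) (abel e) _ _ e x.2.2.1 e0 a0 ia m1 H1.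
have m2 : measurable_fun setT (fun w : RM * RM => x.2.2.1 * w.1 + x.2.2.2 * w.2) by mfun.
have H3 := @tensor_cos _ _ (prodm (leb R) (leb R)) _ _ _ e x.2.1 e0 p2 i2 m2 H2.
have m3 : measurable_fun setT (fun w : RM * (RM * RM) => x.2.1 * w.1 + (x.2.2.1 * w.2.1 + x.2.2.2 * w.2.2)) by mfun.
exact: (@tensor_cos _ _ (leb3 R) _ _ _ e x.1 e0 p3 i3 m3 H3).
Qed.


Lemma ge0_integral_tensor d1 d2 (T1 : measurableType d1) (T2 : measurableType d2)
  (m1 : {sigma_finite_measure set T1 -> \bar R}) (m2 : {sigma_finite_measure set T2 -> \bar R})
  (g : T1 -> R) (h : T2 -> R) :
  (forall x, 0 <= g x) -> (forall y, 0 <= h y) ->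
  measurable_fun setT g -> measurable_fun setT h ->
  (\int[prodm m1 m2]_z (g z.1 * h z.2)%:E = (\int[m1]_x (g x)%:E) * (\int[m2]_y (h y)%:E))%E.
Proof.
move=> g0 h0 mg mh.
have mgh : measurable_fun setT (fun z : T1 * T2 => (g z.1 * h z.2)%:E).
  by apply/measurable_EFinP; mfun.
rewrite (ge0_integral_prodm m1 m2 mgh); last by move=> z; rewrite lee_fin mulr_ge0.
transitivity (\int[m1]_x ((\int[m2]_y (h y)%:E) * (g x)%:E))%E.
  apply: eq_integral => x _ /=; under eq_integral do rewrite EFinM.
  rewrite (ge0_integralZl m2 measurableT) 1?muleC//; first exact/measurable_EFinP.
    by move=> y _; rewrite lee_fin.
  by rewrite lee_fin.
rewrite (ge0_integralZl m1 measurableT) 1?muleC//; first exact/measurable_EFinP.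
  by move=> y _; rewrite lee_fin.
by apply: integral_ge0 => y _; rewrite lee_fin.
Qed.

Definition clip (x : R) : R := Num.min 1 `|x|.

Lemma clip_ge0 x : 0 <= clip x.
Proof. by rewrite /clip le_min ler01 normr_ge0. Qed.

Definition clip4 (z : T4) : R := clip z.1 + (clip z.2.1 + (clip z.2.2.1 + clip z.2.2.2)).

Lemma clip4_ge0 z : 0 <= clip4 z.
Proof. by rewrite /clip4 !addr_ge0// clip_ge0. Qed.

Lemma measurable_clip : measurable_fun setT (clip : RM -> R).
Proof. by rewrite /clip; mfun. Qed.

Lemma measurable_clip4 : measurable_fun setT clip4.
Proof. by have mc := measurable_clip; rewrite /clip4; mfun. Qed.

Lemma tensor4_integral (f1 f2 f3 f4 : RM -> R) :
  (forall x, 0 <= f1 x) -> (forall x, 0 <= f2 x) ->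
  (forall x, 0 <= f3 x) -> (forall x, 0 <= f4 x) ->
  measurable_fun setT f1 -> measurable_fun setT f2 ->
  measurable_fun setT f3 -> measurable_fun setT f4 ->
  (\int[leb4 R]_z (f1 z.1 * (f2 z.2.1 * (f3 z.2.2.1 * f4 z.2.2.2)))%:E =
   (\int[leb R]_x (f1 x)%:E) * ((\int[leb R]_x (f2 x)%:E) *
     ((\int[leb R]_x (f3 x)%:E) * (\int[leb R]_x (f4 x)%:E))))%E.
Proof.
move=> p1 p2 p3 p4 m1 m2 m3 m4.
have p34 (z : RM * RM) : 0 <= f3 z.1 * f4 z.2 by rewrite mulr_ge0.
have p234 (z : RM * (RM * RM)) : 0 <= f2 z.1 * (f3 z.2.1 * f4 z.2.2) by rewrite !mulr_ge0.
rewrite (@ge0_integral_tensor _ _ _ _ (leb R) (leb3 R) f1 (fun z => f2 z.1 * (f3 z.2.1 * f4 z.2.2)) p1 p234 m1); last by mfun.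
rewrite (@ge0_integral_tensor _ _ _ _ (leb R) (prodm (leb R) (leb R)) f2 (fun z => f3 z.1 * f4 z.2) p2 p34 m2); last by mfun.
by rewrite (@ge0_integral_tensor _ _ _ _ (leb R) (leb R) f3 f4 p3 p4 m3 m4).
Qed.

Lemma integral_poisson4 e : 0 < e ->
  (\int[leb4 R]_z (poisson4 e z)%:E = ((2 * pi) ^+ 4)%:E)%E.
Proof.
move=> e0; have p0 (x : RM) : 0 <= poisson e x by exact: poisson_ge0.
have mp := measurable_poisson e0.
rewrite /poisson4 (tensor4_integral p0 p0 p0 p0 mp mp mp mp) integral_poisson//.
Qed.

(** Each of the four terms of [clip4] affects one coordinate, which contributes at most d; the other
    three contribute 2 pi each. *)
Lemma integral_poisson4_clip e (d : R) : 0 < e ->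
  (\int[leb R]_z (poisson e z * clip z)%:E <= d%:E)%E ->
  (\int[leb4 R]_z (poisson4 e z * clip4 z)%:E <= (4 * (2 * pi) ^+ 3 * d)%:E)%E.
Proof.
move=> e0 Hd; have p0 (x : RM) : 0 <= poisson e x by exact: poisson_ge0.
have mp := measurable_poisson e0; have mc := measurable_clip.
pose pc (x : RM) := poisson e x * clip x.
have pc0 x : 0 <= pc x by rewrite mulr_ge0 ?clip_ge0.
have mpc : measurable_fun setT pc by rewrite /pc; mfun.
pose G (f1 f2 f3 f4 : RM -> R) (z : T4) := f1 z.1 * (f2 z.2.1 * (f3 z.2.2.1 * f4 z.2.2.2)).
pose p := poisson e : RM -> R.
have Gge0 (f1 f2 f3 f4 : RM -> R) : (forall x, 0 <= f1 x) -> (forall x, 0 <= f2 x) ->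
  (forall x, 0 <= f3 x) -> (forall x, 0 <= f4 x) -> forall z, (0 <= (G f1 f2 f3 f4 z)%:E)%E.
  by move=> ? ? ? ? z; rewrite lee_fin /G !mulr_ge0.
have mG (f1 f2 f3 f4 : RM -> R) : measurable_fun setT f1 -> measurable_fun setT f2 ->
  measurable_fun setT f3 -> measurable_fun setT f4 ->
  measurable_fun setT (fun z => (G f1 f2 f3 f4 z)%:E).
  by move=> ? ? ? ?; apply/measurable_EFinP; rewrite /G; mfun.
have -> : (\int[leb4 R]_z (poisson4 e z * clip4 z)%:E =
  \int[leb4 R]_z ((G pc p p p z)%:E + ((G p pc p p z)%:E + ((G p p pc p z)%:E + (G p p p pc z)%:E))))%E.
  apply: eq_integral => z _; rewrite -!EFinD; congr EFin.
  by rewrite /poisson4 /clip4 /G /pc /p; ring.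
have pi0 : 0 <= 2 * pi :> R by rewrite mulr_ge0// pi_ge0.
have D0 : (0 <= \int[leb R]_x (pc x)%:E)%E by apply: integral_ge0 => x _; rewrite lee_fin.
have fd : ((\int[leb R]_x (pc x)%:E) \is a fin_num)%E.
  by rewrite ge0_fin_numE// (le_lt_trans Hd)// ltry.
rewrite !ge0_integralD//; do ?[by move=> z _; apply: Gge0 | by apply: mG
  | by move=> z _; rewrite !adde_ge0//; apply: Gge0
  | by do ?[apply: emeasurable_funD]; apply: mG].
rewrite /G !tensor4_integral// integral_poisson//.
rewrite -(fineK fd) -!EFinM -!EFinD lee_fin.
have fle : fine (\int[leb R]_x (pc x)%:E) <= d by rewrite -lee_fin fineK.
set D := fine _ in fle *.
have -> : D * (2 * pi * (2 * pi * (2 * pi))) + (2 * pi * (D * (2 * pi * (2 * pi))) +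
  (2 * pi * (2 * pi * (D * (2 * pi))) + 2 * pi * (2 * pi * (2 * pi * D)))) = 4 * (2 * pi) ^+ 3 * D by ring.
by rewrite ler_wpM2l// mulr_ge0// exprn_ge0.
Qed.

End poisson_fourier.

(** * Abel summation of the Fourier integral *)

Section linear.
Context d (T : measurableType d) (R : realType) (m : {measure set T -> \bar R}).

Lemma integrable_lin (f g : T -> R) (a b : R) :
  m.-integrable setT (EFin \o f) -> m.-integrable setT (EFin \o g) ->
  m.-integrable setT (EFin \o (fun x => a * f x + b * g x)).
Proof.
move=> fi gi.
rewrite (_ : EFin \o _ = (fun x => a%:E * (EFin \o f) x) \+ (fun x => b%:E * (EFin \o g) x))%E.
  by apply: integrableD => //; exact: integrableZl.
by apply/funext => x /=; rewrite EFinD !EFinM.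
Qed.

Lemma Rintegral_lin (f g : T -> R) (a b : R) :
  m.-integrable setT (EFin \o f) -> m.-integrable setT (EFin \o g) ->
  \int[m]_x (a * f x + b * g x) = a * \int[m]_x f x + b * \int[m]_x g x.
Proof.
move=> fi gi; rewrite -!RintegralZl//.
have iZ (c : R) (h : T -> R) : m.-integrable setT (EFin \o h) ->
    m.-integrable setT (EFin \o (fun x => c * h x)).
  move=> hi; rewrite (_ : EFin \o _ = (fun x => c%:E * (EFin \o h) x)%E); first exact: integrableZl.
  by apply/funext => x /=; rewrite EFinM.
by rewrite -RintegralD//; exact: iZ.
Qed.

End linear.

Section convolution.
Variable R : realType.
Local Notation RM := (measurableTypeR R).
Local Notation T4 := (RM * (RM * (RM * RM)))%type.
Local Notation lam := (leb4 R).

(** The decay that is used from here on: it is stable under sums and bounded factors, and the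
    majorant splits over the coordinates as Fubini requires. *)
Definition dominated (f : T4 -> R) := measurable_fun setT f /\
  exists2 M, 0 <= M & forall z, `|f z| <= M * poisson4 1 z.

Definition lipschitz4 (f : T4 -> R) := exists2 L, 0 <= L & forall z w : T4,
  `|f z - f w| <= L * (`|z.1 - w.1| + `|z.2.1 - w.2.1| + `|z.2.2.1 - w.2.2.1| + `|z.2.2.2 - w.2.2.2|).

Definition fre (u1 u2 : T4 -> R) (k : T4) : R :=
  \int[lam]_x (u1 x * cos (dot x k) + u2 x * sin (dot x k)).
Definition fim (u1 u2 : T4 -> R) (k : T4) : R :=
  \int[lam]_x (u2 x * cos (dot x k) - u1 x * sin (dot x k)).
Definition fnorm (u1 u2 : T4 -> R) (k : T4) : R :=
  Num.sqrt (fre u1 u2 k ^+ 2 + fim u1 u2 k ^+ 2).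

Let p1 z : 0 <= poisson4 1 z :> R. Proof. exact: poisson4_ge0. Qed.

Lemma normr_cos_le1 (t : R) : `|cos t| <= 1.
Proof. by rewrite ler_norml cos_geN1 cos_le1. Qed.

Lemma normr_sin_le1 (t : R) : `|sin t| <= 1.
Proof. by rewrite ler_norml sin_geN1 sin_le1. Qed.

Lemma measurable_dot : measurable_fun setT (fun z : T4 * T4 => dot z.1 z.2).
Proof. by rewrite /dot; mfun. Qed.

Lemma measurable_dotl (k : T4) : measurable_fun setT (fun x : T4 => dot x k).
Proof. by rewrite /dot; mfun. Qed.

Lemma measurable_dotr (k : T4) : measurable_fun setT (fun x : T4 => dot k x).
Proof. by rewrite /dot; mfun. Qed.

Lemma dominated_int f : dominated f -> lam.-integrable setT (EFin \o f).
Proof.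
move=> [mf [M M0 HM]]; apply: (integrable_le mf _ HM).
rewrite (_ : EFin \o _ = (fun z => M%:E * (EFin \o poisson4 1) z)%E); last by apply/funext => z; rewrite /= EFinM.
by apply: integrableZl => //; exact: integrable_poisson4.
Qed.

Lemma dominatedM (f g : T4 -> R) (c : R) : dominated f -> measurable_fun setT g -> (forall z, `|g z| <= c) ->
  dominated (fun z => f z * g z).
Proof.
move=> [mf [M M0 HM]] mg Hc; split; first by mfun.
exists (M * `|c|); first by rewrite mulr_ge0.
move=> z; rewrite normrM mulrAC ler_pM//.
by rewrite (le_trans (Hc z))// ler_norm.
Qed.

Lemma dominatedD f g : dominated f -> dominated g -> dominated (fun z => f z + g z).
Proof.
move=> [mf [M M0 HM]] [mg [N N0 HN]]; split; first by mfun.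
exists (M + N); first by rewrite addr_ge0.
by move=> z; rewrite mulrDl (le_trans (ler_normD _ _))// lerD.
Qed.

Lemma dominatedN f : dominated f -> dominated (fun z => - f z).
Proof.
move=> [mf [M M0 HM]]; split; first by mfun.
by exists M => // z; rewrite normrN.
Qed.

Lemma dominated_cos f (k : T4) : dominated f -> dominated (fun z => f z * cos (dot z k)).
Proof.
move=> df; apply: (@dominatedM _ _ 1 df); last by move=> z; exact: normr_cos_le1.
by have := measurable_dotl k => ?; mfun.
Qed.

Lemma dominated_sin f (k : T4) : dominated f -> dominated (fun z => f z * sin (dot z k)).
Proof.
move=> df; apply: (@dominatedM _ _ 1 df); last by move=> z; exact: normr_sin_le1.
by have := measurable_dotl k => ?; mfun.
Qed.

Lemma dominated_re u1 u2 k : dominated u1 -> dominated u2 ->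
  dominated (fun x => u1 x * cos (dot x k) + u2 x * sin (dot x k)).
Proof. by move=> d1 d2; apply: dominatedD; [exact: dominated_cos|exact: dominated_sin]. Qed.

Lemma dominated_im u1 u2 k : dominated u1 -> dominated u2 ->
  dominated (fun x => u2 x * cos (dot x k) - u1 x * sin (dot x k)).
Proof.
by move=> d1 d2; apply: dominatedD; [exact: dominated_cos|apply: dominatedN; exact: dominated_sin].
Qed.

Lemma measurable_fre u1 u2 : dominated u1 -> dominated u2 -> measurable_fun setT (fre u1 u2).
Proof.
move=> [m1 _] [m2 _].
apply: (@measurable_Rintegral_l _ _ T4 T4 R lam (fun z => u1 z.2 * cos (dot z.2 z.1) + u2 z.2 * sin (dot z.2 z.1))).
have md : measurable_fun setT (fun z : T4 * T4 => dot z.2 z.1) by rewrite /dot; mfun.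
by mfun.
Qed.

Lemma measurable_fim u1 u2 : dominated u1 -> dominated u2 -> measurable_fun setT (fim u1 u2).
Proof.
move=> [m1 _] [m2 _].
apply: (@measurable_Rintegral_l _ _ T4 T4 R lam (fun z => u2 z.2 * cos (dot z.2 z.1) - u1 z.2 * sin (dot z.2 z.1))).
have md : measurable_fun setT (fun z : T4 * T4 => dot z.2 z.1) by rewrite /dot; mfun.
by mfun.
Qed.

Lemma measurable_fnorm u1 u2 : dominated u1 -> dominated u2 -> measurable_fun setT (fnorm u1 u2).
Proof.
move=> d1 d2; have mr := measurable_fre d1 d2; have mi := measurable_fim d1 d2.
by rewrite /fnorm; mfun.
Qed.

Lemma fnorm_ge0 u1 u2 k : 0 <= fnorm u1 u2 k. Proof. exact: sqrtr_ge0. Qed.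

Lemma Rintegral_bound (f : T4 -> R) (M : R) : measurable_fun setT f -> 0 <= M ->
  (forall z, `|f z| <= M * poisson4 1 z) -> `|\int[lam]_z f z| <= M * (2 * pi) ^+ 4.
Proof.
move=> mf M0 HM; have df : dominated f by split => //; exists M.
have dp : dominated (poisson4 1 : T4 -> R).
  split; first exact: measurable_poisson4.
  by exists 1 => // z; rewrite mul1r ger0_norm.
rewrite (le_trans (le_normr_Rintegral measurableT (dominated_int df)))//.
have -> : (2 * pi) ^+ 4 = \int[lam]_z poisson4 1 z by rewrite /Rintegral integral_poisson4.
rewrite -RintegralZl//; last exact: dominated_int.
apply: le_Rintegral => //.
- apply: dominated_int; split; first by case: df => mf' _; mfun.
  by exists M => // z; rewrite normr_id.
- apply: dominated_int; split; first by have := dp.1 => ?; mfun.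
  by exists M => // z; rewrite normrM !ger0_norm.
Qed.

(** This boundedness, together with measurability, is all that is ever known of a transform; against
    the integrable Abel factor it suffices for Fubini. *)
Lemma bounded_fre u1 u2 : dominated u1 -> dominated u2 -> exists2 K, 0 <= K &
  forall k, `|fre u1 u2 k| <= K /\ `|fim u1 u2 k| <= K.
Proof.
move=> d1 d2; have [_ [M1 M10 H1]] := d1; have [_ [M2 M20 H2]] := d2.
have b (a t z : R) c : `|a| <= c -> `|t| <= 1 -> `|a * t| <= c.
  by move=> ac t1; rewrite normrM (le_trans _ ac)// ler_piMr.
exists ((M1 + M2) * (2 * pi) ^+ 4).
  by rewrite mulr_ge0 ?addr_ge0// exprn_ge0// mulr_ge0// pi_ge0.
move=> k; split; (apply: Rintegral_bound; [|exact: addr_ge0|]).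
- by have [] := dominated_re k d1 d2.
- move=> z; rewrite mulrDl (le_trans (ler_normD _ _))// lerD// b ?normr_cos_le1 ?normr_sin_le1//.
- by have [] := dominated_im k d1 d2.
- move=> z; rewrite mulrDl [leRHS]addrC (le_trans (ler_normB _ _))// lerD// b ?normr_cos_le1 ?normr_sin_le1//.
Qed.

Lemma dot_sub4 (x y k : T4) : dot (sub4 x y) k = dot x k - dot y k.
Proof. by rewrite /dot /sub4 /sub3 /=; ring. Qed.

Lemma dot_sub4r (x y k : T4) : dot k (sub4 x y) = dot k x - dot k y.
Proof. by rewrite /dot /sub4 /sub3 /=; ring. Qed.

(* Abel summation of the Fourier inversion integral is convolution with a Poisson kernel. *)
Lemma abel_inversion v1 v2 e x : 0 < e -> dominated v1 -> dominated v2 ->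
  \int[lam]_y (v1 y * poisson4 e (sub4 x y)) =
  \int[lam]_k (abel4 e k * (cos (dot x k) * fre v1 v2 k - sin (dot x k) * fim v1 v2 k)).
Proof.
move=> e0 d1 d2; have [m1 [M1 M10 H1]] := d1; have [m2 [M2 M20 H2]] := d2.
have ia := integrable_abel4 e0.
have ma : measurable_fun setT (abel4 e : T4 -> R) by apply/measurable_EFinP; exact: measurable_int ia.
have iacos (y : T4) : lam.-integrable setT (EFin \o (fun k => abel4 e k * cos (dot y k))).
  have := measurable_dotr y => md.
  apply: (integrable_le _ ia); first by mfun.
  by move=> k; rewrite normrM (ger0_norm (abel4_ge0 _ _)) ler_piMr ?abel4_ge0// normr_cos_le1.
have iasin (y : T4) : lam.-integrable setT (EFin \o (fun k => abel4 e k * sin (dot y k))).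
  have := measurable_dotr y => md.
  apply: (integrable_le _ ia); first by mfun.
  by move=> k; rewrite normrM (ger0_norm (abel4_ge0 _ _)) ler_piMr ?abel4_ge0// normr_sin_le1.
(* The real part of v(y) e^{i(x-y).k} times the Abel factor. Integrated in k, the sine part vanishes
   by symmetry, so only [v1] survives. *)
pose F (z : T4 * T4) := v1 z.1 * (abel4 e z.2 * cos (dot (sub4 x z.1) z.2)) +
  (- v2 z.1) * (abel4 e z.2 * sin (dot (sub4 x z.1) z.2)).
transitivity (\int[lam]_y \int[lam]_k F (y, k)).
  apply: eq_Rintegral => y _; rewrite /F /= Rintegral_lin//.
  have -> : \int[lam]_k (abel4 e k * cos (dot (sub4 x y) k)) = poisson4 e (sub4 x y).
    rewrite -[RHS]mulr1 -(cos0 R) -(fourier_abel4 _ _ e0).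
    by apply: eq_Rintegral => k _; rewrite addr0.
  (* The phase -pi/2 turns the cosine formula into the one for the sine. *)
  have -> : \int[lam]_k (abel4 e k * sin (dot (sub4 x y) k)) = 0.
    rewrite -[RHS](mulr0 (poisson4 e (sub4 x y))) -(cos_pihalf R) -[in RHS](cosN (pi / 2)) -(fourier_abel4 _ _ e0).
    by apply: eq_Rintegral => k _; rewrite cosD cosN sinN cos_pihalf sin_pihalf mulr0 mulrN1 sub0r opprK.
  by rewrite mulr0 addr0.
have mF : measurable_fun setT F.
  have md : measurable_fun setT (fun z : T4 * T4 => dot (sub4 x z.1) z.2).
    by rewrite /dot /sub4 /sub3 /=; mfun.
  by rewrite /F; mfun.
have d12 : dominated (fun y => `|v1 y| + `|v2 y|).
  split; first by mfun.
  by exists (M1 + M2) => [|z]; rewrite ?addr_ge0// ger0_norm ?addr_ge0// mulrDl lerD.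
rewrite (@Rintegral_swap _ _ _ _ R lam lam F _ _ mF (dominated_int d12) ia).
- apply: eq_Rintegral => k _; rewrite /F /=.
  have E y : v1 y * (abel4 e k * cos (dot (sub4 x y) k)) + - v2 y * (abel4 e k * sin (dot (sub4 x y) k)) =
    (abel4 e k * cos (dot x k)) * (v1 y * cos (dot y k) + v2 y * sin (dot y k)) +
    (- (abel4 e k * sin (dot x k))) * (v2 y * cos (dot y k) - v1 y * sin (dot y k)).
    by rewrite dot_sub4 cosD sinD cosN sinN; ring.
  under eq_Rintegral do rewrite E.
  rewrite Rintegral_lin; first by rewrite /fre /fim; ring.
  + exact/dominated_int/dominated_re.
  + exact/dominated_int/dominated_im.
- by move=> y; rewrite addr_ge0.
- by move=> k; exact: abel4_ge0.
- move=> y k; rewrite /F /= mulrDl (le_trans (ler_normD _ _))//.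
  rewrite (normrM (v1 y)) (normrM (- v2 y)) normrN !(normrM (abel4 e k)) (ger0_norm (abel4_ge0 _ _)).
  by apply: lerD; rewrite ler_wpM2l// ler_piMr ?abel4_ge0 ?normr_cos_le1 ?normr_sin_le1.
Qed.

(** Real part of: the integral of A + iB against the smoothed v equals the Abel integral of v~(k)
    times the transform of A + iB at -k. It is the inversion formula put under the integral in x,
    followed by Fubini. *)
Lemma abel_pairing A B v1 v2 e : 0 < e ->
  dominated A -> dominated B -> dominated v1 -> dominated v2 ->
  \int[lam]_x (A x * (\int[lam]_y (v1 y * poisson4 e (sub4 x y))) -
               B x * (\int[lam]_y (v2 y * poisson4 e (sub4 x y)))) =
  \int[lam]_k (abel4 e k *
    (fre v1 v2 k * (\int[lam]_x (A x * cos (dot x k) - B x * sin (dot x k))) -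
     fim v1 v2 k * (\int[lam]_x (B x * cos (dot x k) + A x * sin (dot x k))))).
Proof.
move=> e0 dA dB d1 d2; have [mA [MA MA0 HA]] := dA; have [mB [MB MB0 HB]] := dB.
have ia := integrable_abel4 e0.
have ma : measurable_fun setT (abel4 e : T4 -> R) by apply/measurable_EFinP; exact: measurable_int ia.
have [K K0 HK] := bounded_fre d1 d2.
have mr := measurable_fre d1 d2; have mi := measurable_fim d1 d2.
(* The pair (v2, -v1) represents -iv, so the inversion formula for real parts applied to it yields
   the imaginary part of v. *)
have d1N : dominated (fun z => - v1 z) by exact: dominatedN.
have Er k : fre v2 (fun z => - v1 z) k = fim v1 v2 k.
  by apply: eq_Rintegral => z _; rewrite mulNr.
have Ei k : fim v2 (fun z => - v1 z) k = - fre v1 v2 k.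
  rewrite -mulN1r /fre -RintegralZl//; last exact/dominated_int/dominated_re.
  by apply: eq_Rintegral => z _; ring.
have iT (f : T4 -> R) : measurable_fun setT f -> (forall k, `|f k| <= 2 * K * abel4 e k) ->
    lam.-integrable setT (EFin \o f).
  move=> mf Hf; apply: (integrable_le mf _ Hf).
  rewrite (_ : EFin \o _ = (fun z => (2 * K)%:E * (EFin \o abel4 e) z)%E); last by apply/funext => z; rewrite /= EFinM.
  exact: integrableZl.
have bd (k : T4) (s t : R) : `|s| <= 1 -> `|t| <= 1 ->
    `|abel4 e k * (s * fre v1 v2 k + t * fim v1 v2 k)| <= 2 * K * abel4 e k.
  move=> s1 t1; rewrite normrM (ger0_norm (abel4_ge0 _ _)) mulrC ler_wpM2r ?abel4_ge0//.
  rewrite (le_trans (ler_normD _ _))// !normrM mulrDl mul1r; have [h1 h2] := HK k.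
  by rewrite lerD// (le_trans (ler_piMl _ _) _)//.
pose F (z : T4 * T4) := A z.1 * (abel4 e z.2 * (cos (dot z.1 z.2) * fre v1 v2 z.2 + - sin (dot z.1 z.2) * fim v1 v2 z.2)) +
  (- B z.1) * (abel4 e z.2 * (sin (dot z.1 z.2) * fre v1 v2 z.2 + cos (dot z.1 z.2) * fim v1 v2 z.2)).
have mF : measurable_fun setT F by have := measurable_dot => md; rewrite /F; mfun.
transitivity (\int[lam]_x \int[lam]_k F (x, k)).
  apply: eq_Rintegral => x _; have mdx := measurable_dotr x.
  rewrite (abel_inversion x e0 d1 d2) (abel_inversion x e0 d2 d1N) /F /= Rintegral_lin; first last.
  - by apply: iT => [|k]; [mfun|apply: bd; rewrite ?normr_cos_le1 ?normr_sin_le1].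
  - by apply: iT => [|k]; [mfun|apply: bd; rewrite ?normrN ?normr_cos_le1 ?normr_sin_le1].
  rewrite mulNr; congr (_ * _ - _ * _); apply: eq_Rintegral => k _; rewrite ?Er ?Ei; ring.
have d12 : dominated (fun y => `|A y| + `|B y|).
  split; first by mfun.
  by exists (MA + MB) => [|z]; rewrite ?addr_ge0// ger0_norm ?addr_ge0// mulrDl lerD.
have i2 : lam.-integrable setT (EFin \o (fun k => 2 * K * abel4 e k)).
  by apply: iT => [|k]; [mfun|rewrite ger0_norm// mulr_ge0 ?abel4_ge0// mulr_ge0].
rewrite (@Rintegral_swap _ _ _ _ R lam lam F _ _ mF (dominated_int d12) i2).
- apply: eq_Rintegral => k _; rewrite /F /=.
  have E x : A x * (abel4 e k * (cos (dot x k) * fre v1 v2 k + - sin (dot x k) * fim v1 v2 k)) +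
      - B x * (abel4 e k * (sin (dot x k) * fre v1 v2 k + cos (dot x k) * fim v1 v2 k)) =
    (abel4 e k * fre v1 v2 k) * (A x * cos (dot x k) - B x * sin (dot x k)) +
    (- (abel4 e k * fim v1 v2 k)) * (B x * cos (dot x k) + A x * sin (dot x k)).
    by ring.
  under eq_Rintegral do rewrite E.
  rewrite Rintegral_lin; first by ring.
  + exact: (dominated_int (dominated_im k dB dA)).
  + exact: (dominated_int (dominated_re k dB dA)).
- by move=> y; rewrite addr_ge0.
- by move=> k; rewrite mulr_ge0 ?abel4_ge0// mulr_ge0.
- move=> y k; rewrite /F /= mulrDl (le_trans (ler_normD _ _))// (normrM (A y)) (normrM (- B y)) normrN.
  by apply: lerD; rewrite ler_wpM2l// bd ?normrN ?normr_cos_le1 ?normr_sin_le1.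
Qed.

End convolution.

(** * The convolution inequality *)

Section convolution_theorem.
Variable R : realType.
Local Notation RM := (measurableTypeR R).
Local Notation T4 := (RM * (RM * (RM * RM)))%type.
Local Notation lam := (leb4 R).

Lemma poisson4_le16 (z : T4) : poisson4 1 z <= 16 :> R.
Proof.
have p0 (x : R) : 0 <= poisson 1 x by exact: poisson_ge0.
have p2 (x : R) : poisson 1 x <= 2.
  have x1 : 0 < 1 + x ^+ 2 by rewrite ltr_pwDl ?sqr_ge0.
  by rewrite /poisson expr1n ler_pdivrMr// mulr1 ler_peMr// lerDl sqr_ge0.
have -> : 16 = 2 * (2 * (2 * 2)) :> R by ring.
rewrite /poisson4; apply: ler_pM => //; first by apply: mulr_ge0 => //; exact: mulr_ge0.
apply: ler_pM => //; first exact: mulr_ge0.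
exact: ler_pM.
Qed.

Lemma dominated_bounded (f : T4 -> R) : dominated f -> exists2 N, 0 <= N & forall z, `|f z| <= N.
Proof.
move=> [_ [M M0 HM]]; exists (M * 16); first by rewrite mulr_ge0.
by move=> z; rewrite (le_trans (HM z))// ler_wpM2l// poisson4_le16.
Qed.

(** If some coordinate differs by at least 1, then [clip4] is at least 1 and the bound 2N on the
    oscillation suffices; otherwise [clip4] is the sum of the absolute values and the Lipschitz
    bound applies. *)
Lemma lipschitz_clip (v : T4 -> R) : dominated v -> lipschitz4 v ->
  exists2 C, 0 <= C & forall x y, `|v y - v x| <= C * clip4 (sub4 x y).
Proof.
move=> dv [L L0 HL]; have [N N0 HN] := dominated_bounded dv.
exists (2 * N + L) => [|x y]; first by rewrite addr_ge0// mulr_ge0.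
have b2 : `|v y - v x| <= 2 * N.
  by rewrite (le_trans (ler_normB _ _))// mulr2n mulrDl !mul1r lerD.
have := HL x y; rewrite distrC /clip4 /sub4 /sub3 /= /clip.
move: (x.1 - y.1) (x.2.1 - y.2.1) (x.2.2.1 - y.2.2.1) (x.2.2.2 - y.2.2.2) => p q r s.
have n0 (t : R) : 0 <= `|t| by [].
have m0 (t : R) : 0 <= Num.min 1 `|t| by rewrite le_min ler01 n0.
have big (t T : R) : 1 <= t -> 0 <= T -> t <= T -> `|v y - v x| <= (2 * N + L) * T.
  move=> t1 T0 tT; rewrite (le_trans b2)//.
  rewrite (_ : (2 * N + L) * T = 2 * N * T + L * T); last by ring.
  rewrite -[leLHS]addr0 lerD ?mulr_ge0//.
  by rewrite ler_peMr ?mulr_ge0// (le_trans t1).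
have [p1|p1] := leP 1 `|p|.
  by move=> _; apply: (big 1) => //; rewrite ?addr_ge0// lerDl !addr_ge0.
have [q1|q1] := leP 1 `|q|.
  move=> _; apply: (big 1); rewrite ?addr_ge0//.
  by rewrite addrCA lerDl !addr_ge0.
have [r1|r1] := leP 1 `|r|.
  move=> _; apply: (big 1); rewrite ?addr_ge0//.
  by rewrite addrA [X in _ <= X]addrC -addrA lerDl !addr_ge0.
have [s1|s1] := leP 1 `|s|.
  move=> _; apply: (big 1); rewrite ?addr_ge0//.
  by rewrite !addrA [X in _ <= X]addrC lerDl !addr_ge0.
move=> H; rewrite (le_trans H)// !addrA ler_wpM2r ?addr_ge0// lerDr mulr_ge0//.
Qed.

Lemma integrable_poisson4_sub e (x : T4) : 0 < e ->
  lam.-integrable setT (EFin \o (fun y => poisson4 e (sub4 x y))).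
Proof.
move=> e0; have [ms Hs] := preserving_sub4r x.
have mp := measurable_poisson4 e0.
have mps : measurable_fun setT (fun y => poisson4 e (sub4 x y)).
  exact: (measurableT_comp mp ms).
apply/integrableP; split; first exact/measurable_EFinP.
rewrite (_ : (\int[lam]_y `|(EFin \o (fun y => poisson4 e (sub4 x y))) y|)%E = ((2 * pi) ^+ 4)%:E) ?ltry//.
rewrite -(integral_poisson4 e0) -(Hs (fun z => (poisson4 e z)%:E)); first last.
- by move=> z; rewrite lee_fin poisson4_ge0.
- exact/measurable_EFinP.
by apply: eq_integral => y _; rewrite /= (ger0_norm (poisson4_ge0 _ e0)).
Qed.

Lemma Rintegral_poisson4_sub e (x : T4) : 0 < e ->
  \int[lam]_y poisson4 e (sub4 x y) = (2 * pi) ^+ 4.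
Proof.
move=> e0; have [ms Hs] := preserving_sub4r x; have mp := measurable_poisson4 e0.
rewrite /Rintegral (Hs (fun z => (poisson4 e z)%:E)); first by rewrite integral_poisson4.
- exact/measurable_EFinP.
- by move=> z; rewrite lee_fin poisson4_ge0.
Qed.

(** The kernel has mass (2 pi)^4, so the difference is the integral of v(y) - v(x) against it. The
    error depends on e only through d and is uniform in x. *)
Lemma poisson_approx (v : T4 -> R) : dominated v -> lipschitz4 v ->
  exists2 C, 0 <= C & forall e d x, 0 < e ->
    (\int[leb R]_z (poisson e z * clip z)%:E <= d%:E)%E ->
    `|\int[lam]_y (v y * poisson4 e (sub4 x y)) - (2 * pi) ^+ 4 * v x| <= C * d.
Proof.
move=> dv lv; have [C C0 HC] := lipschitz_clip dv lv.
have [N N0 HN] := dominated_bounded dv; have mv := dv.1.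
have pi0 : 0 <= 2 * pi :> R by rewrite mulr_ge0// pi_ge0.
exists (C * (4 * (2 * pi) ^+ 3)) => [|e d x e0 Hd]; first by rewrite mulr_ge0// mulr_ge0// exprn_ge0.
have [ms Hs] := preserving_sub4r x.
have iq := integrable_poisson4_sub x e0.
have mp := measurable_poisson4 e0.
have mq : measurable_fun setT (fun y => poisson4 e (sub4 x y)) by exact: (measurableT_comp mp ms).
have ivq : lam.-integrable setT (EFin \o (fun y => v y * poisson4 e (sub4 x y))).
  apply: (@integrable_le _ _ _ lam _ (fun y => N * poisson4 e (sub4 x y))); first by mfun.
    rewrite (_ : EFin \o _ = (fun z => N%:E * (EFin \o (fun y => poisson4 e (sub4 x y))) z)%E); last by apply/funext => z; rewrite /= EFinM.
    exact: integrableZl.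
  by move=> y; rewrite normrM (ger0_norm (poisson4_ge0 _ e0)) ler_wpM2r ?poisson4_ge0.
have -> : \int[lam]_y (v y * poisson4 e (sub4 x y)) - (2 * pi) ^+ 4 * v x =
    \int[lam]_y (1 * (v y * poisson4 e (sub4 x y)) + (- v x) * poisson4 e (sub4 x y)).
  by rewrite Rintegral_lin// Rintegral_poisson4_sub//; ring.
have E y : 1 * (v y * poisson4 e (sub4 x y)) + (- v x) * poisson4 e (sub4 x y) = (v y - v x) * poisson4 e (sub4 x y) by ring.
under eq_Rintegral do rewrite E.
have mf : measurable_fun setT (fun y => ((v y - v x) * poisson4 e (sub4 x y))%:E).
  by apply/measurable_EFinP; mfun.
have intf : lam.-integrable setT (EFin \o (fun y => (v y - v x) * poisson4 e (sub4 x y))).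
  have := integrable_lin 1 (- v x) ivq iq.
  by apply: eq_integrable => // y _ /=; rewrite E.
rewrite -lee_fin EFin_normr_Rintegral//.
apply: (le_trans (le_abse_integral lam measurableT mf)).
have mpc : measurable_fun setT (fun z : T4 => (poisson4 e z * clip4 z)%:E).
  by apply/measurable_EFinP; have := @measurable_clip4 R => ?; mfun.
have pc0 (z : T4) : (0 <= (poisson4 e z * clip4 z)%:E)%E.
  by rewrite lee_fin mulr_ge0 ?poisson4_ge0 ?clip4_ge0.
apply: (@le_trans _ _ (\int[lam]_y (C%:E * (poisson4 e (sub4 x y) * clip4 (sub4 x y))%:E))%E).
  apply: ge0_le_integral => //.
  - exact: measurableT_comp.
  - apply: emeasurable_funM; first exact: measurable_cst.
    exact: (measurableT_comp mpc ms).
  - move=> y _; rewrite -EFinM lee_fin normrM (ger0_norm (poisson4_ge0 _ e0)).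
    rewrite [leRHS](_ : _ = (C * clip4 (sub4 x y)) * poisson4 e (sub4 x y)); last by ring.
    by apply: ler_wpM2r; [exact: poisson4_ge0|exact: HC].
rewrite ge0_integralZl//; first last.
- exact: (measurableT_comp mpc ms).
rewrite (Hs (fun z => (poisson4 e z * clip4 z)%:E) mpc pc0) -mulrA EFinM.
by apply: lee_wpmul2l; [rewrite lee_fin|exact: integral_poisson4_clip].
Qed.

(** The left side is |Re| of (a - ib)(r + is)(p + iq) and the right side its modulus; the square
    added in the proof is that of the imaginary part. *)
Lemma trilinear_cs (a b p q r s : R) :
  `|p * (a * r + b * s) - q * (a * s - b * r)| <=
  Num.sqrt (a ^+ 2 + b ^+ 2) * (Num.sqrt (r ^+ 2 + s ^+ 2) * Num.sqrt (p ^+ 2 + q ^+ 2)).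
Proof.
have P (x y : R) : 0 <= x ^+ 2 + y ^+ 2 by rewrite addr_ge0 ?sqr_ge0.
rewrite -sqrtrM// -sqrtrM// -sqrtr_sqr ler_wsqrtr//.
have : 0 <= (a * (p * s + q * r) - b * (p * r - q * s)) ^+ 2 by exact: sqr_ge0.
have -> : (a ^+ 2 + b ^+ 2) * ((r ^+ 2 + s ^+ 2) * (p ^+ 2 + q ^+ 2)) =
  (p * (a * r + b * s) - q * (a * s - b * r)) ^+ 2 + (a * (p * s + q * r) - b * (p * r - q * s)) ^+ 2 by ring.
by rewrite lerDl.
Qed.

Lemma convolution_le u1 u2 v1 v2 (k : T4) :
  dominated u1 -> dominated u2 -> dominated v1 -> dominated v2 ->
  lipschitz4 v1 -> lipschitz4 v2 ->
  (((2 * pi) ^+ 4 * fnorm (fun x => u1 x * v1 x - u2 x * v2 x)%R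
      (fun x => u1 x * v2 x + u2 x * v1 x)%R k)%:E <=
   \int[lam]_h (fnorm u1 u2 (sub4 k h) * fnorm v1 v2 h)%:E)%E.
Proof.
move=> du1 du2 dv1 dv2 lv1 lv2.
set w1 := (fun x => u1 x * v1 x - u2 x * v2 x)%R; set w2 := (fun x => u1 x * v2 x + u2 x * v1 x)%R.
have [N1 N10 HN1] := dominated_bounded dv1; have [N2 N20 HN2] := dominated_bounded dv2.
have mv1 := dv1.1; have mv2 := dv2.1.
have dw1 : dominated w1.
  by apply: dominatedD; [exact: (dominatedM du1 mv1 HN1)|apply: dominatedN; exact: (dominatedM du2 mv2 HN2)].
have dw2 : dominated w2.
  by apply: dominatedD; [exact: (dominatedM du1 mv2 HN2)|exact: (dominatedM du2 mv1 HN1)].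
set N := (\int[lam]_h _)%E.
have N0 : (0 <= N)%E by apply: integral_ge0 => h _; rewrite lee_fin mulr_ge0// fnorm_ge0.
set n := fnorm w1 w2 k; have := fnorm_ge0 w1 w2 k; rewrite -/n le_eqVlt => /predU1P[<-|n0].
  by rewrite mulr0.
set a := fre w1 w2 k; set b := fim w1 w2 k.
pose c1 x := u1 x * cos (dot x k) + u2 x * sin (dot x k).
pose c2 x := u2 x * cos (dot x k) - u1 x * sin (dot x k).
have dc1 : dominated c1 by exact: dominated_re.
have dc2 : dominated c2 by exact: dominated_im.
have dZ (c : R) (f : T4 -> R) : dominated f -> dominated (fun x => c * f x).
  move=> [mf [M M0 HM]]; split; first by mfun.
  by exists (`|c| * M) => [|z]; rewrite ?mulr_ge0// normrM -mulrA ler_wpM2l.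
(* A + i B = (a - i b) (u1 + i u2) e^{-i x.k}, so that the integral of Re ((A + i B) (v1 + i v2))
   is a ^+ 2 + b ^+ 2 = n ^+ 2. *)
pose A x := a * c1 x + b * c2 x; pose B x := a * c2 x + (- b) * c1 x.
have dA : dominated A by apply: dominatedD; exact: dZ.
have dB : dominated B by apply: dominatedD; exact: dZ.
have nE : n ^+ 2 = \int[lam]_x (1 * (A x * v1 x) + (-1) * (B x * v2 x)).
  rewrite /n /fnorm sqr_sqrtr ?addr_ge0 ?sqr_ge0// -/a -/b !expr2 {2}/a {2}/b /fre /fim.
  rewrite -Rintegral_lin; [|exact/dominated_int/dominated_re|exact/dominated_int/dominated_im].
  by apply: eq_Rintegral => x _; rewrite /A /B /c1 /c2 /w1 /w2; ring.
have [C1 C10 HC1] := poisson_approx dv1 lv1; have [C2 C20 HC2] := poisson_approx dv2 lv2.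
have [mA [MA MA0 HA]] := dA; have [mB [MB MB0 HB]] := dB.
have pi0 : 0 <= 2 * pi :> R by rewrite mulr_ge0// pi_ge0.
pose K := (MA * C1 + MB * C2) * (2 * pi) ^+ 4.
have K0 : 0 <= K by rewrite mulr_ge0 ?exprn_ge0// addr_ge0// mulr_ge0.
(* Pairing with the conjugate of the value at k produces [n] squared; the surplus factor is divided
   out, which is why n = 0 was settled first. *)
suff main : (((2 * pi) ^+ 4 * n ^+ 2)%:E <= n%:E * N)%E.
  by move: main; rewrite expr2 mulrCA EFinM lee_pmul2l.
apply/lee_addgt0Pr => d d0.
(* [K] is the total error per unit of modulus. It may be 0, hence the division by K + 1. *)
have dK : 0 < d / (K + 1) by rewrite divr_gt0// ltr_wpDl.
have [e [e0 He]] := poisson_modulus dK.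
pose P (v : T4 -> R) x := \int[lam]_y (v y * poisson4 e (sub4 x y)).
have mP v : dominated v -> measurable_fun setT (P v).
  move=> [mv _]; apply: (@measurable_Rintegral_l _ _ T4 T4 R lam (fun z => v z.2 * poisson4 e (sub4 z.1 z.2))).
  have ms := @measurable_sub4 R; have mp := measurable_poisson4 e0.
  have mps : measurable_fun setT (fun z : T4 * T4 => poisson4 e (sub4 z.1 z.2)) by exact: (measurableT_comp mp ms).
  by mfun.
have mP1 := mP _ dv1; have mP2 := mP _ dv2.
have HP1 x := HC1 e _ x e0 He; have HP2 x := HC2 e _ x e0 He.
have dD (f v : T4 -> R) C M : dominated f -> dominated v -> (forall z, `|v z| <= M) ->
   (forall x, `|P v x - (2 * pi) ^+ 4 * v x| <= C) -> dominated (fun x => f x * P v x).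
  move=> df dv Hv HC; apply: (@dominatedM _ _ _ (C + (2 * pi) ^+ 4 * M) df); first exact: mP.
  move=> x; have -> : P v x = (P v x - (2 * pi) ^+ 4 * v x) + (2 * pi) ^+ 4 * v x by ring.
  rewrite (le_trans (ler_normD _ _))// lerD// normrM ger0_norm ?exprn_ge0// ler_wpM2l// exprn_ge0//.
have iAP : lam.-integrable setT (EFin \o (fun x => A x * P v1 x)) := dominated_int (dD _ _ _ _ dA dv1 HN1 HP1).
have iBP : lam.-integrable setT (EFin \o (fun x => B x * P v2 x)) := dominated_int (dD _ _ _ _ dB dv2 HN2 HP2).
have iAv : lam.-integrable setT (EFin \o (fun x => A x * v1 x)) := dominated_int (dominatedM dA mv1 HN1).
have iBv : lam.-integrable setT (EFin \o (fun x => B x * v2 x)) := dominated_int (dominatedM dB mv2 HN2).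
set X := \int[lam]_x (A x * P v1 x - B x * P v2 x).
have XE : X = \int[lam]_x (1 * (A x * P v1 x) + (-1) * (B x * P v2 x)).
  by apply: eq_Rintegral => x _; ring.
have close : (2 * pi) ^+ 4 * n ^+ 2 - X <= d.
  have -> : (2 * pi) ^+ 4 * n ^+ 2 - X =
    \int[lam]_x ((2 * pi) ^+ 4 * (1 * (A x * v1 x) + (-1) * (B x * v2 x)) + (-1) * (1 * (A x * P v1 x) + (-1) * (B x * P v2 x))).
    by rewrite Rintegral_lin; [rewrite -nE -XE; ring|exact: integrable_lin|exact: integrable_lin].
  apply: (@le_trans _ _ (K * (d / (K + 1)))); last first.
    by rewrite mulrCA ler_piMr ?(ltW d0)// ler_pdivrMr ?ltr_wpDl// mul1r lerDl.
  rewrite (le_trans (ler_norm _))//.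
  have -> : K * (d / (K + 1)) = ((MA * C1 + MB * C2) * (d / (K + 1))) * (2 * pi) ^+ 4 by rewrite /K; ring.
  apply: Rintegral_bound; first by mfun.
    by rewrite mulr_ge0 ?(ltW dK)// addr_ge0// mulr_ge0.
  move=> x.
  have -> : (2 * pi) ^+ 4 * (1 * (A x * v1 x) + (-1) * (B x * v2 x)) + (-1) * (1 * (A x * P v1 x) + (-1) * (B x * P v2 x)) =
    B x * (P v2 x - (2 * pi) ^+ 4 * v2 x) - A x * (P v1 x - (2 * pi) ^+ 4 * v1 x) by ring.
  rewrite (le_trans (ler_normB _ _))//.
  have -> : (MA * C1 + MB * C2) * (d / (K + 1)) * poisson4 1 x =
    MB * poisson4 1 x * (C2 * (d / (K + 1))) + MA * poisson4 1 x * (C1 * (d / (K + 1))) by ring.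
  by apply: lerD; rewrite normrM; [apply: ler_pM (HB x) (HP2 x)|apply: ler_pM (HA x) (HP1 x)].
have Xle : (X%:E <= n%:E * N)%E.
  rewrite /X (abel_pairing e0 dA dB dv1 dv2).
  (* As A + iB carries the phase e^{-ix.k}, its transform at -h is (a - ib) u~(k - h). So [G h] is
     the real part of (a - ib) u~(k - h) v~(h). *)
  pose G h := fre v1 v2 h * (a * fre u1 u2 (sub4 k h) + b * fim u1 u2 (sub4 k h)) -
     fim v1 v2 h * (a * fim u1 u2 (sub4 k h) - b * fre u1 u2 (sub4 k h)).
  have GE h : fre v1 v2 h * (\int[lam]_x (A x * cos (dot x h) - B x * sin (dot x h))) -
     fim v1 v2 h * (\int[lam]_x (B x * cos (dot x h) + A x * sin (dot x h))) = G h.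
    have i1 := dominated_int (dominated_re (sub4 k h) du1 du2).
    have i2 := dominated_int (dominated_im (sub4 k h) du1 du2).
    have -> : \int[lam]_x (A x * cos (dot x h) - B x * sin (dot x h)) =
        a * fre u1 u2 (sub4 k h) + b * fim u1 u2 (sub4 k h).
      rewrite /fre /fim -Rintegral_lin//; apply: eq_Rintegral => x _.
      by rewrite /A /B /c1 /c2 dot_sub4r cosD sinD cosN sinN; ring.
    have -> : \int[lam]_x (B x * cos (dot x h) + A x * sin (dot x h)) =
        a * fim u1 u2 (sub4 k h) + (- b) * fre u1 u2 (sub4 k h).
      rewrite /fre /fim -Rintegral_lin//; apply: eq_Rintegral => x _.
      by rewrite /A /B /c1 /c2 dot_sub4r cosD sinD cosN sinN; ring.
    by rewrite /G mulNr.
  under eq_Rintegral do rewrite GE.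
  have mr := measurable_fre du1 du2; have mi := measurable_fim du1 du2.
  have mr' := measurable_fre dv1 dv2; have mi' := measurable_fim dv1 dv2.
  have [ms _] := preserving_sub4r k.
  have mrs : measurable_fun setT (fun h => fre u1 u2 (sub4 k h)) := measurableT_comp mr ms.
  have mis : measurable_fun setT (fun h => fim u1 u2 (sub4 k h)) := measurableT_comp mi ms.
  have mG : measurable_fun setT G by rewrite /G; mfun.
  have ia := integrable_abel4 e0.
  have ma : measurable_fun setT (abel4 e : T4 -> R) by apply/measurable_EFinP; exact: measurable_int ia.
  have Gn h : `|G h| <= n * (fnorm u1 u2 (sub4 k h) * fnorm v1 v2 h) by exact: trilinear_cs.
  have mn : measurable_fun setT (fun h => fnorm u1 u2 (sub4 k h) * fnorm v1 v2 h).
    have m1 : measurable_fun setT (fun h => fnorm u1 u2 (sub4 k h)) := measurableT_comp (measurable_fnorm du1 du2) ms.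
    by have m2 := measurable_fnorm dv1 dv2; mfun.
  have maG : measurable_fun setT (fun h => (abel4 e h * G h)%:E) by apply/measurable_EFinP; mfun.
  (* Integrability of the Abel integrand comes from bounded transforms and not from [N], which may
     be infinite. *)
  have [Ku _ HKu] := bounded_fre du1 du2; have [Kv _ HKv] := bounded_fre dv1 dv2.
  have fb (u1' u2' : T4 -> R) (K' : R) : (forall h, `|fre u1' u2' h| <= K' /\ `|fim u1' u2' h| <= K') ->
      forall h, fnorm u1' u2' h <= Num.sqrt (K' ^+ 2 + K' ^+ 2).
    move=> H h; apply: ler_wsqrtr; have [h1 h2] := H h.
    by apply: lerD; rewrite -[leLHS]real_normK ?num_real// ler_pXn2r// nnegrE ?(le_trans _ h1).
  have iaG : lam.-integrable setT (EFin \o (fun h => abel4 e h * G h)).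
    pose Z := n * (Num.sqrt (Ku ^+ 2 + Ku ^+ 2) * Num.sqrt (Kv ^+ 2 + Kv ^+ 2)).
    apply: (@integrable_le _ _ _ lam _ (fun h => Z * abel4 e h)); first exact/measurable_EFinP.
      rewrite (_ : EFin \o _ = (fun z => Z%:E * (EFin \o abel4 e) z)%E); last by apply/funext => z; rewrite /= EFinM.
      exact: integrableZl.
    move=> h; rewrite normrM (ger0_norm (abel4_ge0 _ _)) mulrC ler_wpM2r ?abel4_ge0//.
    rewrite (le_trans (Gn h))// ler_wpM2l ?(ltW n0)//.
    by rewrite ler_pM ?fnorm_ge0// fb.
  apply: (@le_trans _ _ (`|\int[lam]_h (abel4 e h * G h)|%:E)); first by rewrite lee_fin ler_norm.
  rewrite (EFin_normr_Rintegral measurableT iaG).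
  apply: (le_trans (le_abse_integral lam measurableT maG)).
  rewrite /N -ge0_integralZl//; first last.
  - by rewrite lee_fin ltW.
  - by move=> h _; rewrite lee_fin mulr_ge0// fnorm_ge0.
  - exact/measurable_EFinP.
  apply: ge0_le_integral => //.
  - exact: measurableT_comp.
  - by apply: emeasurable_funM; [exact: measurable_cst|exact/measurable_EFinP].
  - move=> h _ /=; rewrite lee_fin normrM (ger0_norm (abel4_ge0 _ _)) (le_trans _ (Gn h))//.
    by rewrite ler_piMl// abel4_le1.
apply: (@le_trans _ _ (X + d)%:E); first by rewrite lee_fin -lerBlDl.
by rewrite EFinD leeD2r.
Qed.

End convolution_theorem.

(** * Square integrals of the weights *)

Section weights.
Variable R : realType.
Local Notation RM := (measurableTypeR R).
Local Notation T3 := (RM * (RM * RM))%type.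

Lemma jbr_ge1 (y : R) : 1 <= jbr y.
Proof. by rewrite /jbr -{1}(sqrtr1 R) ler_wsqrtr// lerDl sqr_ge0. Qed.

Lemma jbr_gt0 (y : R) : 0 < jbr y.
Proof. exact: lt_le_trans (jbr_ge1 y). Qed.

Lemma le_jbr (x y : R) : `|x| <= `|y| -> jbr x <= jbr y.
Proof.
move=> xy; apply: ler_wsqrtr; rewrite lerD2l -[leLHS]real_normK ?num_real//.
by rewrite -[leRHS]real_normK ?num_real// ler_pXn2r// nnegrE.
Qed.

Lemma le_1Dnorm_jbr (y : R) : 1 + `|y| <= 2 * jbr y.
Proof.
have h : `|y| <= jbr y by rewrite -sqrtr_sqr ler_wsqrtr// lerDr.
by have := jbr_ge1 y; lra.
Qed.

Lemma norm3_ge0 (x y z : R) : 0 <= norm3 x y z. Proof. exact: sqrtr_ge0. Qed.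

Lemma sqr_norm3 (x y z : R) : norm3 x y z ^+ 2 = x ^+ 2 + y ^+ 2 + z ^+ 2.
Proof. by rewrite sqr_sqrtr// !addr_ge0 ?sqr_ge0. Qed.

Lemma norm3_ler (x y z : R) : [/\ `|x| <= norm3 x y z, `|y| <= norm3 x y z & `|z| <= norm3 x y z].
Proof.
rewrite /norm3 -!sqrtr_sqr; have := sqr_ge0 x; have := sqr_ge0 y; have := sqr_ge0 z => hz hy hx.
by split; apply: ler_wsqrtr; lra.
Qed.

Lemma ler_powRN (p x y : R) : 0 <= p -> 0 < x -> x <= y -> y `^ (- p) <= x `^ (- p).
Proof.
move=> p0 x0 xy; have y0 := lt_le_trans x0 xy.
rewrite !powRN lef_pV2 ?posrE ?powR_gt0//.
by apply: ge0_ler_powR => //; rewrite nnegrE ltW.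
Qed.

Lemma powR_sqr (x p : R) : (x `^ p) ^+ 2 = x `^ (2 * p).
Proof. by rewrite -powR_mulrn ?powR_ge0// -powRrM mulrC. Qed.

Lemma jbr_powRN (p y : R) : 0 <= p -> jbr y `^ (- p) <= 2 `^ p * (1 + `|y|) `^ (- p).
Proof.
move=> p0; have h : 0 < (1 + `|y|) / 2 by rewrite divr_gt0// ltr_wpDr.
apply: (@le_trans _ _ (((1 + `|y|) / 2) `^ (- p))).
  by apply: ler_powRN => //; rewrite ler_pdivrMr// mulrC le_1Dnorm_jbr.
rewrite powRM//.
by rewrite mulrC -(powR_inv1 (ler0n R 2)) -powRrM mulN1r opprK.
Qed.

Definition xi_norm (xi : T3) : R := norm3 xi.1 xi.2.1 xi.2.2.
Definition xi_jb (xi : T3) : R := jbr (xi_norm xi).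

Lemma xi_norm_ge0 xi : 0 <= xi_norm xi. Proof. exact: norm3_ge0. Qed.

Lemma xi_jb_gt0 xi : 0 < xi_jb xi. Proof. exact: jbr_gt0. Qed.

Lemma le_xi_jb xi eta : xi_norm xi <= xi_norm eta -> xi_jb xi <= xi_jb eta.
Proof. by move=> h; apply: le_jbr; rewrite !ger0_norm ?xi_norm_ge0. Qed.

Lemma measurable_xi_norm : measurable_fun setT xi_norm.
Proof. by rewrite /xi_norm /norm3; mfun. Qed.

Lemma measurable_xi_jb : measurable_fun setT xi_jb.
Proof. by have := measurable_xi_norm => ?; rewrite /xi_jb /jbr; mfun. Qed.

(** Every coordinate is at most |xi|, so each can be given a third of the decay. Integrals over R^3
    then factor into integrals on the line, with the sharp exponent 3 and without polar
    coordinates. *)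
Lemma xi_jb_powRN (p : R) xi : 0 <= p ->
  xi_jb xi `^ (- (3 * p)) <= (2 `^ p * (1 + `|xi.1|) `^ (- p)) *
    ((2 `^ p * (1 + `|xi.2.1|) `^ (- p)) * (2 `^ p * (1 + `|xi.2.2|) `^ (- p))).
Proof.
move=> p0; have [h1 h2 h3] := norm3_ler xi.1 xi.2.1 xi.2.2.
have H (y : R) : `|y| <= norm3 xi.1 xi.2.1 xi.2.2 -> xi_jb xi `^ (- p) <= 2 `^ p * (1 + `|y|) `^ (- p).
  move=> hy; apply: le_trans (jbr_powRN y p0); apply: ler_powRN => //; first exact: jbr_gt0.
  by apply: le_jbr; rewrite [leRHS]ger0_norm ?norm3_ge0.
have -> : - (3 * p) = - p + (- p + - p) by ring.
have nz : xi_jb xi != 0 by rewrite lt0r_neq0 ?xi_jb_gt0.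
rewrite (powRD (x := xi_jb xi)) ?nz ?implybT// (powRD (x := xi_jb xi)) ?nz ?implybT//.
apply: ler_pM; [exact: powR_ge0|by rewrite mulr_ge0 ?powR_ge0|exact: H|].
by apply: ler_pM; [exact: powR_ge0|exact: powR_ge0|exact: H|exact: H].
Qed.

Lemma tensor3_integral (f : RM -> R) :
  (forall x, 0 <= f x) -> measurable_fun setT f ->
  (\int[leb3 R]_z (f z.1 * (f z.2.1 * f z.2.2))%:E =
   (\int[leb R]_x (f x)%:E) * ((\int[leb R]_x (f x)%:E) * (\int[leb R]_x (f x)%:E)))%E.
Proof.
move=> p m.
have p2 (z : RM * RM) : 0 <= f z.1 * f z.2 by rewrite mulr_ge0.
rewrite (@ge0_integral_tensor _ _ _ _ _ (leb R) (prodm (leb R) (leb R)) f (fun z => f z.1 * f z.2) p p2 m); last by mfun.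
by rewrite (@ge0_integral_tensor _ _ _ _ _ (leb R) (leb R) f f p p m m).
Qed.

Definition lowfreq (a s : R) (xi eta : T3) : R :=
  if xi_norm eta <= xi_norm xi then xi_jb xi `^ (- a) * xi_jb eta `^ (- s) else 0.

Lemma lowfreq_ge0 a s xi eta : 0 <= lowfreq a s xi eta.
Proof. by rewrite /lowfreq; case: ifP => // _; rewrite mulr_ge0 ?powR_ge0. Qed.

Lemma measurable_lowfreq d (T : measurableType d) (a s : R) (f g : T -> T3) :
  measurable_fun setT f -> measurable_fun setT g ->
  measurable_fun setT (fun z => lowfreq a s (f z) (g z)).
Proof.
move=> mf mg; have mn := measurable_xi_norm; have mj := measurable_xi_jb.
by apply: measurable_fun_ifT; [apply: measurable_fun_ler|..]; mfun.
Qed.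

(** On the support <eta> <= <xi>, so decay in xi may be traded for decay in eta. *)
Lemma lowfreq_shift (a s c : R) xi eta : 0 <= c -> lowfreq a s xi eta <= lowfreq (a - c) (s + c) xi eta.
Proof.
move=> c0; rewrite /lowfreq; case: ifP => // h.
have nx : xi_jb xi != 0 by rewrite lt0r_neq0 ?xi_jb_gt0.
have ne : xi_jb eta != 0 by rewrite lt0r_neq0 ?xi_jb_gt0.
rewrite (_ : - a = - (a - c) + - c); last by ring.
rewrite (_ : - (s + c) = - c + - s); last by ring.
rewrite (powRD (x := xi_jb xi)) ?nx ?implybT// (powRD (x := xi_jb eta)) ?ne ?implybT// -mulrA.
apply: ler_wpM2l; first exact: powR_ge0.
apply: ler_wpM2r; first exact: powR_ge0.
by apply: ler_powRN => //; [exact: xi_jb_gt0|exact: le_xi_jb].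
Qed.

(* If a + s = 3/2, trading decay in xi for decay in eta brings the exponent of eta into
   (0, 3/2), where the integral over a ball of radius rho grows like a power of rho that
   the remaining decay in xi compensates exactly. *)
Lemma lowfreq_integral (a s : R) : 0 <= a -> 3 / 2 <= a + s -> ~ (a = 0 /\ s = 3 / 2) ->
  exists2 C, 0 <= C & forall xi,
    (\int[leb3 R]_eta (lowfreq a s xi eta ^+ 2)%:E <= C%:E)%E.
Proof.
move=> a0 as32 nas.
have mE (b t : R) xi : measurable_fun setT (fun eta => (lowfreq b t xi eta ^+ 2)%:E).
  apply/measurable_EFinP; apply: measurable_funX.
  by apply: measurable_lowfreq; [exact: measurable_cst|exact: measurable_id].
have shift c xi : 0 <= c -> (\int[leb3 R]_eta (lowfreq a s xi eta ^+ 2)%:E <=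
    \int[leb3 R]_eta (lowfreq (a - c) (s + c) xi eta ^+ 2)%:E)%E.
  move=> c0; apply: ge0_le_integral => //.
  - by move=> eta _; rewrite lee_fin sqr_ge0.
  - by move=> eta _; rewrite lee_fin ler_pXn2r ?nnegrE ?lowfreq_ge0// lowfreq_shift.
have [as32'|as32'] := ltP (3 / 2) (a + s).
  (* All the decay is moved to eta: the squared weight is <eta>^(-3p) with p > 1, integrable over
     the whole space. *)
  pose p := 2 * (a + s) / 3; have p1 : 1 < p by rewrite /p; lra.
  have p0 : 0 <= p by lra.
  pose f (x : RM) : R := 2 `^ p * (1 + `|x|) `^ (- p).
  have f0 x : 0 <= f x by rewrite mulr_ge0 ?powR_ge0.
  have mf : measurable_fun setT f by rewrite /f; mfun.
  have ffin : (\int[leb R]_x (f x)%:E)%E \is a fin_num.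
    rewrite ge0_fin_numE; last by apply: integral_ge0 => x _; rewrite lee_fin.
    under eq_integral do rewrite EFinM.
    rewrite ge0_integralZl//; last by apply/measurable_EFinP; mfun.
    by apply: lte_mul_pinfty; [rewrite lee_fin powR_ge0|by []|exact: integral_powR1Dnorm_fin].
  exists (fine (\int[leb R]_x (f x)%:E)%E ^+ 3) => [|xi].
    by apply/exprn_ge0/fine_ge0/integral_ge0 => x _; rewrite lee_fin.
  apply: (le_trans (shift a xi a0)).
  apply: (@le_trans _ _ (\int[leb3 R]_eta (f eta.1 * (f eta.2.1 * f eta.2.2))%:E)%E); last first.
    rewrite tensor3_integral// -{1 2 3}(fineK ffin) -!EFinM lee_fin le_eqVlt; apply/orP; left.
    by apply/eqP; ring.
  apply: ge0_le_integral => //.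
  - by move=> eta _; rewrite lee_fin sqr_ge0.
  - by apply/measurable_EFinP; mfun.
  - move=> eta _; rewrite lee_fin /lowfreq; case: ifP => _; last by rewrite expr0n/= !mulr_ge0.
    rewrite subrr oppr0 powRr0 mul1r powR_sqr.
    have -> : 2 * - (s + a) = - (3 * p) by rewrite /p; field.
    exact: xi_jb_powRN.
have {as32 as32'} sE : s = 3 / 2 - a by lra.
have apos : 0 < a.
  rewrite lt_neqAle a0 andbT; apply/eqP => a00; apply: nas; rewrite sE -a00; split => //; ring.
(* Only a - a' is moved, so a' > 0 of the decay in xi remains. The cap 3/4 keeps the exponent 3/2 -
   a' of eta positive, and 3q = 2(3/2 - a') defines q. *)
pose a' := Num.min a (3 / 4); have a'0 : 0 < a' by rewrite lt_min apos; lra.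
have a'a : a' <= a by rewrite ge_min lexx.
have a'34 : a' <= 3 / 4 by rewrite ge_min lexx orbT.
pose q := 1 - 2 * a' / 3; have q01 : 0 < q < 1 by rewrite /q; apply/andP; split; lra.
have /andP[q0 q1] := q01.
(* For each coordinate: 2^q for replacing the bracket by 1 + |x|, 2/(1-q) from the integral over an
   interval, and 2^(1-q) from 1 + rho <= 2<rho>. *)
exists ((2 `^ q * (2 / (1 - q)) * 2 `^ (1 - q)) ^+ 3) => [|xi].
  by rewrite exprn_ge0// !mulr_ge0 ?powR_ge0// invr_ge0; lra.
have ca : 0 <= a - a' by rewrite subr_ge0.
apply: (le_trans (shift _ xi ca)).
rewrite (_ : a - (a - a') = a'); last by ring.
rewrite (_ : s + (a - a') = 3 / 2 - a'); last by rewrite sE; ring.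
set rho := xi_norm xi.
(* The ball of radius rho is enlarged to a cube, which keeps the majorant a product. *)
pose f (x : RM) : R := 2 `^ q * (if `|x| <= rho then (1 + `|x|) `^ (- q) else 0).
have g0 (x : R) : 0 <= (if `|x| <= rho then (1 + `|x|) `^ (- q) else 0) by case: ifP; rewrite ?powR_ge0.
have f0 x : 0 <= f x by rewrite mulr_ge0 ?powR_ge0.
have mg : measurable_fun setT (fun x : RM => if `|x| <= rho then (1 + `|x|) `^ (- q) else 0).
  by apply: measurable_fun_ifT; [apply: measurable_fun_ler|..]; mfun.
have mf : measurable_fun setT f by rewrite /f; mfun.
set B := 2 `^ q * (2 / (1 - q) * (1 + rho) `^ (1 - q)).
have fB : (\int[leb R]_x (f x)%:E <= B%:E)%E.
  under eq_integral do rewrite EFinM.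
  rewrite ge0_integralZl//; first last.
  - by move=> x _; rewrite lee_fin.
  - exact/measurable_EFinP.
  rewrite EFinM; apply: lee_wpmul2l; first by rewrite lee_fin powR_ge0.
  by apply: integral_powR1Dnorm_ball => //; exact: xi_norm_ge0.
have If0 : (0 <= \int[leb R]_x (f x)%:E)%E by apply: integral_ge0 => x _; rewrite lee_fin.
have B0 : 0 <= B by rewrite -lee_fin (le_trans If0).
apply: (@le_trans _ _ (\int[leb3 R]_eta (((xi_jb xi `^ (- a')) ^+ 2)%:E * (f eta.1 * (f eta.2.1 * f eta.2.2))%:E))%E).
  apply: ge0_le_integral => //.
  - by move=> eta _; rewrite lee_fin sqr_ge0.
  - by apply: emeasurable_funM; [exact: measurable_cst|apply/measurable_EFinP; mfun].
  - move=> eta _; rewrite -EFinM lee_fin /lowfreq; case: ifP => h; last first.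
      by rewrite expr0n/= mulr_ge0 ?sqr_ge0// !mulr_ge0.
    rewrite exprMn ler_wpM2l ?sqr_ge0// powR_sqr.
    have -> : 2 * - (3 / 2 - a') = - (3 * q) by rewrite /q; field.
    have [h1 h2 h3] := norm3_ler eta.1 eta.2.1 eta.2.2.
    rewrite /f (le_trans h1 h) (le_trans h2 h) (le_trans h3 h).
    by apply: xi_jb_powRN; exact: ltW.
rewrite ge0_integralZl//; first last.
- by rewrite lee_fin sqr_ge0.
- by move=> x _; rewrite lee_fin !mulr_ge0.
- by apply/measurable_EFinP; mfun.
rewrite tensor3_integral//.
apply: (@le_trans _ _ (((xi_jb xi `^ (- a')) ^+ 2)%:E * (B%:E * (B%:E * B%:E)))%E).
  apply: lee_wpmul2l; first by rewrite lee_fin sqr_ge0.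
  apply: lee_pmul => //; first exact: mule_ge0.
  exact: lee_pmul.
rewrite -!EFinM lee_fin -expr2 -exprS.
have r0 : 0 <= rho := xi_norm_ge0 xi.
have Bx : B <= (2 `^ q * (2 / (1 - q)) * 2 `^ (1 - q)) * xi_jb xi `^ (1 - q).
  rewrite /B -!mulrA ler_wpM2l ?powR_ge0// ler_wpM2l// ler_wpM2l ?invr_ge0 ?subr_ge0 ?(ltW q1)//.
  rewrite -powRM ?(ltW (xi_jb_gt0 _))//.
  apply: ge0_ler_powR; rewrite ?nnegrE ?subr_ge0 ?(ltW q1) ?addr_ge0 ?mulr_ge0 ?(ltW (xi_jb_gt0 _))//.
  by have := le_1Dnorm_jbr rho; rewrite (ger0_norm r0).
have J0 := xi_jb_gt0 xi.
apply: (@le_trans _ _ ((xi_jb xi `^ (- a')) ^+ 2 * ((2 `^ q * (2 / (1 - q)) * 2 `^ (1 - q)) * xi_jb xi `^ (1 - q)) ^+ 3)).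
  rewrite ler_wpM2l ?sqr_ge0// ler_pXn2r// nnegrE//.
  by rewrite (le_trans B0).
rewrite exprMn mulrCA ler_piMr ?exprn_ge0 ?mulr_ge0 ?powR_ge0 ?invr_ge0 ?subr_ge0 ?(ltW q1)//.
rewrite powR_sqr -powR_mulrn ?powR_ge0// -powRrM -powRD; last by rewrite (lt0r_neq0 J0) implybT.
(* The growth of the cube integral and the decay kept in xi cancel exactly; this is the
   scaling-critical case. *)
have -> : 2 * - a' + (1 - q) * 3%:R = 0 by rewrite /q; field.
by rewrite powRr0.
Qed.

(** Uniform in r: on each half-line | |t| - r | is |t - r| or |t + r|, and a translate of (1 +
    |t|)^(-2b) has an integral independent of r, finite since 2b > 1. *)
Lemma modulation_integral (b : R) : 1 / 2 < b -> exists2 C, 0 <= C & forall r : R,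
  (\int[leb R]_t ((jbr (`|t| - r) `^ (- b)) ^+ 2)%:E <= C%:E)%E.
Proof.
move=> b12; have p1 : 1 < 2 * b by lra.
have p0 : 0 <= 2 * b by lra.
pose f (x : RM) : R := (1 + `|x|) `^ (- (2 * b)).
have f0 x : 0 <= f x by exact: powR_ge0.
have mf : measurable_fun setT f by rewrite /f; mfun.
have If0 : (0 <= \int[leb R]_x (f x)%:E)%E by apply: integral_ge0 => x _; rewrite lee_fin.
have ffin : (\int[leb R]_x (f x)%:E)%E \is a fin_num.
  by rewrite ge0_fin_numE//; exact: integral_powR1Dnorm_fin.
set I := fine (\int[leb R]_x (f x)%:E)%E.
exists (2 `^ (2 * b) * (I + I)) => [|r].
  by rewrite mulr_ge0 ?powR_ge0// addr_ge0 ?fine_ge0.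
apply: (@le_trans _ _ (\int[leb R]_t ((2 `^ (2 * b))%:E * ((f (t + - r))%:E + (f (t + r))%:E)))%E).
  have mr (c : R) : measurable_fun setT (fun t : RM => (f (t + c))%:E).
    by apply/measurable_EFinP; apply: (measurableT_comp mf); mfun.
  apply: ge0_le_integral => //.
  - by move=> t _; rewrite lee_fin sqr_ge0.
  - by apply/measurable_EFinP; rewrite /jbr; mfun.
  - apply: emeasurable_funM; first exact: measurable_cst.
    by apply: emeasurable_funD; exact: mr.
  - move=> t _; rewrite -EFinD -EFinM lee_fin powR_sqr mulrN (le_trans (jbr_powRN _ p0))//.
    rewrite ler_wpM2l ?powR_ge0//.
    have [t0|t0] := leP 0 t; first by rewrite (ger0_norm t0) lerDl.
    by rewrite (ltr0_norm t0) /f -opprD normrN lerDr powR_ge0.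
have mr (c : R) : measurable_fun setT (fun t : RM => (f (t + c))%:E).
  by apply/measurable_EFinP; apply: (measurableT_comp mf); mfun.
rewrite ge0_integralZl//; first last.
- by move=> t _; rewrite adde_ge0// lee_fin.
- by apply: emeasurable_funD; exact: mr.
rewrite ge0_integralD//; do ?[exact: mr | by move=> t _; rewrite lee_fin].
have mEf : measurable_fun setT (fun x => (f x)%:E) by exact/measurable_EFinP.
have Ef0 (x : RM) : (0 <= (f x)%:E)%E by rewrite lee_fin.
rewrite (ge0_integral_addr (- r) mEf Ef0) (ge0_integral_addr r mEf Ef0).
by rewrite -(fineK ffin) -EFinD -EFinM.
Qed.

End weights.

(** * The frequency splitting *)

Section bilinear.
Variable R : realType.
Local Notation RM := (measurableTypeR R).
Local Notation T3 := (RM * (RM * RM))%type.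
Local Notation T4 := (RM * T3)%type.
Local Notation lam := (leb4 R).

Lemma norm3D (x y z x' y' z' : R) :
  norm3 (x + x') (y + y') (z + z') <= norm3 x y z + norm3 x' y' z'.
Proof.
have n0 := norm3_ge0 x y z; have n0' := norm3_ge0 x' y' z'.
rewrite -(@ler_pXn2r _ 2)// ?nnegrE ?addr_ge0 ?norm3_ge0// sqrrD !sqr_norm3.
have H : x * x' + y * y' + z * z' <= norm3 x y z * norm3 x' y' z'.
  rewrite (le_trans (ler_norm _))// -(@ler_pXn2r _ 2)// ?nnegrE ?mulr_ge0//.
  rewrite real_normK ?num_real// exprMn !sqr_norm3.
  have := sqr_ge0 (x * y' - y * x'); have := sqr_ge0 (y * z' - z * y'); have := sqr_ge0 (x * z' - z * x').
  move=> h1 h2 h3; rewrite -subr_ge0.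
  have -> : (x ^+ 2 + y ^+ 2 + z ^+ 2) * (x' ^+ 2 + y' ^+ 2 + z' ^+ 2) - (x * x' + y * y' + z * z') ^+ 2 =
    (x * y' - y * x') ^+ 2 + (y * z' - z * y') ^+ 2 + (x * z' - z * x') ^+ 2 by ring.
  by rewrite !addr_ge0.
rewrite -mulr_natr; lra.
Qed.

Lemma norm3N (x y z : R) : norm3 (- x) (- y) (- z) = norm3 x y z.
Proof. by rewrite /norm3 !sqrrN. Qed.

Lemma xi_norm_sub (xi eta : T3) :
  [/\ xi_norm xi <= xi_norm (sub3 xi eta) + xi_norm eta,
      xi_norm eta <= xi_norm (sub3 xi eta) + xi_norm xi &
      xi_norm (sub3 xi eta) <= xi_norm xi + xi_norm eta].
Proof.
rewrite /xi_norm /sub3 /=; split.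
- by have := norm3D (xi.1 - eta.1) (xi.2.1 - eta.2.1) (xi.2.2 - eta.2.2) eta.1 eta.2.1 eta.2.2; rewrite !subrK.
- have := norm3D (- (xi.1 - eta.1)) (- (xi.2.1 - eta.2.1)) (- (xi.2.2 - eta.2.2)) xi.1 xi.2.1 xi.2.2.
  by rewrite norm3N !opprB !subrK.
- by have := norm3D xi.1 xi.2.1 xi.2.2 (- eta.1) (- eta.2.1) (- eta.2.2); rewrite norm3N.
Qed.

Lemma powR_comparable (s x y : R) : 0 < x -> 0 < y -> x <= 2 * y -> y <= 2 * x ->
  x `^ (- s) <= 2 `^ `|s| * y `^ (- s).
Proof.
move=> x0 y0 xy yx; have [s0|s0] := leP 0 s.
  rewrite (ger0_norm s0); have -> : 2 `^ s * y `^ (- s) = (y / 2) `^ (- s).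
    rewrite powRM ?(ltW y0)// mulrC; congr (_ * _).
    by rewrite -(powR_inv1 (ler0n R 2)) -powRrM mulN1r opprK.
  by apply: ler_powRN; rewrite ?divr_gt0// ler_pdivrMr// mulrC.
rewrite (ltr0_norm s0) -powRM ?(ltW y0)//; apply: ge0_ler_powR; rewrite ?nnegrE ?oppr_ge0 ?(ltW s0) ?(ltW x0) ?mulr_ge0 ?(ltW y0)//.
Qed.

Lemma xi_jb_double (xi eta : T3) : xi_norm xi <= 2 * xi_norm eta -> xi_jb xi <= 2 * xi_jb eta.
Proof.
move=> h; have n0 := xi_norm_ge0 xi; have n0' := xi_norm_ge0 eta.
rewrite /xi_jb /jbr; have -> : 2 * Num.sqrt (1 + xi_norm eta ^+ 2) = Num.sqrt (4 * (1 + xi_norm eta ^+ 2)).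
  by rewrite sqrtrM// (_ : 4 = 2 ^+ 2) ?sqrtr_sqr ?ger0_norm//; ring.
apply: ler_wsqrtr.
have : xi_norm xi ^+ 2 <= (2 * xi_norm eta) ^+ 2 by rewrite ler_pXn2r ?nnegrE ?mulr_ge0.
by rewrite exprMn; lra.
Qed.

(* Of the three frequencies in xi = (xi - eta) + eta the two largest are comparable. *)
Lemma kernel_split (s0 s1 s2 : R) (xi eta : T3) :
  xi_jb xi `^ (- s0) * xi_jb (sub3 xi eta) `^ (- s1) * xi_jb eta `^ (- s2) <=
  (2 `^ `|s1| + 2 `^ `|s2|) * (lowfreq (s0 + s1) s2 xi eta +
    lowfreq (s0 + s2) s1 xi (sub3 xi eta) + lowfreq (s1 + s2) s0 eta xi).
Proof.
have [h1 h2 h3] := xi_norm_sub xi eta; set sg := sub3 xi eta in h1 h2 h3 *.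
have jx := xi_jb_gt0 xi; have je := xi_jb_gt0 eta; have js := xi_jb_gt0 sg.
have pD (x a b : R) : 0 < x -> x `^ (- (a + b)) = x `^ (- a) * x `^ (- b).
  by move=> x0; rewrite opprD powRD// (lt0r_neq0 x0) implybT.
have L (a s : R) x y : 0 <= lowfreq a s x y := lowfreq_ge0 a s x y.
have c1 : 0 <= 2 `^ `|s1| :> R := powR_ge0 _ _.
have c2 : 0 <= 2 `^ `|s2| :> R := powR_ge0 _ _.
have P (x a : R) : 0 <= x `^ a := powR_ge0 x a.
have cmp (x y : T3) s : xi_norm x <= 2 * xi_norm y -> xi_norm y <= 2 * xi_norm x ->
    xi_jb x `^ (- s) <= 2 `^ `|s| * xi_jb y `^ (- s).
  by move=> xy yx; apply: powR_comparable; rewrite ?xi_jb_gt0// xi_jb_double.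
have fin (c k S X : R) : 0 <= k -> 0 <= S -> c <= 2 `^ `|s1| + 2 `^ `|s2| -> k <= S -> X <= c * k ->
    X <= (2 `^ `|s1| + 2 `^ `|s2|) * S.
  move=> k0 S0 cC kS Xck; apply: (le_trans Xck); apply: (@le_trans _ _ ((2 `^ `|s1| + 2 `^ `|s2|) * k)).
    by rewrite ler_wpM2r.
  by rewrite ler_wpM2l// addr_ge0.
have big3 (x y z : R) : 0 <= x -> 0 <= y -> 0 <= z ->
    [/\ 0 <= x + y + z, x <= x + y + z, y <= x + y + z & z <= x + y + z].
  by move=> x0 y0 z0; split; lra.
have r1 (a b c d : R) : a * (b * c * d) = b * (a * c) * d by ring.
have r2 (a b c d : R) : a * (b * c * d) = b * d * (a * c) by ring.
have r3 (a b c d : R) : a * (b * c * d) = d * (a * b) * c by ring.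
have C1 : 2 `^ `|s1| <= 2 `^ `|s1| + 2 `^ `|s2| :> R by rewrite lerDl.
have C2 : 2 `^ `|s2| <= 2 `^ `|s1| + 2 `^ `|s2| :> R by rewrite lerDr.
have S := big3 _ _ _ (L (s0 + s1) s2 xi eta) (L (s0 + s2) s1 xi sg) (L (s1 + s2) s0 eta xi).
move: S.
(* If eta is lowest, <xi - eta> is exchanged for <xi>; if xi - eta is lowest, <eta> for <xi>; if xi
   is lowest, <xi - eta> for <eta>. The middle case occurs for either order of xi and eta. *)
have [ex|xe] := leP (xi_norm eta) (xi_norm xi).
  have [es|se] := leP (xi_norm eta) (xi_norm sg).
    have H : xi_jb sg `^ (- s1) <= 2 `^ `|s1| * xi_jb xi `^ (- s1) by apply: cmp; lra.
    move=> [S0 S1 S2 S3]; apply: (fin _ _ _ _ (L _ _ _ _) S0 C1 S1).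
    rewrite /lowfreq ex pD//.
    rewrite [leRHS]r1.
    by apply: ler_wpM2r; [exact: P|apply: ler_wpM2l H; exact: P].
  have sx : xi_norm sg <= xi_norm xi by lra.
  have H : xi_jb eta `^ (- s2) <= 2 `^ `|s2| * xi_jb xi `^ (- s2) by apply: cmp; lra.
  move=> [S0 S1 S2 S3]; apply: (fin _ _ _ _ (L _ _ _ _) S0 C2 S2).
  rewrite /lowfreq sx pD//.
  rewrite [leRHS]r2.
  by apply: ler_wpM2l H; exact: mulr_ge0.
have [xs|sx] := leP (xi_norm xi) (xi_norm sg).
  have H : xi_jb sg `^ (- s1) <= 2 `^ `|s1| * xi_jb eta `^ (- s1) by apply: cmp; lra.
  move=> [S0 S1 S2 S3]; apply: (fin _ _ _ _ (L _ _ _ _) S0 C1 S3).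
  rewrite /lowfreq (ltW xe) pD//.
  rewrite [leRHS]r3.
  by apply: ler_wpM2r; [exact: P|apply: ler_wpM2l H; exact: P].
have H : xi_jb eta `^ (- s2) <= 2 `^ `|s2| * xi_jb xi `^ (- s2) by apply: cmp; lra.
move=> [S0 S1 S2 S3]; apply: (fin _ _ _ _ (L _ _ _ _) S0 C2 S2).
rewrite /lowfreq (ltW sx) pD//.
rewrite [leRHS]r2.
by apply: ler_wpM2l H; exact: mulr_ge0.
Qed.

End bilinear.


(** * Square estimates for weighted convolutions *)

Section bilinear2.
Variable R : realType.
Local Notation RM := (measurableTypeR R).
Local Notation T3 := (RM * (RM * RM))%type.
Local Notation T4 := (RM * T3)%type.
Local Notation lam := (leb4 R).

Lemma ge0_integral_prodm2 d1 d2 (T1 : measurableType d1) (T2 : measurableType d2)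
  (m1 : {sigma_finite_measure set T1 -> \bar R}) (m2 : {sigma_finite_measure set T2 -> \bar R})
  (f : T1 * T2 -> \bar R) :
  measurable_fun setT f -> (forall z, 0 <= f z)%E ->
  (\int[prodm m1 m2]_z f z = \int[m2]_y \int[m1]_x f (x, y))%E.
Proof. by move=> mf f0; rewrite -[RHS](fubini_tonelli2 f). Qed.

Definition conv (K : T4 -> T4 -> R) (F G : T4 -> R) (z : T4) : \bar R :=
  (\int[lam]_w (K z w * (F (sub4 z w) * G w))%:E)%E.

Section square_estimates.
Variables (K : T4 -> T4 -> R) (F G : T4 -> R).
Hypotheses (mK : measurable_fun setT (fun z : T4 * T4 => K z.1 z.2))
  (mF : measurable_fun setT F) (mG : measurable_fun setT G)
  (K0 : forall z w, 0 <= K z w) (F0 : forall z, 0 <= F z) (G0 : forall z, 0 <= G z).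

Let mFs : measurable_fun setT (fun z : T4 * T4 => F (sub4 z.1 z.2)).
Proof. exact: (measurableT_comp mF (@measurable_sub4 R)). Qed.

Lemma conv_ge0 z : (0 <= conv K F G z)%E.
Proof. by apply: integral_ge0 => w _; rewrite lee_fin !mulr_ge0. Qed.

Lemma measurable_conv : measurable_fun setT (conv K F G).
Proof.
apply: (@measurable_fun_fubini_tonelli_F _ _ T4 T4 R lam (fun z => (K z.1 z.2 * (F (sub4 z.1 z.2) * G z.2))%:E)).
  by apply/measurable_EFinP; mfun.
by move=> z; rewrite lee_fin !mulr_ge0.
Qed.

Lemma integral_sub_tensor :
  (\int[lam]_z \int[lam]_w ((F (sub4 z w) * G w) ^+ 2)%:E =
   (\int[lam]_z (F z ^+ 2)%:E) * (\int[lam]_w (G w ^+ 2)%:E))%E.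
Proof.
pose H (z : T4 * T4) := ((F (sub4 z.1 z.2) * G z.2) ^+ 2)%:E.
have mH : measurable_fun setT H by apply/measurable_EFinP; mfun.
have H0 z : (0 <= H z)%E by rewrite lee_fin sqr_ge0.
rewrite (@fubini_tonelli _ _ T4 T4 R lam lam H mH H0).
have mF2 : measurable_fun setT (fun z => (F z ^+ 2)%:E) by apply/measurable_EFinP; mfun.
have mG2 : measurable_fun setT (fun z => (G z ^+ 2)%:E) by apply/measurable_EFinP; mfun.
have IF0 : (0 <= \int[lam]_z (F z ^+ 2)%:E)%E by apply: integral_ge0 => z _; rewrite lee_fin sqr_ge0.
transitivity (\int[lam]_w ((\int[lam]_z (F z ^+ 2)%:E) * (G w ^+ 2)%:E))%E.
  apply: eq_integral => w _.
  have [ms Hs] := preserving_sub4l w.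
  have Hw := Hs _ mF2 (fun z => _ : (0 <= (F z ^+ 2)%:E)%E).
  rewrite -Hw; last by move=> z; rewrite lee_fin sqr_ge0.
  transitivity (\int[lam]_z ((G w ^+ 2)%:E * (F (sub4 z w) ^+ 2)%:E))%E.
    by apply: eq_integral => z _; rewrite /H /= exprMn mulrC EFinM.
  rewrite (ge0_integralZl lam measurableT) 1?muleC//.
  - exact: (measurableT_comp mF2 ms).
  - by move=> z _; rewrite lee_fin sqr_ge0.
  - by rewrite lee_fin sqr_ge0.
rewrite (ge0_integralZl lam measurableT mG2); [by []| |exact: IF0].
by move=> z _; rewrite lee_fin sqr_ge0.
Qed.

(** Cauchy-Schwarz in w with [K] alone on one side; the other side integrates to the product of the
    two square norms by translation invariance. *)
Lemma conv_sqr_bound (D : R) : 0 <= D ->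
  (forall z, \int[lam]_w (K z w ^+ 2)%:E <= D%:E)%E ->
  (\int[lam]_z (conv K F G z ^+ 2) <=
   D%:E * ((\int[lam]_z (F z ^+ 2)%:E) * (\int[lam]_w (G w ^+ 2)%:E)))%E.
Proof.
move=> D0 HD; rewrite -integral_sub_tensor.
pose H (z : T4 * T4) := ((F (sub4 z.1 z.2) * G z.2) ^+ 2)%:E.
have mH : measurable_fun setT H by apply/measurable_EFinP; mfun.
have H0 z : (0 <= H z)%E by rewrite lee_fin sqr_ge0.
have mFH := @measurable_fun_fubini_tonelli_F _ _ T4 T4 R lam H mH H0.
rewrite -(ge0_integralZl lam measurableT mFH); last 2 first.
- by move=> z _; apply: integral_ge0.
- by rewrite lee_fin.
apply: (ge0_le_integral _ measurableT).
- by move=> z _; rewrite expe2; apply: mule_ge0; exact: conv_ge0.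
- by apply: emeasurable_funM; exact: measurable_conv.
- by apply: emeasurable_funM; [exact: measurable_cst|exact: mFH].
- move=> z _; apply: (le_trans (@cauchy_schwarz _ _ _ lam (K z) (fun w => F (sub4 z w) * G w) _ _ _ _)).
  + exact: (measurableT_comp mK (measurable_pair1 z)).
  + by apply: measurable_funM => //; exact: (measurableT_comp mFs (measurable_pair1 z)).
  + by [].
  + by move=> w; rewrite mulr_ge0.
  + by apply: lee_wpmul2r => //; apply: integral_ge0 => w _; rewrite lee_fin sqr_ge0.
Qed.

(** For a low output frequency, where the square integral of [K] in w may diverge. Cauchy-Schwarz
    puts [K1] with [F] and [K2] with [G]. The second factor [S] does not depend on the output time
    frequency, so integrating in that variable affects only [P], and [D2] is spent in the integral
    over xi. *)
Lemma conv_sqr_bound_split (K1 : T4 -> R) (K2 : T3 -> T4 -> R) (D1 D2 : R) :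
  0 <= D1 -> 0 <= D2 ->
  measurable_fun setT K1 -> measurable_fun setT (fun z : T3 * T4 => K2 z.1 z.2) ->
  (forall w, 0 <= K1 w) -> (forall x w, 0 <= K2 x w) ->
  (forall z w, K z w = K1 w * K2 z.2 w) ->
  (forall eta : T3, \int[leb R]_t (K1 (t, eta) ^+ 2)%:E <= D1%:E)%E ->
  (forall w, \int[leb3 R]_xi (K2 xi w ^+ 2)%:E <= D2%:E)%E ->
  (\int[lam]_z (conv K F G z ^+ 2) <=
   (D1 * D2)%:E * ((\int[lam]_z (F z ^+ 2)%:E) * (\int[lam]_w (G w ^+ 2)%:E)))%E.
Proof.
move=> D10 D20 mK1 mK2 K10 K20 KE HD1 HD2.
have mF2 : measurable_fun setT (fun z => (F z ^+ 2)%:E) by apply/measurable_EFinP; mfun.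
have mG2 : measurable_fun setT (fun z => (G z ^+ 2)%:E) by apply/measurable_EFinP; mfun.
have F20 z : (0 <= (F z ^+ 2)%:E)%E by rewrite lee_fin sqr_ge0.
have IF0 : (0 <= \int[lam]_z (F z ^+ 2)%:E)%E by apply: integral_ge0 => z _; exact: F20.
have IG0 : (0 <= \int[lam]_z (G z ^+ 2)%:E)%E by apply: integral_ge0 => z _; rewrite lee_fin sqr_ge0.
pose H1 (z : T4 * T4) := ((F (sub4 z.1 z.2) * K1 z.2) ^+ 2)%:E.
have mH1 : measurable_fun setT H1 by apply/measurable_EFinP; mfun.
have H10 z : (0 <= H1 z)%E by rewrite lee_fin sqr_ge0.
pose P (z : T4) := (\int[lam]_w H1 (z, w))%E.
have mP : measurable_fun setT P := @measurable_fun_fubini_tonelli_F _ _ T4 T4 R lam H1 mH1 H10.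
have P0 z : (0 <= P z)%E by exact: integral_ge0.
pose H2 (z : T3 * T4) := ((K2 z.1 z.2 * G z.2) ^+ 2)%:E.
have mH2 : measurable_fun setT H2 by apply/measurable_EFinP; mfun.
have H20 z : (0 <= H2 z)%E by rewrite lee_fin sqr_ge0.
pose S (x : T3) := (\int[lam]_w H2 (x, w))%E.
have mS : measurable_fun setT S := @measurable_fun_fubini_tonelli_F _ _ T3 T4 R lam H2 mH2 H20.
have S0 x : (0 <= S x)%E by exact: integral_ge0.
have step1 : (\int[lam]_z (conv K F G z ^+ 2) <= \int[lam]_z (P z * S z.2))%E.
  have mS2 : measurable_fun setT (fun z : T4 => S z.2) by exact: (measurableT_comp mS measurable_snd).
  apply: (ge0_le_integral _ measurableT).
  - by move=> z _; rewrite expe2; apply: mule_ge0; exact: conv_ge0.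
  - by apply: emeasurable_funM; exact: measurable_conv.
  - by apply: emeasurable_funM; [exact: mP|exact: mS2].
  - move=> z _.
    have -> : conv K F G z = (\int[lam]_w ((F (sub4 z w) * K1 w) * (K2 z.2 w * G w))%:E)%E.
      by apply: eq_integral => w _; rewrite KE; congr EFin; ring.
    apply: cauchy_schwarz.
    + by apply: measurable_funM => //; exact: (measurableT_comp mFs (measurable_pair1 z)).
    + by apply: measurable_funM => //; exact: (measurableT_comp mK2 (measurable_pair1 z.2)).
    + by move=> w; rewrite mulr_ge0.
    + by move=> w; rewrite mulr_ge0.
have stepS : (\int[leb3 R]_xi S xi <= D2%:E * \int[lam]_w (G w ^+ 2)%:E)%E.
  rewrite /S (@fubini_tonelli _ _ T3 T4 R (leb3 R) lam H2 mH2 H20).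
  rewrite -(ge0_integralZl lam measurableT mG2); last 2 first.
- by move=> w _; rewrite lee_fin sqr_ge0.
- by rewrite lee_fin.
  apply: (ge0_le_integral _ measurableT).
  - by move=> w _; apply: integral_ge0.
  - exact: (@measurable_fun_fubini_tonelli_G _ _ T3 T4 R (leb3 R) H2 mH2 H20).
  - by apply: emeasurable_funM; [exact: measurable_cst|exact: mG2].
  - move=> w _.
    have -> : (\int[leb3 R]_x H2 (x, w) = \int[leb3 R]_x ((G w ^+ 2)%:E * (K2 x w ^+ 2)%:E))%E.
      by apply: eq_integral => x _; rewrite /H2 /= exprMn mulrC EFinM.
    rewrite (ge0_integralZl (leb3 R) measurableT).
    + by rewrite muleC; apply: lee_wpmul2r; [rewrite lee_fin sqr_ge0|exact: HD2].
    + apply/measurable_EFinP; apply: measurable_funX.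
      exact: (measurableT_comp mK2 (measurable_pair2 w)).
    + by move=> x _; rewrite lee_fin sqr_ge0.
    + by rewrite lee_fin sqr_ge0.
pose f2 (x : T3) := (\int[leb R]_t (F (t, x) ^+ 2)%:E)%E.
have mf2 : measurable_fun setT f2 := @measurable_fun_fubini_tonelli_G _ _ RM T3 R (leb R) _ mF2 F20.
have f20 x : (0 <= f2 x)%E by exact: integral_ge0.
have f2E : (\int[leb3 R]_x f2 x = \int[lam]_z (F z ^+ 2)%:E)%E.
  by rewrite /lam (ge0_integral_prodm2 (leb R) (leb3 R) mF2 F20).
(* Integrating the output time frequency removes the shift by w.1 from F. What remains depends on
   w.2 only, and the integral of [K1] squared over the time component of w can be taken alone. *)
have stepP (xi : T3) : (\int[leb R]_t P (t, xi) <= D1%:E * \int[lam]_z (F z ^+ 2)%:E)%E.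
  pose H3 (z : RM * T4) := H1 ((z.1, xi), z.2).
  have mp : measurable_fun setT (fun z : RM * T4 => ((z.1, xi) : T4, z.2)).
    by apply: measurable_fun_pair; mfun.
  have mH3 : measurable_fun setT H3 by exact: (measurableT_comp mH1 mp).
  rewrite (_ : (\int[leb R]_t P (t, xi) = \int[leb R]_t \int[lam]_w H3 (t, w))%E)//.
  rewrite (@fubini_tonelli _ _ RM T4 R (leb R) lam H3 mH3 (fun z => H10 _)).
  have inner (w : T4) : (\int[leb R]_t H3 (t, w) = (K1 w ^+ 2)%:E * f2 (sub3 xi w.2))%E.
    have mFx : measurable_fun setT (fun t : RM => (F (t, sub3 xi w.2) ^+ 2)%:E).
      exact: (measurableT_comp mF2 (measurable_pair2 _)).
    have mFx' : measurable_fun setT (fun t : RM => (F (t - w.1, sub3 xi w.2) ^+ 2)%:E).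
      by apply: (measurableT_comp mFx (g := fun t : RM => t - w.1)); mfun.
    rewrite /f2 -(ge0_integral_addr (- w.1) mFx); last by move=> t; exact: F20.
    rewrite -(ge0_integralZl (leb R) measurableT mFx'); last 2 first.
    + by move=> t _; exact: F20.
    + by rewrite lee_fin sqr_ge0.
    by apply: eq_integral => t _; rewrite /H3 /H1 /= exprMn mulrC EFinM.
  under eq_integral do rewrite inner.
  have mK12 : measurable_fun setT (fun w : T4 => (K1 w ^+ 2)%:E) by apply/measurable_EFinP; mfun.
  have [ms3 Hs3] := preserving_sub3r xi.
  have mf2s : measurable_fun setT (fun eta : T3 => f2 (sub3 xi eta)) by exact: (measurableT_comp mf2 ms3).
  have mf2s' : measurable_fun setT (fun w : T4 => f2 (sub3 xi w.2)).
    exact: (measurableT_comp mf2s measurable_snd).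
  rewrite (ge0_integral_prodm2 (leb R) (leb3 R) (emeasurable_funM mK12 mf2s')); last first.
    by move=> w; apply: mule_ge0; [rewrite lee_fin sqr_ge0|exact: f20].
  rewrite -f2E -(Hs3 f2 mf2 f20) -(ge0_integralZl (leb3 R) measurableT mf2s); last 2 first.
  - by move=> eta _; exact: f20.
  - by rewrite lee_fin.
  have mK1e (eta : T3) : measurable_fun setT (fun t : RM => (K1 (t, eta) ^+ 2)%:E).
    exact: (measurableT_comp mK12 (measurable_pair2 eta)).
  apply: (ge0_le_integral _ measurableT).
  - move=> eta _; apply: integral_ge0 => t _; apply: mule_ge0; first by rewrite lee_fin sqr_ge0.
    exact: f20.
  - apply: (@measurable_fun_fubini_tonelli_G _ _ RM T3 R (leb R) (fun w => ((K1 w ^+ 2)%:E * f2 (sub3 xi w.2))%E)).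
      exact: emeasurable_funM.
    by move=> w; apply: mule_ge0; [rewrite lee_fin sqr_ge0|exact: f20].
  - by apply: emeasurable_funM; [exact: measurable_cst|exact: mf2s].
  - move=> eta _ /=.
    rewrite (ge0_integralZr (leb R) measurableT (mK1e eta)).
    + by apply: lee_wpmul2r; [exact: f20|exact: HD1].
    + by move=> t _; rewrite lee_fin sqr_ge0.
    + exact: f20.
apply: (le_trans step1).
have mPS : measurable_fun setT (fun z : T4 => (P z * S z.2)%E).
  by apply: emeasurable_funM; [exact: mP|exact: (measurableT_comp mS measurable_snd)].
rewrite (ge0_integral_prodm2 (leb R) (leb3 R) mPS); last by move=> z; exact: mule_ge0.
apply: (@le_trans _ _ (\int[leb3 R]_xi ((D1%:E * \int[lam]_z (F z ^+ 2)%:E) * S xi))%E).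
  apply: (ge0_le_integral _ measurableT).
  - by move=> xi _; apply: integral_ge0 => t _; exact: mule_ge0.
  - apply: (@measurable_fun_fubini_tonelli_G _ _ RM T3 R (leb R) _ mPS).
    by move=> z; exact: mule_ge0.
  - by apply: emeasurable_funM; [exact: measurable_cst|exact: mS].
  - move=> xi _ /=.
    rewrite (ge0_integralZr (leb R) measurableT).
    + by apply: lee_wpmul2r; [exact: S0|exact: stepP].
    + exact: (measurableT_comp mP (measurable_pair2 xi)).
    + by move=> t _; exact: P0.
    + exact: S0.
rewrite (ge0_integralZl (leb3 R) measurableT mS); last 2 first.
- by move=> xi _; exact: S0.
- by apply: mule_ge0; [rewrite lee_fin|exact: IF0].
rewrite EFinM -!muleA; apply: lee_wpmul2l; first by rewrite lee_fin.
by rewrite muleCA; apply: lee_wpmul2l; [exact: IF0|exact: stepS].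
Qed.

End square_estimates.

End bilinear2.

(** * The weighted bilinear estimate *)

Section weighted.
Variable R : realType.
Local Notation RM := (measurableTypeR R).
Local Notation T3 := (RM * (RM * RM))%type.
Local Notation T4 := (RM * T3)%type.
Local Notation lam := (leb4 R).

Lemma sqr_add3_le (x y z : \bar R) : (0 <= x)%E -> (0 <= y)%E -> (0 <= z)%E ->
  ((x + y + z) ^+ 2 <= 3%:E * (x ^+ 2 + y ^+ 2 + z ^+ 2))%E.
Proof.
have oo (t u : \bar R) : t = +oo%E -> (u <= 3%:E * t)%E.
  by move=> ->; rewrite gt0_muley ?lte_fin// leey.
move: x y z => [x| |//] [y| |//] [z| |//] x0 y0 z0; last 7 first.
all: try by apply: oo; rewrite !expe2 ?mulyy -?EFinM.
change (((x + y + z) ^+ 2)%:E <= (3 * (x ^+ 2 + y ^+ 2 + z ^+ 2))%:E)%E; rewrite lee_fin.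
have := sqr_ge0 (x - y); have := sqr_ge0 (y - z); have := sqr_ge0 (x - z); nra.
Qed.

Definition modul (w : T4) : R := jbr (`|w.1| - xi_norm w.2).

Lemma modul_gt0 w : 0 < modul w. Proof. exact: jbr_gt0. Qed.

Lemma measurable_modul : measurable_fun setT modul.
Proof. by have := @measurable_xi_norm R => ?; rewrite /modul /jbr; mfun. Qed.

(** The time frequency is integrated first, at fixed eta, where the bound on the modulation weight
    is uniform. *)
Lemma modulated_integral (L : T3 -> R) (b D Db : R) : 0 <= Db ->
  measurable_fun setT L -> (forall eta, 0 <= L eta) ->
  (\int[leb3 R]_eta (L eta ^+ 2)%:E <= D%:E)%E ->
  (forall eta, \int[leb R]_t (modul (t, eta) `^ (- b) ^+ 2)%:E <= Db%:E)%E ->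
  (\int[lam]_w ((L w.2 * modul w `^ (- b)) ^+ 2)%:E <= (Db * D)%:E)%E.
Proof.
move=> Db0 mL L0 HD HDb; have mm := measurable_modul.
have mH : measurable_fun setT (fun w : T4 => ((L w.2 * modul w `^ (- b)) ^+ 2)%:E).
  by apply/measurable_EFinP; mfun.
have H0 (w : T4) : (0 <= ((L w.2 * modul w `^ (- b)) ^+ 2)%:E)%E by rewrite lee_fin sqr_ge0.
rewrite (ge0_integral_prodm2 (leb R) (leb3 R) mH H0).
have mL2 : measurable_fun setT (fun eta => (L eta ^+ 2)%:E) by apply/measurable_EFinP; mfun.
apply: (@le_trans _ _ (\int[leb3 R]_eta (Db%:E * (L eta ^+ 2)%:E))%E).
  apply: (ge0_le_integral _ measurableT).
  - by move=> eta _; apply: integral_ge0.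
  - exact: (@measurable_fun_fubini_tonelli_G _ _ RM T3 R (leb R) _ mH H0).
  - by apply: emeasurable_funM; [exact: measurable_cst|exact: mL2].
  - move=> eta _ /=.
    have -> : (\int[leb R]_t ((L eta * modul (t, eta) `^ (- b)) ^+ 2)%:E =
        \int[leb R]_t ((L eta ^+ 2)%:E * (modul (t, eta) `^ (- b) ^+ 2)%:E))%E.
      by apply: eq_integral => t _; rewrite exprMn EFinM.
    rewrite (ge0_integralZl (leb R) measurableT).
    + by rewrite muleC; apply: lee_wpmul2r; [rewrite lee_fin sqr_ge0|exact: HDb].
    + have mme : measurable_fun setT (fun t : RM => modul (t, eta)) by exact: (measurableT_comp mm (measurable_pair2 eta)).
      by apply/measurable_EFinP; mfun.
    + by move=> t _; rewrite lee_fin sqr_ge0.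
    + by rewrite lee_fin sqr_ge0.
rewrite (ge0_integralZl (leb3 R) measurableT mL2).
- by rewrite EFinM; apply: lee_wpmul2l; [rewrite lee_fin|exact: HD].
- by move=> eta _; rewrite lee_fin sqr_ge0.
- by rewrite lee_fin.
Qed.

(** The theorem for moduli of transforms: W is only assumed to lie below the convolution of U and V,
    which is what the convolution inequality supplies. *)
Lemma weighted_bilinear (s0 s1 s2 b : R) : 1 / 2 < b ->
  3 / 2 <= s0 + s1 + s2 -> Num.max s0 (Num.max s1 s2) <= s0 + s1 + s2 ->
  ~ (s0 + s1 + s2 = 3 / 2 /\ s0 + s1 + s2 = Num.max s0 (Num.max s1 s2)) ->
  exists2 C, 0 <= C & forall U V W : T4 -> R,
    measurable_fun setT U -> measurable_fun setT V -> measurable_fun setT W ->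
    (forall z, 0 <= U z) -> (forall z, 0 <= V z) -> (forall z, 0 <= W z) ->
    (forall z, (W z)%:E <= \int[lam]_w (U (sub4 z w) * V w)%:E)%E ->
    (\int[lam]_z ((xi_jb z.2 `^ (- s0) * W z) ^+ 2)%:E <=
     C%:E * ((\int[lam]_z ((xi_jb z.2 `^ s1 * U z) ^+ 2)%:E) *
             (\int[lam]_w ((xi_jb w.2 `^ s2 * modul w `^ b * V w) ^+ 2)%:E)))%E.
Proof.
move=> b12 S32; rewrite !ge_max => /andP[M0 /andP[M1 M2]] nS.
(* The exceptional pair (0, 3/2) for the piece with low exponent s forces s = s0 + s1 + s2 = 3/2;
   then s is also the maximum, and both hypotheses are equalities. *)
have nmax (s : R) : s = s0 + s1 + s2 -> (s = s0 \/ s = s1 \/ s = s2) -> s <> 3 / 2.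
  move=> sS sx s32; apply: nS; rewrite -sS; split=> //; apply/eqP; rewrite eq_le !ge_max.
  have Hmax : Num.max s0 (Num.max s1 s2) <= s by rewrite !ge_max sS M0 M1 M2.
  move: Hmax; rewrite !ge_max => ->; rewrite andbT !le_max.
  by case: sx => [<-|[<-|<-]]; rewrite lexx ?orbT.
have [D1 D10 HD1] : exists2 C, 0 <= C & forall xi,
    (\int[leb3 R]_eta (lowfreq (s0 + s1) s2 xi eta ^+ 2)%:E <= C%:E)%E.
  apply: lowfreq_integral; [lra|lra|move=> [h1 h2]].
  by apply: (nmax s2) => //; [lra|right; right].
have [D2 D20 HD2] : exists2 C, 0 <= C & forall xi,
    (\int[leb3 R]_eta (lowfreq (s0 + s2) s1 xi eta ^+ 2)%:E <= C%:E)%E.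
  apply: lowfreq_integral; [lra|lra|move=> [h1 h2]].
  by apply: (nmax s1) => //; [lra|right; left].
have [D3 D30 HD3] : exists2 C, 0 <= C & forall xi,
    (\int[leb3 R]_eta (lowfreq (s1 + s2) s0 xi eta ^+ 2)%:E <= C%:E)%E.
  apply: lowfreq_integral; [lra|lra|move=> [h1 h2]].
  by apply: (nmax s0) => //; [lra|left].
have [Db Db0 HDb] := modulation_integral b12.
have HDm (eta : T3) : (\int[leb R]_t (modul (t, eta) `^ (- b) ^+ 2)%:E <= Db%:E)%E.
  exact: (HDb (xi_norm eta)).
clear nmax nS HDb.
pose c : R := 2 `^ `|s1| + 2 `^ `|s2|.
have c0 : 0 <= c by rewrite addr_ge0 ?powR_ge0.
(* [c] comes from the frequency splitting, 3 from squaring a sum of three terms, and each piece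
   costs its own constant times that of the modulation weight. *)
exists (c ^+ 2 * 3 * (Db * D1 + Db * D2 + Db * D3)) => [|U V W mU mV mW U0 V0 W0 HW].
  by rewrite mulr_ge0 ?mulr_ge0 ?sqr_ge0// !addr_ge0// mulr_ge0.
have mj := @measurable_xi_jb R; have mm := measurable_modul.
pose F z := xi_jb z.2 `^ s1 * U z; pose G w := xi_jb w.2 `^ s2 * modul w `^ b * V w.
have F0 z : 0 <= F z by rewrite mulr_ge0 ?powR_ge0.
have G0 z : 0 <= G z by rewrite mulr_ge0 ?mulr_ge0 ?powR_ge0.
have mF : measurable_fun setT F by rewrite /F; mfun.
have mG : measurable_fun setT G by rewrite /G; mfun.
pose K1 (z w : T4) := lowfreq (s0 + s1) s2 z.2 w.2 * modul w `^ (- b).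
pose K2 (z w : T4) := lowfreq (s0 + s2) s1 z.2 (sub3 z.2 w.2) * modul w `^ (- b).
pose K3 (z w : T4) := modul w `^ (- b) * lowfreq (s1 + s2) s0 w.2 z.2.
have K10 z w : 0 <= K1 z w by rewrite mulr_ge0 ?powR_ge0 ?lowfreq_ge0.
have K20 z w : 0 <= K2 z w by rewrite mulr_ge0 ?powR_ge0 ?lowfreq_ge0.
have K30 z w : 0 <= K3 z w by rewrite mulr_ge0 ?powR_ge0 ?lowfreq_ge0.
have m12 : measurable_fun setT (fun z : T4 * T4 => z.1.2) by mfun.
have m22 : measurable_fun setT (fun z : T4 * T4 => z.2.2) by mfun.
have mpair : measurable_fun setT (fun z : T4 * T4 => (z.1.2, z.2.2)) by mfun.
have ms3 : measurable_fun setT (fun z : T4 * T4 => sub3 z.1.2 z.2.2).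
  exact: (measurableT_comp (@measurable_sub3 R) mpair).
have mm2 : measurable_fun setT (fun z : T4 * T4 => modul z.2 `^ (- b)) by mfun.
have mK1 : measurable_fun setT (fun z : T4 * T4 => K1 z.1 z.2).
  by apply: measurable_funM => //; exact: measurable_lowfreq.
have mK2 : measurable_fun setT (fun z : T4 * T4 => K2 z.1 z.2).
  by apply: measurable_funM => //; exact: measurable_lowfreq.
have mK3 : measurable_fun setT (fun z : T4 * T4 => K3 z.1 z.2).
  by apply: measurable_funM => //; exact: measurable_lowfreq.
pose X := ((\int[lam]_z (F z ^+ 2)%:E) * (\int[lam]_w (G w ^+ 2)%:E))%E.
rewrite -[Y in (_ <= _%:E * Y)%E]/X.
have X0 : (0 <= X)%E.
  by apply: mule_ge0; apply: integral_ge0 => z _; rewrite lee_fin sqr_ge0.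
have E1 : (\int[lam]_z (conv K1 F G z ^+ 2) <= (Db * D1)%:E * X)%E.
  apply: conv_sqr_bound => //; first exact: mulr_ge0.
  move=> z; apply: (modulated_integral (L := lowfreq (s0 + s1) s2 z.2)) => //.
  - by apply: measurable_lowfreq; [exact: measurable_cst|exact: measurable_id].
  - by move=> eta; exact: lowfreq_ge0.
have E2 : (\int[lam]_z (conv K2 F G z ^+ 2) <= (Db * D2)%:E * X)%E.
  apply: conv_sqr_bound => //; first exact: mulr_ge0.
  move=> z; have [mss Hss] := preserving_sub3r z.2.
  apply: (modulated_integral (L := fun eta => lowfreq (s0 + s2) s1 z.2 (sub3 z.2 eta))) => //.
  - by apply: measurable_lowfreq; [exact: measurable_cst|exact: mss].
  - by move=> eta; exact: lowfreq_ge0.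
  - rewrite (Hss (fun eta => (lowfreq (s0 + s2) s1 z.2 eta ^+ 2)%:E)); first exact: HD2.
      apply/measurable_EFinP; apply: measurable_funX.
      by apply: measurable_lowfreq; [exact: measurable_cst|exact: measurable_id].
    by move=> eta; rewrite lee_fin sqr_ge0.
(* Here the low frequency is the output xi, and [D3] bounds an integral in xi at fixed eta; this is
   what the split form takes. *)
have E3 : (\int[lam]_z (conv K3 F G z ^+ 2) <= (Db * D3)%:E * X)%E.
  have n1 : measurable_fun setT (fun w : T4 => modul w `^ (- b)) by mfun.
  have n2 : measurable_fun setT (fun z : T3 * T4 => lowfreq (s1 + s2) s0 z.2.2 z.1).
    by apply: measurable_lowfreq; mfun.
  have p1 (w : T4) : 0 <= modul w `^ (- b) by exact: powR_ge0.
  have p2 (x : T3) (w : T4) : 0 <= lowfreq (s1 + s2) s0 w.2 x by exact: lowfreq_ge0.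
  have HD3' (w : T4) : (\int[leb3 R]_xi (lowfreq (s1 + s2) s0 w.2 xi ^+ 2)%:E <= D3%:E)%E by exact: (HD3 w.2).
  exact: (@conv_sqr_bound_split R K3 F G mK3 mF mG K30 F0 G0 _ (fun x w => lowfreq (s1 + s2) s0 w.2 x)
    Db D3 Db0 D30 n1 n2 p1 p2 (fun _ _ => erefl) HDm HD3').
have I10 z : (0 <= conv K1 F G z)%E by exact: conv_ge0.
have I20 z : (0 <= conv K2 F G z)%E by exact: conv_ge0.
have I30 z : (0 <= conv K3 F G z)%E by exact: conv_ge0.
have mI1 := measurable_conv mK1 mF mG K10 F0 G0.
have mI2 := measurable_conv mK2 mF mG K20 F0 G0.
have mI3 := measurable_conv mK3 mF mG K30 F0 G0.
have pw z : ((xi_jb z.2 `^ (- s0) * W z)%:E <= c%:E * (conv K1 F G z + conv K2 F G z + conv K3 F G z))%E.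
  have mi (K : T4 -> T4 -> R) : measurable_fun setT (fun z : T4 * T4 => K z.1 z.2) ->
      measurable_fun setT (fun w => (K z w * (F (sub4 z w) * G w))%:E).
    move=> mK; apply/measurable_EFinP; apply: measurable_funM; first exact: (measurableT_comp mK (measurable_pair1 z)).
    apply: measurable_funM => //; have [mss _] := preserving_sub4r z.
    exact: (measurableT_comp mF mss).
  have i0 (K : T4 -> T4 -> R) : (forall z w, 0 <= K z w) -> forall w, (0 <= (K z w * (F (sub4 z w) * G w))%:E)%E.
    move=> K0 w; rewrite lee_fin; apply: mulr_ge0; first exact: K0.
    by apply: mulr_ge0; [exact: F0|exact: G0].
  rewrite /conv -(ge0_integralD lam measurableT (fun w _ => i0 _ K10 w) (mi _ mK1) (fun w _ => i0 _ K20 w) (mi _ mK2)).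
  have i12 w : [set: T4] w -> (0 <= (K1 z w * (F (sub4 z w) * G w))%:E + (K2 z w * (F (sub4 z w) * G w))%:E)%E.
    by move=> _; apply: adde_ge0; apply: i0.
  have mi12 := emeasurable_funD (mi _ mK1) (mi _ mK2).
  rewrite -(ge0_integralD lam measurableT i12 mi12 (fun w _ => i0 _ K30 w) (mi _ mK3)).
  have mi123 := emeasurable_funD mi12 (mi _ mK3).
  rewrite -(ge0_integralZl lam measurableT mi123); last 2 first.
  - by move=> w _; apply: adde_ge0; [exact: i12|exact: i0].
  - by rewrite lee_fin.
  have mUV : measurable_fun setT (fun w => (U (sub4 z w) * V w)%:E).
    apply/measurable_EFinP; apply: measurable_funM => //; have [mss _] := preserving_sub4r z.
    exact: (measurableT_comp mU mss).
  apply: (@le_trans _ _ ((xi_jb z.2 `^ (- s0))%:E * \int[lam]_w (U (sub4 z w) * V w)%:E)%E).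
    by rewrite EFinM; apply: lee_wpmul2l; [rewrite lee_fin powR_ge0|exact: HW].
  rewrite -(ge0_integralZl lam measurableT mUV); last 2 first.
  - by move=> w _; rewrite lee_fin mulr_ge0.
  - by rewrite lee_fin powR_ge0.
  apply: (ge0_le_integral _ measurableT).
  - by move=> w _; rewrite -EFinM lee_fin mulr_ge0 ?powR_ge0 ?mulr_ge0.
  - by apply: emeasurable_funM; [exact: measurable_cst|exact: mUV].
  - by apply: emeasurable_funM; [exact: measurable_cst|exact: mi123].
  - move=> w _; rewrite -!EFinD -!EFinM lee_fin.
    (* The weights absorbed in [F] and [G] are taken out again; together with the one in front of
       [W] they form the kernel that is split. *)
    have pK (x s : R) : 0 < x -> x `^ (- s) * x `^ s = 1.
      by move=> x0; rewrite powRN mulVf// lt0r_neq0// powR_gt0.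
    have UE : U (sub4 z w) = xi_jb (sub3 z.2 w.2) `^ (- s1) * F (sub4 z w).
      by rewrite /F mulrA pK ?mul1r// xi_jb_gt0.
    have VE : V w = xi_jb w.2 `^ (- s2) * modul w `^ (- b) * G w.
      rewrite /G.
      have r (x y x' y' v : R) : x * y * (x' * y' * v) = (x * x') * (y * y') * v by ring.
      by rewrite r !pK ?mul1r ?xi_jb_gt0// modul_gt0.
    have r1 (x y f y' m g : R) : x * (y * f * (y' * m * g)) = x * y * y' * (m * (f * g)) by ring.
    have r2 (x k1 k2 k3 m f : R) : x * (k1 * m * f + k2 * m * f + m * k3 * f) = x * (k1 + k2 + k3) * (m * f) by ring.
    rewrite {1}UE {1}VE r1 /K1 /K2 /K3 r2.
    apply: ler_wpM2r; last exact: kernel_split.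
    by apply: mulr_ge0; [exact: powR_ge0|apply: mulr_ge0; [exact: F0|exact: G0]].
pose I z := (conv K1 F G z ^+ 2 + conv K2 F G z ^+ 2 + conv K3 F G z ^+ 2)%E.
have sq0 (x : \bar R) : (0 <= x -> 0 <= x ^+ 2)%E by move=> x0; rewrite expe2 mule_ge0.
have msq (f : T4 -> \bar R) : measurable_fun setT f -> measurable_fun setT (fun z => (f z ^+ 2)%E).
  by move=> mf; exact: emeasurable_funM.
have I0 z : (0 <= I z)%E.
  by apply: adde_ge0; [apply: adde_ge0; [exact: sq0 (I10 z)|exact: sq0 (I20 z)]|exact: sq0 (I30 z)].
have mI : measurable_fun setT I.
  by apply: emeasurable_funD; [apply: emeasurable_funD|]; exact: msq.
apply: (@le_trans _ _ (\int[lam]_z ((c ^+ 2 * 3)%:E * I z))%E).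
  apply: (ge0_le_integral _ measurableT).
  - by move=> z _; rewrite lee_fin sqr_ge0.
  - by apply/measurable_EFinP; mfun.
  - by apply: emeasurable_funM; [exact: measurable_cst|exact: mI].
  - move=> z _; rewrite (_ : ((xi_jb z.2 `^ (- s0) * W z) ^+ 2)%:E = ((xi_jb z.2 `^ (- s0) * W z)%:E ^+ 2)%E)//.
    have wz : (0 <= (xi_jb z.2 `^ (- s0) * W z)%:E)%E by rewrite lee_fin mulr_ge0 ?powR_ge0.
    apply: (@le_trans _ _ ((c%:E * (conv K1 F G z + conv K2 F G z + conv K3 F G z)) ^+ 2)%E).
      by rewrite !expe2; apply: lee_pmul => //; exact: pw.
    rewrite expe2 muleACA (EFinM (c ^+ 2)) -[leRHS]muleA (_ : (c ^+ 2)%:E = (c%:E * c%:E)%E); last by rewrite -EFinM -expr2.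
    apply: lee_wpmul2l; first by rewrite -EFinM lee_fin mulr_ge0.
    exact: sqr_add3_le (I10 z) (I20 z) (I30 z).
rewrite (ge0_integralZl lam measurableT mI); last 2 first.
- by move=> z _; exact: I0.
- by rewrite lee_fin mulr_ge0 ?sqr_ge0.
rewrite (EFinM (c ^+ 2 * 3)) -muleA; apply: lee_wpmul2l; first by rewrite lee_fin mulr_ge0 ?sqr_ge0.
have sI1 z : [set: T4] z -> (0 <= conv K1 F G z ^+ 2)%E by move=> _; exact: sq0 (I10 z).
have sI2 z : [set: T4] z -> (0 <= conv K2 F G z ^+ 2)%E by move=> _; exact: sq0 (I20 z).
have sI3 z : [set: T4] z -> (0 <= conv K3 F G z ^+ 2)%E by move=> _; exact: sq0 (I30 z).
have sI12 z : [set: T4] z -> (0 <= conv K1 F G z ^+ 2 + conv K2 F G z ^+ 2)%E.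
  by move=> tz; apply: adde_ge0; [exact: sI1|exact: sI2].
rewrite /I (ge0_integralD lam measurableT sI12 (emeasurable_funD (msq _ mI1) (msq _ mI2)) sI3 (msq _ mI3)).
rewrite (ge0_integralD lam measurableT sI1 (msq _ mI1) sI2 (msq _ mI2)).
have DX1 : (0 <= (Db * D1)%:E)%E by rewrite lee_fin mulr_ge0.
have DX2 : (0 <= (Db * D2)%:E)%E by rewrite lee_fin mulr_ge0.
have DX3 : (0 <= (Db * D3)%:E)%E by rewrite lee_fin mulr_ge0.
rewrite !EFinD ge0_muleDl; [|exact: adde_ge0|exact: DX3].
rewrite ge0_muleDl; [|exact: DX1|exact: DX2].
by apply: leeD; [apply: leeD; [exact: E1|exact: E2]|exact: E3].
Qed.

End weighted.

(** * Wave-Sobolev norms *)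

Section wave_sobolev.
Variable R : realType.
Local Notation RM := (measurableTypeR R).
Local Notation T4 := (RM * (RM * (RM * RM)))%type.
Local Notation lam := (leb4 R).

Lemma schwartz_dominated (f : 'rV[R]_4 -> R) : rschwartz f -> dominated (f \o @pt4 R).
Proof.
move=> sf; split; first exact: measurable_schwartz.
by have [M [M0 HM]] := schwartz_decay sf; exists M.
Qed.

Lemma schwartz_lipschitz4 (f : 'rV[R]_4 -> R) : rschwartz f -> lipschitz4 (f \o @pt4 R).
Proof. by move=> sf; have [L [L0 HL]] := schwartz_lipschitz sf; exists L. Qed.

(** At each stage the coordinates already fixed turn into a constant factor of the majorant, so the
    remaining section is again dominated by a product. *)
Lemma int4E (f : T4 -> R) : dominated f ->
  int4 (fun t a b c => f (t, (a, (b, c)))) = \int[lam]_z f z.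
Proof.
move=> [mf [M M0 HM]].
have ip := integrable_poisson (ltr01 : 0 < 1 :> R).
have p0 (x : R) : 0 <= poisson 1 x by exact: poisson_ge0.
have p2 (z : RM * RM) : 0 <= poisson 1 z.1 * poisson 1 z.2 by exact: mulr_ge0.
have p3 (z : RM * (RM * RM)) : 0 <= poisson 1 z.1 * (poisson 1 z.2.1 * poisson 1 z.2.2).
  by apply: mulr_ge0; [exact: p0|exact: mulr_ge0].
have i2 : (prodm (leb R) (leb R)).-integrable setT (EFin \o (fun z : RM * RM => poisson 1 z.1 * poisson 1 z.2)).
  exact: (@tensor_integrable R _ _ RM RM (leb R) (leb R) (poisson 1) (poisson 1) p0 p0 ip ip).
have i3 : (leb3 R).-integrable setT (EFin \o (fun z : RM * (RM * RM) => poisson 1 z.1 * (poisson 1 z.2.1 * poisson 1 z.2.2))).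
  exact: (@tensor_integrable R _ _ RM _ (leb R) (prodm (leb R) (leb R)) (poisson 1) (fun z => poisson 1 z.1 * poisson 1 z.2) p0 p2 ip i2).
have iZ (c : R) : (leb R).-integrable setT (EFin \o (fun t : RM => c * poisson 1 t)).
  rewrite (_ : EFin \o _ = (fun z => c%:E * (EFin \o poisson 1) z)%E); first exact: integrableZl.
  by apply/funext => z; rewrite /= EFinM.
have r3 (m x a q : R) : m * x * a * q = m * (x * (a * q)) by ring.
have r4 (m x a b q : R) : m * x * a * b * q = m * (x * (a * (b * q))) by ring.
have c0 (c : R) : 0 <= c -> forall t : RM, 0 <= c * poisson 1 t by move=> ? t; exact: mulr_ge0.
rewrite (@Rintegral_prodm _ _ _ _ _ (leb R) (leb3 R) f (fun t => M * poisson 1 t) _ mf (iZ M) i3 (c0 _ M0) p3); last first.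
  by move=> t y; rewrite -mulrA; exact: HM.
apply: eq_Rintegral => t _.
have mft : measurable_fun setT (fun y => f (t, y)) by exact: (measurableT_comp mf (measurable_pair1 t)).
have Mt0 : 0 <= M * poisson 1 t by exact: c0.
rewrite (@Rintegral_prodm _ _ _ _ _ (leb R) (prodm (leb R) (leb R)) (fun y => f (t, y))
  (fun a => M * poisson 1 t * poisson 1 a) _ mft (iZ _) i2 (c0 _ Mt0) p2); last first.
  by move=> a y; rewrite r3; exact: HM.
apply: eq_Rintegral => a _.
have mfa : measurable_fun setT (fun y => f (t, (a, y))) by exact: (measurableT_comp mft (measurable_pair1 a)).
have Ma0 : 0 <= M * poisson 1 t * poisson 1 a by exact: c0.
rewrite (@Rintegral_prodm _ _ _ _ _ (leb R) (leb R) (fun y => f (t, (a, y)))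
  (fun b => M * poisson 1 t * poisson 1 a * poisson 1 b) _ mfa (iZ _) ip (c0 _ Ma0) p0)//.
by move=> b c; rewrite r4; exact: HM.
Qed.

Lemma eint4E (f : T4 -> \bar R) : measurable_fun setT f -> (forall z, 0 <= f z)%E ->
  eint4 (fun t a b c => f (t, (a, (b, c)))) = (\int[lam]_z f z)%E.
Proof.
move=> mf f0; rewrite (ge0_integral_prodm (leb R) (leb3 R) mf f0).
apply: eq_integral => t _.
have mft : measurable_fun setT (fun y => f (t, y)) by exact: (measurableT_comp mf (measurable_pair1 t)).
rewrite (ge0_integral_prodm (leb R) (prodm (leb R) (leb R)) mft (fun y => f0 _)).
apply: eq_integral => a _.
have mfa : measurable_fun setT (fun y => f (t, (a, y))) by exact: (measurableT_comp mft (measurable_pair1 a)).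
by rewrite (ge0_integral_prodm (leb R) (leb R) mfa (fun y => f0 _)).
Qed.

Definition ampl (u : cfun R) : T4 -> R := fnorm (u.1 \o @pt4 R) (u.2 \o @pt4 R).

Lemma ft_reE (u : cfun R) (t a b c : R) :
  dominated (u.1 \o @pt4 R) -> dominated (u.2 \o @pt4 R) ->
  ft_re u t a b c = fre (u.1 \o @pt4 R) (u.2 \o @pt4 R) (t, (a, (b, c))).
Proof.
move=> d1 d2; rewrite /fre -(int4E (dominated_re _ d1 d2)).
have E t' a' b' c' : phase t a b c t' a' b' c' = dot (t', (a', (b', c'))) (t, (a, (b, c))).
  by rewrite /phase /dot /= !addrA.
rewrite /ft_re; congr int4; apply/funext => t'; apply/funext => a'; apply/funext => b'; apply/funext => c'.
by rewrite /= E.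
Qed.

Lemma ft_imE (u : cfun R) (t a b c : R) :
  dominated (u.1 \o @pt4 R) -> dominated (u.2 \o @pt4 R) ->
  ft_im u t a b c = fim (u.1 \o @pt4 R) (u.2 \o @pt4 R) (t, (a, (b, c))).
Proof.
move=> d1 d2; rewrite /fim -(int4E (dominated_im _ d1 d2)).
have E t' a' b' c' : phase t a b c t' a' b' c' = dot (t', (a', (b', c'))) (t, (a, (b, c))).
  by rewrite /phase /dot /= !addrA.
rewrite /ft_im; congr int4; apply/funext => t'; apply/funext => a'; apply/funext => b'; apply/funext => c'.
by rewrite /= E.
Qed.

Lemma Hsb_normE (s b : R) (u : cfun R) :
  dominated (u.1 \o @pt4 R) -> dominated (u.2 \o @pt4 R) ->
  Hsb_norm s b u =
  sqrte (\int[lam]_z ((xi_jb z.2 `^ s * modul z `^ b * ampl u z) ^+ 2)%:E)%E.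
Proof.
move=> d1 d2; congr sqrte.
have mj := @measurable_xi_jb R; have mm := @measurable_modul R.
have ma : measurable_fun setT (ampl u) := measurable_fnorm d1 d2.
rewrite -(@eint4E (fun z => ((xi_jb z.2 `^ s * modul z `^ b * ampl u z) ^+ 2)%:E)); first last.
- by move=> z; rewrite lee_fin sqr_ge0.
- by apply/measurable_EFinP; mfun.
congr eint4; apply/funext => t; apply/funext => x; apply/funext => y; apply/funext => z.
congr EFin; rewrite [RHS]exprMn; congr (_ * _).
by rewrite /ampl /fnorm sqr_sqrtr ?addr_ge0 ?sqr_ge0// ft_reE// ft_imE.
Qed.

Lemma dominated_cmul (u v : cfun R) :
  dominated (u.1 \o @pt4 R) -> dominated (u.2 \o @pt4 R) ->
  dominated (v.1 \o @pt4 R) -> dominated (v.2 \o @pt4 R) ->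
  dominated ((cmul u v).1 \o @pt4 R) /\ dominated ((cmul u v).2 \o @pt4 R).
Proof.
move=> du1 du2 dv1 dv2.
have [N1 _ HN1] := dominated_bounded dv1; have [N2 _ HN2] := dominated_bounded dv2.
split; apply: dominatedD.
- exact: (dominatedM du1 dv1.1 HN1).
- by apply: dominatedN; exact: (dominatedM du2 dv2.1 HN2).
- exact: (dominatedM du1 dv2.1 HN2).
- exact: (dominatedM du2 dv1.1 HN1).
Qed.

Lemma sqrte_scale (c : R) (x y : \bar R) : (0 <= c%:E)%E -> (0 <= x)%E ->
  ((Num.sqrt c)%:E * sqrte x * sqrte y = sqrte (c%:E * (x * y)))%E.
Proof. by move=> c0 x0; rewrite sqrteM// sqrteM// muleA. Qed.

End wave_sobolev.

Theorem theorem1 (R : realType) (s0 s1 s2 b2 : R) :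
  1 / 2 < b2 ->
  3 / 2 <= s0 + s1 + s2 ->
  Num.max s0 (Num.max s1 s2) <= s0 + s1 + s2 ->
  ~ (s0 + s1 + s2 = 3 / 2 /\ s0 + s1 + s2 = Num.max s0 (Num.max s1 s2)) ->
  is_product s0 s1 s2 0 0 b2.
Proof.
move=> b12 S32 Smax nS.
have [C C0 HC] := weighted_bilinear b12 S32 Smax nS.
pose p : R := (2 * pi) ^+ 4.
have p0 : 0 < p by rewrite exprn_gt0// mulr_gt0// pi_gt0.
(* The convolution bounds p |(uv)~|, not |(uv)~|; the factor p leaves the square norm as p^2, and
   the root appears because [C] compares squares of norms. *)
exists (Num.sqrt (C / p ^+ 2)) => u v [su1 su2] [sv1 sv2].
have du1 := schwartz_dominated su1; have du2 := schwartz_dominated su2.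
have dv1 := schwartz_dominated sv1; have dv2 := schwartz_dominated sv2.
have [dw1 dw2] := dominated_cmul du1 du2 dv1 dv2.
have mU : measurable_fun setT (ampl u) := measurable_fnorm du1 du2.
have mV : measurable_fun setT (ampl v) := measurable_fnorm dv1 dv2.
have mW : measurable_fun setT (ampl (cmul u v)) := measurable_fnorm dw1 dw2.
have mpW : measurable_fun setT (fun z => p * ampl (cmul u v) z) by mfun.
have pW0 z : 0 <= p * ampl (cmul u v) z by apply: mulr_ge0; [exact: ltW|exact: fnorm_ge0].
have := HC (ampl u) (ampl v) _ mU mV mpW (fnorm_ge0 _ _) (fnorm_ge0 _ _) pW0
  (fun z => convolution_le z du1 du2 dv1 dv2 (schwartz_lipschitz4 sv1) (schwartz_lipschitz4 sv2)).
rewrite (Hsb_normE _ _ dw1 dw2) (Hsb_normE _ _ du1 du2) (Hsb_normE _ _ dv1 dv2).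
have E (s : R) (f : measurableTypeR R * (measurableTypeR R * (measurableTypeR R * measurableTypeR R)) -> R) : (\int[leb4 R]_z ((xi_jb z.2 `^ s * modul z `^ 0 * f z) ^+ 2)%:E =
    \int[leb4 R]_z ((xi_jb z.2 `^ s * f z) ^+ 2)%:E)%E.
  by apply: eq_integral => z _; rewrite powRr0 mulr1.
rewrite oppr0 !E.
set X := (\int[_]_z ((xi_jb z.2 `^ s1 * ampl u z) ^+ 2)%:E)%E.
set Y := (\int[_]_z ((xi_jb z.2 `^ s2 * modul z `^ b2 * ampl v z) ^+ 2)%:E)%E.
move=> H.
have X0 : (0 <= X)%E by apply: integral_ge0 => z _; rewrite lee_fin sqr_ge0.
have Y0 : (0 <= Y)%E by apply: integral_ge0 => z _; rewrite lee_fin sqr_ge0.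
have Cp0 : 0 <= C / p ^+ 2 by rewrite divr_ge0// sqr_ge0.
have Cp0' : (0 <= (C / p ^+ 2)%:E)%E by exact: Cp0.
rewrite (sqrte_scale Y Cp0' X0) lee_sqrt; last exact: (mule_ge0 Cp0' (mule_ge0 X0 Y0)).
have mj := @measurable_xi_jb R.
have mpw2 : measurable_fun setT (fun z : measurableTypeR R * (measurableTypeR R * (measurableTypeR R * measurableTypeR R)) => ((xi_jb z.2 `^ (- s0) * (p * ampl (cmul u v) z)) ^+ 2)%:E).
  by apply/measurable_EFinP; mfun.
have -> : (\int[leb4 R]_z ((xi_jb z.2 `^ (- s0) * ampl (cmul u v) z) ^+ 2)%:E =
    (p ^- 2)%:E * \int[leb4 R]_z ((xi_jb z.2 `^ (- s0) * (p * ampl (cmul u v) z)) ^+ 2)%:E)%E.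
  rewrite -(ge0_integralZl (leb4 R) measurableT mpw2); last 2 first.
  - by move=> z _; rewrite lee_fin sqr_ge0.
  - by rewrite lee_fin invr_ge0 sqr_ge0.
  apply: eq_integral => z _; rewrite -EFinM; congr EFin.
  have r (q x w : R) : q != 0 -> (x * w) ^+ 2 = q ^- 2 * (x * (q * w)) ^+ 2 by move=> q0; field.
  exact: r (lt0r_neq0 p0).
have ip0 : (0 <= (p ^- 2)%:E)%E by rewrite lee_fin invr_ge0 sqr_ge0.
rewrite (_ : (C / p ^+ 2)%:E = ((p ^- 2)%:E * C%:E)%E); last by rewrite -EFinM mulrC.
by rewrite -[leRHS]muleA; exact: (lee_wpmul2l ip0 H).
Qed.
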